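(* Let $\Omega\subset\mathbb{R}^n$ ($n\ge 1$) be a bounded open set, let $1\le k\le n$, let $p>k$, and let $\delta$ be an admissible function for the exponent $p$. Let $f_m=(f_m^1,\dots,f_m^k)\colon\Omega\to\mathbb{R}^k$, $m\in\mathbb{N}$, be a sequence of mappings locally bounded in $W^{1,p),\delta}(\Omega)$. Assume that $f_m$ converges in $L^1_{\rm loc}(\Omega)$ to $f_0=(f_0^1,\dots,f_0^k)$ as $m\to\infty$. Then the sequence of $k$-forms $\omega_m=df_m^1\wedge\dots\wedge df_m^k$ converges to $\omega_0=df_0^1\wedge\dots\wedge df_0^k$ in $D'$ (in the sense of distributions on $\Omega$), and $(\omega_m)_{m\in\mathbb{N}}$ is locally bounded in $L^{\frac{p}{k}),\delta}(\Omega)$.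
   Context: Admissible functions: for an exponent $q>1$ put $\varepsilon_0=q-1$. A function $\delta\in L^\infty((0,\varepsilon_0),(0,1])$ is admissible for the exponent $q$ if it is left continuous, $\lim_{\varepsilon\to0+}\delta(\varepsilon)=0$, and $\varepsilon\mapsto\delta(\varepsilon)^{\frac{1}{q-\varepsilon}}$ is nondecreasing. Grand Lebesgue space with respect to $\delta$: for a bounded open set $U\subset\mathbb{R}^n$ and $q>1$, $L^{q),\delta}(U)$ consists of all measurable $g\colon U\to\mathbb{R}$ with $$\|g\|_{L^{q),\delta}(U)}=\sup_{0<\varepsilon<q-1}\left(\frac{\delta(\varepsilon)}{|U|}\int_U|g(x)|^{q-\varepsilon}\,dx\right)^{\frac{1}{q-\varepsilon}}<\infty .$$ For vector-valued functions, matrices and differential forms, $|g|$ is the Euclidean norm of the components (coefficients). The norm in $L^{\frac{p}{k}),\delta}$ is given by this formula with $q=p/k$ and the same $\delta$, restricted to $(0,\frac pk-1)$. Grand Sobolev space: $W^{1,p),\delta}(U)$ consists of the weakly differentiable mappings $f$ such that $f$ and its weak differential matrix $Df$ belong to $L^{p),\delta}(U)$, with norm $\|f\|_{L^{p),\delta}(U)}+\|Df\|_{L^{p),\delta}(U)}$. Locally bounded: a sequence is locally bounded in one of these spaces over $\Omega$ if, for every nonempty open $U$ with compact closure contained in $\Omega$, the restrictions to $U$ belong to the corresponding space over $U$ and their norms are bounded uniformly in $m$. Forms: $df^i$ is the weak differential of $f^i$, and the wedge product is taken pointwise a.e., so that $df^1\wedge\dots\wedge df^k=\sum_J \frac{\partial(f^1,\dots,f^k)}{\partial(x^{j_1},\dots,x^{j_k})}\,dx^{j_1}\wedge\dots\wedge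 dx^{j_k}$, the sum being over $J=(j_1<\dots<j_k)$; the coefficients are the $k\times k$ minors of $Df$. (Under the hypotheses, $f_0\in W^{1,q}_{\rm loc}(\Omega)$ for all $1\le q<p$, so $\omega_0$ is well defined.) Convergence in $D'$: a sequence of functions $g_m$ converges to $g_0$ in $D'$ if $\int_\Omega g_m\varphi\,dx\to\int_\Omega g_0\varphi\,dx$ for every $\varphi\in C_0^\infty(\Omega)$ (smooth with compact support in $\Omega$); a sequence of forms converges in $D'$ if each coefficient does. *)

(* Defs.v *)
From HB Require Import structures.
From mathcomp Require Import all_boot all_order all_algebra.
From mathcomp Require Import all_classical all_reals all_analysis.

Set Implicit Arguments.
Unset Strict Implicit.
Unset Printing Implicit Defensive.

Import Order.TTheory GRing.Theory Num.Theory.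
Import numFieldNormedType.Exports.

Local Open Scope classical_set_scope.
Local Open Scope ring_scope.

Definition measure_rV_display : measure_display -> measure_display.
Proof. exact. Qed.

Section measurable_rV.
Context {d} {T : measurableType d} (n : nat).

Definition rV_coord (i : 'I_n) (x : 'rV[T]_n) : T := x ord0 i.

Let rV_set0 : g_sigma_preimage rV_coord set0.
Proof. exact: sigma_algebra0. Qed.

Let rV_setC A : g_sigma_preimage rV_coord A -> g_sigma_preimage rV_coord (~` A).
Proof. exact: sigma_algebraC. Qed.

Let rV_bigcup (F : (set 'rV[T]_n)^nat) :
  (forall i, g_sigma_preimage rV_coord (F i)) ->
  g_sigma_preimage rV_coord (\bigcup_i (F i)).
Proof. exact: sigma_algebra_bigcup. Qed.

(* The product sigma-algebra, i.e., the one generated by the coordinates. For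
   the Borel sets of R, this is the Borel sigma-algebra of R^n. *)
HB.instance Definition _ := @isMeasurable.Build (measure_rV_display d)
  'rV[T]_n (g_sigma_preimage rV_coord) rV_set0 rV_setC rV_bigcup.

Lemma measurable_rV_coord (i : 'I_n) :
  measurable_fun [set: 'rV[T]_n] (rV_coord i).
Proof.
move=> _ Y mY; rewrite setTI; apply: sub_sigma_algebra => /=.
rewrite -bigcup_seq/=; exists i => /=; first by rewrite mem_index_enum.
by exists Y => //; rewrite setTI.
Qed.

Lemma measurable_fun_rVP d' (T' : measurableType d') (f : T' -> 'rV[T]_n) :
  (forall i, measurable_fun setT (rV_coord i \o f)) -> measurable_fun setT f.
Proof.
move=> mf.
suff: g_sigma_preimage (fun i => rV_coord i \o f) `<=` measurable.
  rewrite g_sigma_preimage_comp => prefS _ A mA.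
  by apply: prefS; exists A.
apply: smallest_sub; first exact: sigma_algebra_measurable.
rewrite -bigcup_seq/= => A [i _] [B mB <-].
exact: mf.
Qed.

End measurable_rV.

Section lebesgue_rV.
Context {R : realType}.

Definition rV_cons n (x : R * 'rV[R]_n) : 'rV[R]_n.+1 :=
  row_mx (x.1%:M : 'rV_1) x.2.

Lemma measurable_rV_cons n : measurable_fun setT (@rV_cons n).
Proof.
apply: measurable_fun_rVP => i.
have [j|j] := split_ordP (i : 'I_(1 + n)).
- move=> ->.
  rewrite (_ : _ \o _ = fst)//.
  apply/funext => x /=.
  by apply: etrans (row_mxEl _ _ _ _) _; rewrite mxE !ord1 eqxx mulr1n.
- move=> ->.
  rewrite (_ : _ \o _ = rV_coord j \o snd).
    apply: measurableT_comp => //; exact: measurable_rV_coord.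
  by apply/funext => x; exact: row_mxEr.
Qed.

(* The image of the measure lambda^1 x mu under R x R^n ~ R^(n+1). *)
Definition lebesgue_step n (mu : {sigma_finite_measure set 'rV[R]_n -> \bar R})
  : set 'rV[R]_n.+1 -> \bar R :=
  pushforward (@lebesgue_measure R \x mu)%E (@rV_cons n).

Section step.
Variables (n : nat) (mu : {sigma_finite_measure set 'rV[R]_n -> \bar R}).
Local Open Scope ereal_scope.

Let step0 : lebesgue_step mu set0 = 0.
Proof. by rewrite /lebesgue_step /pushforward preimage_set0 measure0. Qed.

Let step_ge0 A : 0 <= lebesgue_step mu A.
Proof. by rewrite /lebesgue_step /pushforward measure_ge0. Qed.

Let step_sigma_additive : semi_sigma_additive (lebesgue_step mu).
Proof.
move=> F mF tF mUF; rewrite /lebesgue_step /pushforward preimage_bigcup.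
apply: measure_semi_sigma_additive.
- by move=> i; rewrite -[X in measurable X]setTI; exact: measurable_rV_cons.
- apply/trivIsetP => /= i j _ _ ij; rewrite -preimage_setI.
  by move/trivIsetP : tF => /(_ _ _ _ _ ij) ->//; rewrite preimage_set0.
- by rewrite -preimage_bigcup -[X in measurable X]setTI; exact: measurable_rV_cons.
Qed.

HB.instance Definition _ := isMeasure.Build _ _ _ (lebesgue_step mu)
  step0 step_ge0 step_sigma_additive.

Let rV_uncons (x : 'rV[R]_n.+1) : R * 'rV[R]_n :=
  (x ord0 ord0, \row_j x ord0 (lift ord0 j)).

Let rV_consK : cancel (@rV_cons n) rV_uncons.
Proof.
move=> [a v]; rewrite /rV_uncons /rV_cons; congr pair => /=.
  rewrite (_ : ord0 = lshift n (ord0 : 'I_1)); last exact/val_inj.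
  by apply: etrans (row_mxEl _ _ _ _) _; rewrite mxE ord1 eqxx mulr1n.
apply/rowP => j; rewrite mxE.
rewrite (_ : lift ord0 j = rshift 1 j); last exact/val_inj.
exact: row_mxEr.
Qed.

Let measurable_rV_uncons : measurable_fun setT rV_uncons.
Proof.
apply/measurable_fun_pairP; split.
  exact: (measurable_rV_coord ord0).
apply: measurable_fun_rVP => i.
rewrite (_ : _ \o _ = rV_coord (lift ord0 i)); first exact: measurable_rV_coord.
by apply/funext => x; rewrite /rV_coord /= mxE.
Qed.

Let step_sigma_finite : sigma_finite setT (lebesgue_step mu).
Proof.
have /sigma_finiteP[F [TF ndF Foo]] := sigma_finiteT (@lebesgue_measure R).
have /sigma_finiteP[G [TG ndG Goo]] := sigma_finiteT mu.
exists (fun i => rV_uncons @^-1` (F i `*` G i)).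
  apply/seteqP; split=> // x _.
  have [i _ Fi] : (\bigcup_i F i) (rV_uncons x).1 by rewrite -TF.
  have [j _ Gj] : (\bigcup_j G j) (rV_uncons x).2 by rewrite -TG.
  exists (maxn i j) => //; split.
  - by move: Fi; exact/subsetPset/ndF/leq_maxl.
  - by move: Gj; exact/subsetPset/ndG/leq_maxr.
move=> i; have [mF Fy] := Foo i; have [mG Gy] := Goo i; split.
  rewrite -[X in measurable X]setTI; apply: measurable_rV_uncons => //.
  exact: measurableX.
rewrite /lebesgue_step /pushforward -comp_preimage.
rewrite (_ : _ \o _ = id); last by apply/funext => x /=; rewrite rV_consK.
by rewrite preimage_id product_measure1E// lte_mul_pinfty// ge0_fin_numE.
Qed.

HB.instance Definition _ := Measure_isSigmaFinite.Build _ _ _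
  (lebesgue_step mu) step_sigma_finite.

End step.

Fixpoint borel_lebesgue n : {sigma_finite_measure set 'rV[R]_n -> \bar R} :=
  if n is m.+1 then lebesgue_step (borel_lebesgue m)
  else \d_(0 : 'rV[R]_0).

Lemma borel_lebesgue_setX n (A : 'I_n -> set R) :
  (forall i, measurable (A i)) ->
  borel_lebesgue n [set x | forall i, A i (x ord0 i)] =
  (\prod_i lebesgue_measure (A i))%E.
Proof.
elim: n A => [|n IHn] A mA.
  rewrite big_ord0 /= diracE mem_set//=; by case.
rewrite big_ord_recl/= /lebesgue_step /pushforward -IHn//.
rewrite -(product_measure1E (@lebesgue_measure R) (borel_lebesgue n));
  [|exact: mA|]; last first.
  rewrite [X in measurable X](_ : _ =
      \bigcap_(i in [set: 'I_n]) (rV_coord i @^-1` A (lift ord0 i))).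
    apply: fin_bigcap_measurable => // i _.
    rewrite -[X in measurable X]setTI.
    exact: measurable_rV_coord.
  by apply/seteqP; split=> x /= h i; [move=> _; exact: h|exact: h i I].
congr ((_ : set _ -> \bar R) _).
apply/seteqP; split=> -[t v] /=.
- move=> h; split => [|i].
    have := h ord0.
    rewrite (_ : ord0 = lshift n (ord0 : 'I_1)); last exact/val_inj.
    by rewrite [rV_cons _ _ _](row_mxEl (t%:M : 'rV_1) v ord0 ord0) mxE eqxx mulr1n.
  have := h (lift ord0 i).
  rewrite [in X in X -> _](_ : lift ord0 i = rshift 1 i); last exact/val_inj.
  by rewrite [rV_cons _ _ _](row_mxEr (t%:M : 'rV_1) v ord0 i)
    (_ : rshift 1 i = lift ord0 i)//; exact/val_inj.
- move=> [At Av] i; have [j|j] := split_ordP (i : 'I_(1 + n)) => ->.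
    rewrite [rV_cons _ _ _](row_mxEl (t%:M : 'rV_1) v ord0 j) mxE ord1 eqxx mulr1n.
    by rewrite (_ : lshift n ord0 = ord0)//; exact/val_inj.
  rewrite [rV_cons _ _ _](row_mxEr (t%:M : 'rV_1) v ord0 j).
  by rewrite (_ : rshift 1 j = lift ord0 j)//; exact/val_inj.
Qed.

End lebesgue_rV.

Section lebesgue_measure_rV.
Context {R : realType} (n : nat).

(* R^n with the sigma-algebra of Lebesgue measurable sets; it is convertible
   to 'rV[R]_n, whose own measurable sets are the Borel sets. *)
Definition lebesgue_space : measurableType _ :=
  caratheodory_type ((@borel_lebesgue R n)^*)%mu.

Definition lebesgue_rV : {measure set lebesgue_space -> \bar R} :=
  @completed_measure_extension _ _ _ (@borel_lebesgue R n).

Definition lebesgue_measurable (U : set 'rV[R]_n) (g : 'rV[R]_n -> R) : Prop :=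
  measurable_fun (U : set lebesgue_space) (g : lebesgue_space -> R).

Definition integral_rV (U : set 'rV[R]_n) (g : 'rV[R]_n -> \bar R) : \bar R :=
  (\int[lebesgue_rV]_(x in U) g x)%E.

Definition Rintegral_rV (U : set 'rV[R]_n) (g : 'rV[R]_n -> R) : R :=
  Rintegral lebesgue_rV U g.

Lemma lebesgue_rV_borel (A : set 'rV[R]_n) : measurable A ->
  lebesgue_rV A = @borel_lebesgue R n A.
Proof.
by move=> mA; rewrite /lebesgue_rV /= /completed_measure_extension
  measurable_mu_extE.
Qed.

End lebesgue_measure_rV.

Section distributions.
Context {R : realType} {n : nat}.
Implicit Types (U K : set 'rV[R]_n) (g phi : 'rV[R]_n -> R).

Definition locally_integrable_rV U g : Prop :=
  lebesgue_measurable U g /\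
  forall K, compact K -> K `<=` U ->
    (integral_rV K (fun x => `|g x|%:E) < +oo)%E.

Definition partial (j : 'I_n) g : 'rV[R]_n -> R :=
  fun x => derive g x (delta_mx 0 j).

Definition smooth phi : Prop :=
  forall s : seq 'I_n,
    continuous (foldr partial phi s) /\
    forall j x, derivable (foldr partial phi s) x (delta_mx 0 j).

Definition test_function U phi : Prop :=
  [/\ smooth phi, compact (closure [set x | phi x != 0]) &
      closure [set x | phi x != 0] `<=` U].

(* The functions are required to be locally integrable, so that they define
   distributions and all the integrals are those of integrable functions. *)
Definition cvg_distribution U (g : nat -> 'rV[R]_n -> R) g0 : Prop :=
  [/\ forall m, locally_integrable_rV U (g m), locally_integrable_rV U g0 &
      forall phi, test_function U phi ->
        Rintegral_rV U (fun x => g m x * phi x) @[m --> \oo] -->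
        Rintegral_rV U (fun x => g0 x * phi x)].

Definition compactly_inside U (Omega : set 'rV[R]_n) : Prop :=
  [/\ open U, U !=set0, compact (closure U) & closure U `<=` Omega].

End distributions.

Section weak_differential.
Context {R : realType} {n k : nat}.
Implicit Types (U : set 'rV[R]_n) (f : 'rV[R]_n -> 'rV[R]_k).

Definition is_weak_diff U f (D : 'rV[R]_n -> 'M[R]_(k, n)) : Prop :=
  [/\ forall i, locally_integrable_rV U (fun x => f x 0 i),
      forall i j, locally_integrable_rV U (fun x => D x i j) &
      forall i j phi, test_function U phi ->
        Rintegral_rV U (fun x => f x 0 i * partial j phi x) =
        - Rintegral_rV U (fun x => D x i j * phi x)].

Definition weakly_differentiable U f : Prop := exists D, is_weak_diff U f D.

(* The weak differential matrix is unique almost everywhere on U; this is some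
   representative of it, which is 0 if f is not weakly differentiable on U. *)
Definition weak_diff U f : 'rV[R]_n -> 'M[R]_(k, n) :=
  xget (fun=> 0) [set D | is_weak_diff U f D].

End weak_differential.

Section grand_spaces.
Context {R : realType} {n : nat}.
Implicit Types (U : set 'rV[R]_n) (p q : R) (delta : R -> R).

Record admissible q delta : Prop := {
  admissible_measurable : measurable_fun `]0, q - 1[%classic delta;
  admissible_range : forall e, e \in `]0, q - 1[ -> 0 < delta e <= 1;
  admissible_left_continuous :
    forall e, e \in `]0, q - 1[ -> delta x @[x --> e^'-] --> delta e;
  admissible_cvg0 : delta x @[x --> 0^'+] --> (0 : R);
  admissible_nondecreasing :
    {in `]0, q - 1[ &, {homo (fun e => delta e `^ (q - e)^-1) : x y / x <= y}}
}.

Definition euclidean_norm (I : finType) (v : I -> R) : R :=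
  Num.sqrt (\sum_i v i ^+ 2).

Definition grand_norm (I : finType) U q delta (g : 'rV[R]_n -> I -> R)
    : \bar R :=
  ereal_sup [set
    (((delta e / fine (lebesgue_rV n U))%:E *
      integral_rV U (fun x => (euclidean_norm (g x) `^ (q - e))%:E))
     `^ (q - e)^-1)%E | e in `]0, q - 1[%classic].

Definition grand_lebesgue (I : finType) U q delta (g : 'rV[R]_n -> I -> R)
    : Prop :=
  (forall i, lebesgue_measurable U (g ^~ i)) /\
  (grand_norm U q delta g < +oo)%E.

Definition mx_coefs a b (g : 'rV[R]_n -> 'M[R]_(a, b))
    : 'rV[R]_n -> 'I_a * 'I_b -> R :=
  fun x ij => g x ij.1 ij.2.

Definition grand_sobolev k U p delta (f : 'rV[R]_n -> 'rV[R]_k) : Prop :=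
  [/\ weakly_differentiable U f,
      grand_lebesgue U p delta (mx_coefs f) &
      grand_lebesgue U p delta (mx_coefs (weak_diff U f))].

Definition grand_sobolev_norm k U p delta (f : 'rV[R]_n -> 'rV[R]_k) : \bar R :=
  (grand_norm U p delta (mx_coefs f) +
   grand_norm U p delta (mx_coefs (weak_diff U f)))%E.

Definition locally_bounded_grand_lebesgue (I : finType) (Omega : set 'rV[R]_n)
    q delta (g : nat -> 'rV[R]_n -> I -> R) : Prop :=
  forall U, compactly_inside U Omega ->
    exists M : R, forall m,
      grand_lebesgue U q delta (g m) /\ (grand_norm U q delta (g m) <= M%:E)%E.

Definition locally_bounded_grand_sobolev k (Omega : set 'rV[R]_n)
    p delta (f : nat -> 'rV[R]_n -> 'rV[R]_k) : Prop :=
  forall U, compactly_inside U Omega ->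
    exists M : R, forall m,
      grand_sobolev U p delta (f m) /\
      (grand_sobolev_norm U p delta (f m) <= M%:E)%E.

Definition cvg_L1loc k (Omega : set 'rV[R]_n)
    (f : nat -> 'rV[R]_n -> 'rV[R]_k) (f0 : 'rV[R]_n -> 'rV[R]_k) : Prop :=
  [/\ forall m i, locally_integrable_rV Omega (fun x => f m x 0 i),
      forall i, locally_integrable_rV Omega (fun x => f0 x 0 i) &
      forall K, compact K -> K `<=` Omega ->
        integral_rV K (fun x => (euclidean_norm (fun i => f m x 0 i - f0 x 0 i))%:E)
          @[m --> \oo] --> (0 : \bar R)].

End grand_spaces.

Section forms.
Context {R : realType} {n k : nat}.

(* A k-form is given by its coefficients on dx^J(0) /\ ... /\ dx^J(k-1), for
   the increasing maps J : 'I_k -> 'I_n. *)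
Definition multi_index : finType :=
  {J : {ffun 'I_k -> 'I_n} |
    [forall a : 'I_k, forall b : 'I_k, (a < b)%N ==> (J a < J b)%N]}.

(* The coefficients of the exterior product a_0 /\ ... /\ a_(k-1) of the
   covectors a_i = \sum_j (a_i)_j dx^j. *)
Definition wedge (a : 'I_k -> 'rV[R]_n) (J : multi_index) : R :=
  \det (\matrix_(r < k, c < k) a r 0 (val J c)).

(* The k-form df^1 /\ ... /\ df^k, whose coefficients are the k x k minors of
   the weak differential matrix. *)
Definition wedge_diff (U : set 'rV[R]_n) (f : 'rV[R]_n -> 'rV[R]_k)
    : 'rV[R]_n -> multi_index -> R :=
  fun x => wedge (fun i => row i (weak_diff U f x)).

End forms.

(* Main.v *)
Require Import Defs.
From HB Require Import structures.
From mathcomp Require Import all_boot all_order all_algebra perm.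
From mathcomp Require Import all_classical all_reals all_analysis.
From mathcomp Require Import ring lra measurable_realfun.

(** Minors have a divergence structure: if the weak gradients of u_0, ..., u_(k-1)
    are in L^k, then the integral of phi det(Du_0, ..., Du_(k-1)) is minus that of
    u_0 det(Dphi, Du_1, ..., Du_(k-1)). This is clear for smooth functions, since
    d(du) = 0, and extends by mollification. Expanding the last determinant along
    its first row gives minors of order k-1, tested against u_0 times a derivative
    of phi; so minors are weakly continuous, by induction on k, as soon as the
    maps converge in L^k. This strong convergence is an interpolation between the
    assumed convergence in L^1 and the boundedness in L^q for some k < q < p, to
    which the bound on the grand norms reduces on taking epsilon = p - q. The limit
    map is weakly differentiable because its gradients on an exhaustion of Omega
    exist by weak compactness in L^q (a consequence of uniform integrability and
    of the Radon-Nikodym theorem) and are unique almost everywhere. Finally, a minor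
    is at most C |Df|^k, and delta(epsilon) <= delta(k epsilon) because
    delta(epsilon)^(1/(p - epsilon)) is nondecreasing and delta <= 1; so the grand
    norm of the minors is at most C times the k-th power of that of Df. *)

Set Implicit Arguments.
Unset Strict Implicit.
Unset Printing Implicit Defensive.

Import Order.TTheory GRing.Theory Num.Theory.
Import numFieldNormedType.Exports.

Local Open Scope classical_set_scope.
Local Open Scope ring_scope.

(** * Lebesgue measure on R^n *)

(** The gradients converge only weakly, so a product of k of them has no evident limit. Integration
    by parts leaves one factor without derivative, and that factor converges strongly. It is needed
    in L^k, because Young's inequality pairs it with k - 1 rows bounded in L^k; hence q is strictly
    above k, to leave room for interpolation, and strictly below p, so that epsilon = p - q is a
    parameter of the grand norm. As u_0 is not smooth, u_0 times a derivative of phi is not a test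
    function: in the induction u_0 is replaced by a smooth h close to it in L^k, with an error that
    is uniform along the sequence. Another obstacle is that weak differentials are chosen set by
    set. The hypothesis bounds [weak_diff U (f m)] for each U inside Omega, while the forms are
    built on [weak_diff Omega (f m)], whose very existence has to be proved by gluing; the bounds
    are then carried over by uniqueness almost everywhere. Functions on U are extended by zero, so
    that integrals, translations and convolutions live on the whole space. *)

Section borel_rV.
Context {R : realType} {n : nat}.
Implicit Types (x y : 'rV[R]_n).

(** The norm of ['rV[R]_n] is the maximum norm, so balls are open boxes. The condition 0 < e is kept
    apart since for n = 0 there is no coordinate to imply it. *)
Lemma rV_ballP x y (e : R) : ball x e y <-> 0 < e /\ forall i, `|x 0 i - y 0 i| < e.
Proof.
split=> [[e0 h]|[e0 h]]; split=> //.
- by move=> i; exact: (h 0 i).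
- by move=> i j; rewrite (ord1 i); exact: h.
Qed.

Lemma measurable_rV_ball x (e : R) : measurable (ball x e).
Proof.
have [e0|e0] := ltP 0 e; last first.
  rewrite (_ : ball x e = set0)//; apply/seteqP; split=> // y /rV_ballP[].
  by rewrite ltNge e0.
rewrite (_ : ball x e = \bigcap_(i in [set: 'I_n]) (rV_coord i @^-1` ball (x 0 i) e)).
  apply: fin_bigcap_measurable => // i _.
  rewrite -[X in measurable X]setTI; apply: measurable_rV_coord => //.
  by apply: open_measurable; exact: ball_open.
apply/seteqP; split=> y.
- by move=> /rV_ballP[_ h] i _ /=; exact: h.
- by move=> h; apply/rV_ballP; split=> // i; exact: (h i I).
Qed.

(** The measurable sets are generated by the coordinates and not by the topology; an open set is
    reached as the countable union of the boxes with rational centre and radius 1/(m + 1) that it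
    contains. *)
Lemma open_measurable_rV (A : set 'rV[R]_n) : open A -> measurable A.
Proof.
move=> oA.
pose c (p : 'rV[rat]_n * nat) := ball (map_mx ratr p.1 : 'rV[R]_n) (p.2.+1%:R^-1 : R).
pose F (k : nat) : set 'rV[R]_n :=
  if unpickle k is Some p then if `[< c p `<=` A >] then c p else set0 else set0.
rewrite (_ : A = \bigcup_k F k).
  apply: bigcup_measurable => k _; rewrite /F.
  case: unpickle => [p|]; last exact: measurable0.
  by case: asboolP => _; [exact: measurable_rV_ball|exact: measurable0].
apply/seteqP; split=> [x Ax|x [k _]]; last first.
  by rewrite /F; case: unpickle => // p; case: asboolP => // h /h.
have /nbhs_ballP[e /= e0 xeA] : nbhs x A by exact: open_nbhs_nbhs.
have [m me] : exists m, (m.+1%:R^-1 : R) < e / 2.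
  have e2 : 0 < e / 2 by rewrite divr_gt0.
  by have [m _ /(_ m (leqnn m))] := near_infty_natSinv_lt (PosNum e2); exists m.
have m0 : 0 < (m.+1%:R^-1 : R) by [].
have /choice[q hq] : forall i, exists q : rat, `|x 0 i - ratr q| < m.+1%:R^-1.
  move=> i; have [|q] := @rat_in_itvoo R (x 0 i - m.+1%:R^-1) (x 0 i + m.+1%:R^-1).
    by rewrite ltrBlDr -addrA ltrDl addr_gt0.
  by rewrite in_itv/= => /andP[h1 h2]; exists q; rewrite distrC ltr_distl; apply/andP; split.
exists (pickle ((\row_i q i) : 'rV[rat]_n, m)) => //.
rewrite /F pickleK; case: asboolP => [_|].
  by apply/rV_ballP; split=> // i; rewrite !mxE distrC; exact: hq.
move=> H; exfalso; apply: H => y /rV_ballP[_ h]; apply: xeA.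
apply/rV_ballP; split=> // i; move: (hq i) (h i) me; rewrite !mxE/= !ltr_norml.
move: (_^-1) => d.
by move=> /andP[? ?] /andP[? ?] ?; apply/andP; split; lra.
Qed.

Lemma continuous_measurable_rV (f : 'rV[R]_n -> R) : continuous f ->
  measurable_fun [set: 'rV[R]_n] f.
Proof.
move=> cf; apply: (measurability _ (RGenOpens.measurableE R)).
move=> _ [_ [a [b ->] <-]]; rewrite setTI; apply: open_measurable_rV.
by apply: open_comp; [move=> + _; exact: cf|exact: interval_open].
Qed.

Lemma lebesgue_space_borel (A : set 'rV[R]_n) :
  measurable A -> measurable (A : set (@lebesgue_space R n)).
Proof. exact: caratheodory_measurable_mu_ext. Qed.

Lemma open_lebesgue_measurable (A : set 'rV[R]_n) :
  open A -> measurable (A : set (@lebesgue_space R n)).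
Proof. by move=> /open_measurable_rV; exact: lebesgue_space_borel. Qed.

Lemma closed_lebesgue_measurable (A : set 'rV[R]_n) :
  closed A -> measurable (A : set (@lebesgue_space R n)).
Proof.
by move/closed_openC/open_lebesgue_measurable/measurableC; rewrite setCK.
Qed.

Lemma compact_lebesgue_measurable (A : set 'rV[R]_n) :
  compact A -> measurable (A : set (@lebesgue_space R n)).
Proof.
move=> cA; apply: closed_lebesgue_measurable; apply: compact_closed => //.
Qed.

Lemma borel_lebesgue_measurable (f : 'rV[R]_n -> R) :
  measurable_fun [set: 'rV[R]_n] f ->
  measurable_fun [set: @lebesgue_space R n] (f : @lebesgue_space R n -> R).
Proof.
move=> mf _ Y mY; rewrite setTI; apply: lebesgue_space_borel.
by rewrite -[X in measurable X]setTI; exact: mf.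
Qed.

Lemma continuous_lebesgue_measurable (f : 'rV[R]_n -> R) : continuous f ->
  measurable_fun [set: @lebesgue_space R n] (f : @lebesgue_space R n -> R).
Proof.
move=> cf; apply: borel_lebesgue_measurable; exact: continuous_measurable_rV.
Qed.

End borel_rV.

Section measure_preserving.
Context d (T : measurableType d) (R : realType) (mu : {measure set T -> \bar R}).
Variable tau : T -> T.
Hypotheses (mtau : measurable_fun setT tau)
  (mutau : forall A, measurable A -> mu (tau @^-1` A) = mu A).

Lemma ge0_integral_measure_preserving (f : T -> \bar R) :
  measurable_fun setT f -> (forall x, 0 <= f x)%E ->
  (\int[mu]_x f (tau x) = \int[mu]_x f x)%E.
Proof.
move=> mf f0; transitivity (\int[pushforward mu tau]_x f x)%E.
  by rewrite ge0_integral_pushforward.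
by apply: eq_measure_integral => // A mA _; exact: mutau.
Qed.

Lemma integrable_measure_preserving (f : T -> \bar R) :
  mu.-integrable setT f -> mu.-integrable setT (f \o tau).
Proof.
move=> /integrableP[mf foo]; apply/integrableP; split; first exact: (measurableT_comp mf mtau).
rewrite (ge0_integral_measure_preserving (f := fun x => `|f x|%E))//.
exact: measurableT_comp.
Qed.

Lemma integral_measure_preserving (f : T -> \bar R) :
  mu.-integrable setT f -> (\int[mu]_x f (tau x) = \int[mu]_x f x)%E.
Proof.
move=> intf; transitivity (\int[pushforward mu tau]_x f x)%E.
  rewrite integral_pushforward//.
    by have /integrableP[] := intf.
  exact: (integrable_measure_preserving intf).
by apply: eq_measure_integral => // A mA _; exact: mutau.
Qed.

End measure_preserving.

(** * Translation invariance of Lebesgue measure *)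

Section translation_invariance.
Context {R : realType}.

(** The translated measure also gives every []x, y]] its length, which characterizes Lebesgue
    measure on the line. *)
Lemma lebesgue_measure_translate (a : R) (A : set R) : measurable A ->
  lebesgue_measure ((fun t => a + t) @^-1` A) = lebesgue_measure A.
Proof.
move=> mA; apply/esym.
have ma : measurable_fun [set: R] (fun t : measurableTypeR R => a + t : measurableTypeR R).
  exact: measurable_funD.
pose m := measure_function_pushforward__canonical__measure_function_Measure
  (@lebesgue_measure R) ma.
apply: (@lebesgue_measure_unique _ m) => //= _ [[x y]] _ <-.
rewrite /pushforward (_ : _ @^-1` _ = `]x - a, y - a]%classic).
  by rewrite !lebesgue_measure_itv/= !lte_fin ltrD2r -!EFinB opprB addrA subrK.
by apply/seteqP; split=> t /=; rewrite !in_itv/= ltrBlDl lerBrDl.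
Qed.

Lemma measurable_rV_translate n (v : 'rV[R]_n) :
  measurable_fun [set: 'rV[R]_n] (fun x => v + x).
Proof.
apply: measurable_fun_rVP => i.
rewrite (_ : _ \o _ = fun x => v 0 i + rV_coord i x).
  by apply: measurable_funD => //; exact: measurable_rV_coord.
by apply/funext => x; rewrite /rV_coord /= mxE.
Qed.

Lemma rV_cons0 n (t : R) (x : 'rV[R]_n) : rV_cons (t, x) 0 0 = t.
Proof.
rewrite (_ : (0 : 'I_n.+1) = lshift n (ord0 : 'I_1)); last exact/val_inj.
by rewrite [rV_cons _ _ _](row_mxEl (t%:M : 'rV_1) x ord0 ord0) mxE eqxx mulr1n.
Qed.

Lemma rV_consS n (t : R) (x : 'rV[R]_n) j : rV_cons (t, x) 0 (lift ord0 j) = x 0 j.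
Proof.
rewrite (_ : lift ord0 j = rshift 1 j); last exact/val_inj.
by rewrite [rV_cons _ _ _](row_mxEr (t%:M : 'rV_1) x ord0 j).
Qed.

(** By induction on the dimension: the image of the product measure under the translation agrees
    with it on rectangles, which determine a product of sigma-finite measures. *)
Lemma borel_lebesgue_translate n (v : 'rV[R]_n) (A : set 'rV[R]_n) :
  measurable A -> borel_lebesgue n ((fun x => v + x) @^-1` A) = borel_lebesgue n A.
Proof.
elim: n => [|n IHn] in v A *.
  move=> mA; congr (borel_lebesgue 0 _); apply/seteqP; split=> x /=;
  by rewrite (thinmx0 (v + x)) (thinmx0 x).
move=> mA /=; rewrite /lebesgue_step /pushforward.
set B := rV_cons (n:=n) @^-1` A.
have mB : measurable B.
  by rewrite -[X in measurable X]setTI; exact: measurable_rV_cons.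
pose v' := \row_j v 0 (lift ord0 j).
pose T (p : measurableTypeR R * 'rV[R]_n) : measurableTypeR R * 'rV[R]_n :=
  (v 0 0 + p.1, v' + p.2).
have mT : measurable_fun setT T.
  apply/measurable_fun_pairP; split.
    by apply: measurable_funD => //; exact: measurable_fst.
  exact: (measurableT_comp (measurable_rV_translate v') measurable_snd).
pose m := measure_function_pushforward__canonical__measure_function_Measure
  (@lebesgue_measure R \x borel_lebesgue n)%E mT.
rewrite (_ : _ @^-1` _ = T @^-1` B); last first.
  have TE t x : rV_cons (T (t, x)) = v + rV_cons (t, x).
    apply/rowP => i; rewrite [RHS](_ : _ = v 0 i + rV_cons (t, x) 0 i); last first.
      exact: mxE.
    by case: (unliftP ord0 i) => [j|] ->; rewrite /T ?rV_consS ?rV_cons0// !mxE.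
  by apply/seteqP; split=> -[t x]; rewrite /B /= TE.
apply/esym; rewrite -[RHS]/(m B).
apply: product_measure_unique => // C D mC mD.
rewrite /m /= /pushforward.
rewrite (_ : _ @^-1` _ = ((fun t => v 0 0 + t) @^-1` C) `*` ((fun x => v' + x) @^-1` D))//.
rewrite product_measure1E.
- by apply: f_equal2; [exact: lebesgue_measure_translate|exact: IHn].
- by rewrite -[X in measurable X]setTI; exact: measurable_funD.
- by rewrite -[X in measurable X]setTI; exact: measurable_rV_translate.
Qed.

Variable n : nat.
Implicit Types (v : 'rV[R]_n) (A : set 'rV[R]_n).

Lemma preimage_translateK v A :
  (fun x => - v + x) @^-1` ((fun x => v + x) @^-1` A) = A.
Proof. by rewrite -comp_preimage; apply/seteqP; split => x /=; rewrite addNKr. Qed.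

(** Translating a Borel cover of A keeps its total measure; the reverse inequality will come from
    the opposite translation. *)
Let mu_ext_translate_le v A :
  (mu_ext (@borel_lebesgue R n) ((fun x => (v + x)%R) @^-1` A)
    <= mu_ext (@borel_lebesgue R n) A)%E.
Proof.
apply: le_ereal_inf_tmp => _ [F [mF AF] <-].
apply: ereal_inf_lbound; exists (fun i => (fun x => v + x) @^-1` F i).
  split=> [i|x /=]; first by rewrite -[X in measurable X]setTI; exact: measurable_rV_translate.
  by move=> /AF[i _ Fi]; exists i.
by apply: eq_eseriesr => i _; rewrite borel_lebesgue_translate.
Qed.

Lemma mu_ext_translate v A :
  mu_ext (@borel_lebesgue R n) ((fun x => v + x) @^-1` A)
  = mu_ext (@borel_lebesgue R n) A.
Proof.
apply/eqP; rewrite eq_le mu_ext_translate_le/=.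
by rewrite -{1}(preimage_translateK v A) mu_ext_translate_le.
Qed.

(** Lebesgue measurability is Caratheodory's condition, which is stated through the outer measure
    alone; the invariance of the latter transports it, the test set X being translated by - v. *)
Lemma measurable_lebesgue_translate v : measurable_fun [set: @lebesgue_space R n]
  ((fun x : 'rV[R]_n => v + x) : lebesgue_space n -> lebesgue_space n).
Proof.
move=> _ A mA; rewrite setTI.
suff : caratheodory_measurable (mu_ext (@borel_lebesgue R n)) ((fun x => v + x) @^-1` A) by [].
have mA' : caratheodory_measurable (mu_ext (@borel_lebesgue R n)) A := mA.
move=> X; have := preimage_translateK v A.
move: (_ @^-1` A) => A' A'E.
rewrite -(mu_ext_translate (- v) X) -(mu_ext_translate (- v) (X `&` A')).
rewrite -(mu_ext_translate (- v) (X `&` ~` A')).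
by rewrite !preimage_setI -preimage_setC A'E; exact: mA'.
Qed.

Lemma lebesgue_rV_translate v A :
  lebesgue_rV n ((fun x => v + x) @^-1` A) = lebesgue_rV n A.
Proof. exact: mu_ext_translate. Qed.

Lemma ge0_integral_translate v (f : @lebesgue_space R n -> \bar R) :
  measurable_fun setT f -> (forall x, 0 <= f x)%E ->
  (\int[@lebesgue_rV R n]_x f (v + x : 'rV[R]_n)%R = \int[@lebesgue_rV R n]_x f x)%E.
Proof.
exact: (@ge0_integral_measure_preserving _ (@lebesgue_space R n) R (@lebesgue_rV R n)
  (fun x => (v + x : 'rV[R]_n)%R) (measurable_lebesgue_translate v)
  (fun A _ => lebesgue_rV_translate v A) f).
Qed.

Lemma integrable_translate v (f : @lebesgue_space R n -> \bar R) :
  (@lebesgue_rV R n).-integrable setT f ->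
  (@lebesgue_rV R n).-integrable setT (fun x => f (v + x : 'rV[R]_n)).
Proof.
exact: (@integrable_measure_preserving _ (@lebesgue_space R n) R (@lebesgue_rV R n)
  (fun x => (v + x : 'rV[R]_n)%R) (measurable_lebesgue_translate v)
  (fun A _ => lebesgue_rV_translate v A) f).
Qed.

Lemma integral_translate v (f : @lebesgue_space R n -> \bar R) :
  (@lebesgue_rV R n).-integrable setT f ->
  (\int[@lebesgue_rV R n]_x f (v + x : 'rV[R]_n)%R = \int[@lebesgue_rV R n]_x f x)%E.
Proof.
exact: (@integral_measure_preserving _ (@lebesgue_space R n) R (@lebesgue_rV R n)
  (fun x => (v + x : 'rV[R]_n)%R) (measurable_lebesgue_translate v)
  (fun A _ => lebesgue_rV_translate v A) f).
Qed.

End translation_invariance.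

Section rV_norm.
Context {R : realType} {n : nat}.
Implicit Types x y : 'rV[R]_n.

Lemma rV_normP x (e : R) : `|x| < e <-> 0 < e /\ forall i, `|x 0 i| < e.
Proof.
have -> : `|x| < e <-> ball (0 : 'rV[R]_n) e x.
  by rewrite -ball_normE /= sub0r normrN.
by rewrite rV_ballP; split=> -[e0 h]; split=> // i; have := h i; rewrite mxE sub0r normrN.
Qed.

Lemma rV_coord_le_norm x i : `|x 0 i| <= `|x|.
Proof.
apply/ler_addgt0Pr => e e0.
have /rV_normP[_ /(_ i)/ltW//] : `|x| < `|x| + e by rewrite ltrDl.
Qed.

Lemma ball_normP x y (e : R) : ball x e y <-> `|x - y| < e.
Proof. by rewrite -ball_normE. Qed.

Lemma lipschitz_continuous_rV (f : 'rV[R]_n -> R) (L : R) :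
  (forall x y, `|f x - f y| <= L * `|x - y|) -> continuous f.
Proof.
move=> fL x; apply/(@cvgrPdist_lt _ _ _ (nbhs x) (@nbhs_filter _ x)) => e e0.
have L1 : 0 < `|L| + 1 by rewrite ltr_pwDr.
apply/nbhs_ballP; exists (e / (`|L| + 1)) => /=; first by rewrite divr_gt0.
move=> y /ball_normP xy; apply: le_lt_trans (fL _ _) _.
apply: (@le_lt_trans _ _ ((`|L| + 1) * `|x - y|)).
  by rewrite ler_wpM2r// (le_trans (ler_norm _))// lerDl.
by rewrite mulrC -ltr_pdivlMr.
Qed.

End rV_norm.

Section lebesgue_rV_finite.
Context {R : realType} {n : nat}.
Local Notation mu := (@lebesgue_rV R n).
Local Notation T := (@lebesgue_space R n).

(** Balls of the maximum norm are cubes of side 2 e. *)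
Lemma lebesgue_rV_ball (x : 'rV[R]_n) (e : R) : 0 < e ->
  mu (ball x e) = ((e *+ 2) ^+ n)%:E.
Proof.
move=> e0; rewrite lebesgue_rV_borel; last exact: measurable_rV_ball.
rewrite (_ : ball x e = [set y | forall i, ball (x 0 i) e (y 0 i)]).
  rewrite (@borel_lebesgue_setX R n (fun i => ball (x 0 i) e)).
    under eq_bigr do rewrite lebesgue_measure_ball ?ltW//.
    by rewrite prodEFin prodr_const card_ord.
  by move=> i; apply: open_measurable; exact: ball_open.
by apply/seteqP; split=> y; [move=> /rV_ballP[]|move=> h; apply/rV_ballP].
Qed.

Lemma lebesgue_rV_le (A B : set 'rV[R]_n) : A `<=` B -> (mu A <= mu B)%E.
Proof. exact: le_mu_ext. Qed.

Lemma lebesgue_rV_bounded (A : set 'rV[R]_n) : bounded_set A -> (mu A < +oo)%E.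
Proof.
move=> [M [_ AM]]; have M1 : 0 < `|M| + 1 by rewrite ltr_pwDr.
apply: (@le_lt_trans _ _ (mu (ball (0 : 'rV[R]_n) ((`|M| + 1) + 1)))); last first.
  by rewrite lebesgue_rV_ball ?ltry// addr_gt0.
apply: lebesgue_rV_le => x Ax; apply/ball_normP; rewrite sub0r normrN.
rewrite (@le_lt_trans _ _ (`|M| + 1)) ?ltrDl//.
by apply: AM => //; rewrite (le_lt_trans (ler_norm _))// ltrDl.
Qed.

Lemma lebesgue_rV_open_gt0 (A : set 'rV[R]_n) : open A -> A !=set0 -> (0 < mu A)%E.
Proof.
move=> oA [x Ax]; have /nbhs_ballP[e /= e0 xeA] : nbhs x A by exact: open_nbhs_nbhs.
apply: lt_le_trans (lebesgue_rV_le xeA).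
by rewrite lebesgue_rV_ball// lte_fin exprn_gt0// mulrn_wgt0.
Qed.

End lebesgue_rV_finite.

Section sigma_finite_completion.
Context d (T : measurableType d) (R : realType).
Variable mu : {sigma_finite_measure set T -> \bar R}.

Let sigma_finite_completion : sigma_finite setT (@completed_measure_extension _ _ _ mu).
Proof. by apply: completed_measure_extension_sigma_finite; exact: sigma_finiteT. Qed.

(** Sigma-finiteness is required by Tonelli's theorem in the mollification estimates and by the
    Radon-Nikodym theorem in the weak compactness argument. *)
HB.instance Definition _ := Measure_isSigmaFinite.Build _ _ _
  (@completed_measure_extension _ _ _ mu) sigma_finite_completion.

End sigma_finite_completion.

Section borel_hull.
Context {R : realType} {n : nat}.
Local Notation mu := (@lebesgue_rV R n).
Local Notation T := (@lebesgue_space R n).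

(** Intersect Borel covers whose measure exceeds that of A by at most 1/(k + 1); they exist by the
    definition of the outer measure. *)
Lemma lebesgue_rV_borel_hull (A : set 'rV[R]_n) : (mu A < +oo)%E ->
  exists B : set 'rV[R]_n, [/\ measurable B, A `<=` B & mu B = mu A].
Proof.
move=> Aoo.
have Afin : mu A \is a fin_num by rewrite ge0_fin_numE//; exact: measure_ge0.
have /choice[B hB] : forall k : nat, exists B : set 'rV[R]_n,
    [/\ measurable B, A `<=` B & (mu B <= mu A + k.+1%:R^-1%:E)%E].
  move=> k; have k0 : (0 : R) < k.+1%:R^-1 by [].
  have [_ [F [mF AF] <-] hF] := lb_ereal_inf_adherent k0 Afin.
  exists (\bigcup_i F i); split => //; first exact: bigcup_measurable.
  apply: le_trans (ltW hF).
  apply: le_trans (mu_ext_sigma_subadditive (measure_ge0 (@borel_lebesgue R n)) F) _.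
  by rewrite le_eqVlt; apply/orP; left; apply/eqP/eq_eseriesr => i _; exact: lebesgue_rV_borel.
have mB : measurable (\bigcap_k B k).
  by apply: bigcapT_measurable => k; have [] := hB k.
exists (\bigcap_k B k); split => //.
  by move=> x Ax k _; have [_ /(_ x Ax)] := hB k.
apply/eqP; rewrite eq_le; apply/andP; split; last first.
  by apply: lebesgue_rV_le => x Ax k _; have [_ /(_ x Ax)] := hB k.
apply/lee_addgt0Pr => e e0.
have [k _ /(_ k (leqnn k))/ltW ke] := near_infty_natSinv_lt (PosNum e0).
have [_ _ h] := hB k; apply: le_trans (le_trans _ h) _.
  by apply: lebesgue_rV_le => x; exact.
by rewrite leeD2l// lee_fin.
Qed.

End borel_hull.

Section L1_norm.
Context d (T : measurableType d) (R : realType) (mu : {measure set T -> \bar R}).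
Implicit Types f g h s t : T -> R.
Local Open Scope ereal_scope.

Lemma measurable_fun_normrB f g (D : set T) : measurable_fun D f -> measurable_fun D g ->
  measurable_fun D (fun x => `|f x - g x|%:E).
Proof.
by move=> mf mg; apply/measurable_EFinP/measurableT_comp => //; exact: measurable_funB.
Qed.

Lemma L1_triangle f g h : measurable_fun setT f ->
  measurable_fun setT g -> measurable_fun setT h ->
  \int[mu]_x `|f x - h x|%:E <=
  \int[mu]_x `|f x - g x|%:E + \int[mu]_x `|g x - h x|%:E.
Proof.
move=> mf mg mh; rewrite -ge0_integralD//; [|exact: measurable_fun_normrB..].
apply: ge0_le_integral => //; first exact: measurable_fun_normrB.
  by apply: emeasurable_funD; exact: measurable_fun_normrB.
move=> x _; rewrite -EFinD lee_fin.
by rewrite (_ : f x - h x = (f x - g x) + (g x - h x))%R ?ler_normD// addrA subrK.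
Qed.

Lemma L1_lincomb (a b : R) f g s t (e : R) : measurable_fun setT f ->
  measurable_fun setT g -> measurable_fun setT s -> measurable_fun setT t ->
  (0 < e)%R ->
  \int[mu]_x `|f x - s x|%:E < (e / (`|a| + `|b| + 1) / 2)%:E ->
  \int[mu]_x `|g x - t x|%:E < (e / (`|a| + `|b| + 1) / 2)%:E ->
  \int[mu]_x `|(a * f x + b * g x) - (a * s x + b * t x)|%:E < e%:E.
Proof.
move=> mf mg ms mt e0.
(* A common bound of |a| and |b|; the added 1 keeps it positive when both vanish. *)
have [c c0 [ac bc <-]] : exists2 c : R, (0 < c)%R &
    [/\ `|a| <= c, `|b| <= c & c = `|a| + `|b| + 1]%R.
  exists (`|a| + `|b| + 1)%R; first by rewrite ltr_pwDr// addr_ge0.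
  by split => //; have := normr_ge0 a; have := normr_ge0 b; lra.
move=> fs gt.
have mfs := measurable_fun_normrB mf ms.
have mgt := measurable_fun_normrB mg mt.
apply: (@le_lt_trans _ _ (\int[mu]_x (c%:E * `|f x - s x|%:E + c%:E * `|g x - t x|%:E))).
  apply: ge0_le_integral => //=.
  - by apply: measurable_fun_normrB; apply: measurable_funD; apply: measurable_funM.
  - by apply: emeasurable_funD; apply: emeasurable_funM.
  - move=> x _; rewrite -!EFinM -EFinD lee_fin.
    rewrite (_ : _ - _ = a * (f x - s x) + b * (g x - t x))%R; last by ring.
    by rewrite (le_trans (ler_normD _ _))// !normrM lerD// ler_wpM2r.
rewrite ge0_integralD//; last 4 first.
- by move=> x _; rewrite mule_ge0// lee_fin ltW.
- by apply: emeasurable_funM.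
- by move=> x _; rewrite mule_ge0// lee_fin ltW.
- by apply: emeasurable_funM.
rewrite !ge0_integralZl//; try by rewrite lee_fin ltW.
rewrite (_ : e = c * (e / c / 2) + c * (e / c / 2))%R; last by field; exact: lt0r_neq0.
by rewrite EFinD; apply: lteD; rewrite [ltRHS]EFinM lte_pmul2l ?lte_fin.
Qed.

Lemma integrable_indic_lty (A : set T) :
  measurable A -> mu A < +oo -> mu.-integrable setT (EFin \o (\1_A : T -> R)).
Proof.
move=> mA Aoo; apply/integrableP; split; first exact/measurable_EFinP/measurable_indic.
rewrite (eq_integral (fun x => (\1_A x)%:E)); last first.
  by move=> t _; rewrite gee0_abs// lee_fin.
by rewrite integral_indic// setIT.
Qed.

Lemma L1_dominated (f_ : nat -> T -> R) (f g : T -> R) :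
  (forall i, measurable_fun setT (f_ i)) ->
  measurable_fun setT f ->
  mu.-integrable setT (EFin \o g) ->
  (forall x, f_ ^~ x @ \oo --> f x) ->
  (forall x i, (`|f_ i x| <= g x)%R) ->
  forall e : R, (0 < e)%R -> exists N, forall i, (N <= i)%N ->
    \int[mu]_x `|f_ i x - f x|%:E < e%:E.
Proof.
move=> mf_ mf ig fcvg fg e e0.
have mf_' i : measurable_fun setT (fun x => (f_ i x)%:E).
  exact/measurable_EFinP.
have mf' : measurable_fun setT (EFin \o f) by exact/measurable_EFinP.
have fcvg' : {ae mu, forall x, setT x -> (f_ i x)%:E @[i --> \oo] --> (EFin \o f) x}.
  by apply: aeW => x _; apply: cvg_EFin; [exact: nearW|exact: fcvg].
have fg' : {ae mu, forall x (i : nat), setT x -> (`|(f_ i x)%:E| <= (EFin \o g) x)%E}.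
  by apply: aeW => x i _; rewrite lee_fin.
have [_ + _] := dominated_convergence measurableT mf_' mf' fcvg' ig fg'.
move=> /fine_cvgP[+ /cvgrPdist_lt/(_ _ e0)].
move=> [N _ HN] [N' _ HN']; exists (maxn N N') => i; rewrite geq_max => /andP[Ni N'i].
have := HN' _ N'i; have := HN _ Ni; rewrite /= => fin.
rewrite sub0r normrN ger0_norm ?fine_ge0 ?integral_ge0// => h.
by rewrite -lte_fin fineK in h.
Qed.

Import HBSimple.

(** As g vanishes off B, simple functions that approximate it on B may be cut off there. *)
Lemma integrable_sfun_approx (B : set T) g (e : R) : measurable B -> (0 < e)%R ->
  mu.-integrable setT (EFin \o g) -> (forall x, ~ B x -> g x = 0%R) ->
  exists t : {sfun T >-> R}, \int[mu]_x `|g x - t x * \1_B x|%:E < e%:E.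
Proof.
move=> mB e0 ig g0.
have igB := integrableS measurableT mB (@subsetT _ B) ig.
have [s [is_ _ /fine_cvgP[+ /cvgrPdist_lt/(_ _ e0)]]] := approximation_sfun_integrable mB igB.
move=> [N _ HN] [N' _ HN'].
have fin := HN (maxn N N') (leq_maxl _ _).
have := HN' (maxn N N') (leq_maxr _ _); rewrite /= sub0r normrN.
move: (s (maxn N N')) fin => {HN HN' is_}t fin lte; exists t.
move: lte; rewrite ger0_norm ?fine_ge0 ?integral_ge0// -lte_fin fineK//.
apply: le_lt_trans; rewrite [leRHS]integral_mkcond le_eqVlt; apply/orP; left.
apply/eqP/eq_integral => x _; rewrite patchE indicE.
case: ifPn => xB; first by rewrite mulr1.
by rewrite mulr0 subr0 g0 ?normr0// => Bx; rewrite mem_set in xB.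
Qed.

Lemma sfun_indicE (t : {sfun T >-> R}) (B : set T) (x : T) : (t x * \1_B x =
  \sum_(y <- finmap.enum_fset (fset_set (range t)))
    (y * \1_((t @^-1` [set y]) `&` B) x))%R.
Proof.
rewrite {1}(fimfunE t) fsbig_finite//= mulr_suml.
by apply: eq_bigr => y _; rewrite -mulrA !indicE in_setI -natrM mulnb.
Qed.

End L1_norm.

(** * Density of Lipschitz functions in L^1 *)

Section lipschitz_density.
Context {R : realType} {n : nat}.
Local Notation mu := (@lebesgue_rV R n).
Local Notation T := (@lebesgue_space R n).
Implicit Types (f g h s : 'rV[R]_n -> R) (A B O : set 'rV[R]_n).

(** Lipschitz functions are the dense class because a mollifier of width e moves them by at most L e
    everywhere, and the bounded support turns this into a small L^1 distance. *)
Definition lipschitz_bounded_support s : Prop :=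
  (exists L : R, forall x y, `|s x - s y| <= L * `|x - y|) /\
  (exists M : R, forall x, M < `|x| -> s x = 0).

Lemma lipschitz_bounded_supportD (a b : R) s h :
  lipschitz_bounded_support s -> lipschitz_bounded_support h ->
  lipschitz_bounded_support (fun x => a * s x + b * h x).
Proof.
move=> [[L Ls] [M Ms]] [[L' Lh] [M' Mh]]; split.
  exists (`|a| * L + `|b| * L') => x y.
  rewrite (_ : _ - _ = a * (s x - s y) + b * (h x - h y)); last by ring.
  rewrite (le_trans (ler_normD _ _))// !normrM mulrDl -!mulrA.
  by rewrite lerD// ler_wpM2l.
exists (Num.max M M') => x; rewrite gt_max => /andP[? ?].
by rewrite Ms// Mh// !mulr0 addr0.
Qed.

Lemma lipschitz_bounded_support_measurable s : lipschitz_bounded_support s ->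
  measurable_fun setT (s : T -> R).
Proof.
by move=> [[L /lipschitz_continuous_rV cs] _]; exact: continuous_lebesgue_measurable.
Qed.

Definition lipschitz_approximable g : Prop :=
  measurable_fun setT (g : T -> R) /\
  forall e : R, 0 < e -> exists2 s, lipschitz_bounded_support s &
    (\int[mu]_x `|g x - s x|%:E < e%:E)%E.

Lemma lipschitz_approximable_closed g : measurable_fun setT (g : T -> R) ->
  (forall e : R, 0 < e -> exists2 h, lipschitz_approximable h &
    (\int[mu]_x `|g x - h x|%:E < e%:E)%E) -> lipschitz_approximable g.
Proof.
move=> mg H; split=> // e e0.
have e2 : 0 < e / 2 by rewrite divr_gt0.
have [h [mh /(_ _ e2)[s ls hs]] gh] := H _ e2; exists s => //.
apply: le_lt_trans (L1_triangle mu mg mh (lipschitz_bounded_support_measurable ls)) _.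
by rewrite [e]splitr EFinD lteD.
Qed.

Lemma lipschitz_approximableD (a b : R) g h :
  lipschitz_approximable g -> lipschitz_approximable h ->
  lipschitz_approximable (fun x => a * g x + b * h x).
Proof.
move=> [mg Hg] [mh Hh]; split.
  by apply: measurable_funD; apply: measurable_funM.
move=> e e0.
have ec : 0 < e / (`|a| + `|b| + 1) / 2.
  by rewrite !divr_gt0// ltr_pwDr// addr_ge0.
have [s ls gs] := Hg _ ec; have [t lt ht] := Hh _ ec.
exists (fun x => a * s x + b * t x); first exact: lipschitz_bounded_supportD.
apply: L1_lincomb gs ht => //; exact: lipschitz_bounded_support_measurable.
Qed.

(** Its supremum is the distance from x to the complement of O, truncated at 1; the truncation keeps
    it finite when O is the whole space. The radius 0 always belongs to it, the ball of radius 0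
    being empty, so the supremum is 0 outside O. *)
Definition inner_radii O (x : 'rV[R]_n) : set R :=
  [set r | 0 <= r <= 1 /\ ball x r `<=` O].

Lemma inner_radii0 O x : inner_radii O x 0.
Proof.
split; first by rewrite lexx ler01.
by move=> y /ball_normP; rewrite ltNge normr_ge0.
Qed.

Lemma inner_radii_sup O x : has_sup (inner_radii O x).
Proof.
split; first by exists 0; exact: inner_radii0.
by exists 1 => r [/andP[]].
Qed.

Lemma sup_inner_radii_ge0 O x : 0 <= sup (inner_radii O x).
Proof. by apply: ub_le_sup; [case: (inner_radii_sup O x)|exact: inner_radii0]. Qed.

Lemma sup_inner_radii_gt0 O x : open O -> O x -> 0 < sup (inner_radii O x).
Proof.
move=> oO Ox; have /nbhs_ballP[e /= e0 eO] : nbhs x O by exact: open_nbhs_nbhs.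
apply: (@lt_le_trans _ _ (Num.min e 1)); first by rewrite lt_min e0 ltr01.
apply: ub_le_sup; first by case: (inner_radii_sup O x).
split; first by rewrite ge_min lexx orbT andbT le_min ler01 ltW.
by apply: subset_trans eO; apply: le_ball; rewrite ge_min lexx.
Qed.

Lemma sup_inner_radii_eq0 O x : ~ O x -> sup (inner_radii O x) = 0.
Proof.
move=> Ox; apply/eqP; rewrite eq_le sup_inner_radii_ge0 andbT.
apply: ge_sup; first by exists 0; exact: inner_radii0.
move=> r [/andP[r0 _] rO]; rewrite leNgt; apply/negP => r1; apply: Ox.
exact/rO/ballxx.
Qed.

Lemma sup_inner_radii_lipschitz O x y :
  `|sup (inner_radii O x) - sup (inner_radii O y)| <= 1 * `|x - y|.
Proof.
have H u v : sup (inner_radii O u) <= sup (inner_radii O v) + `|u - v|.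
  apply: ge_sup; first by exists 0; exact: inner_radii0.
  move=> r [/andP[r0 r1] rO]; have [ruv|ruv] := leP r `|u - v|.
    by rewrite (le_trans ruv)// lerDr sup_inner_radii_ge0.
  (* If the ball of radius r about u lies in O, so does the ball of radius r - |u - v| about v. *)
  rewrite -lerBlDr; apply: ub_le_sup; first by case: (inner_radii_sup O v).
  split; first by rewrite subr_ge0 ltW//= lerBlDr (le_trans r1)// lerDl.
  move=> z /ball_normP vz; apply: rO; apply/ball_normP.
  rewrite (_ : u - z = (u - v) + (v - z)); last by rewrite addrA subrK.
  by rewrite (le_lt_trans (ler_normD _ _))// -ltrBrDl.
by rewrite mul1r ler_distl lerBlDr H andbT distrC H.
Qed.

Lemma min1_lipschitz (a b : R) : `|Num.min 1 a - Num.min 1 b| <= `|a - b|.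
Proof.
have h1 := ler_norm (a - b); have h2 := ler_norm (b - a); rewrite distrC in h2.
by rewrite ler_norml; case: (leP 1 a) => ha; case: (leP 1 b) => hb;
  apply/andP; split; lra.
Qed.

(** A Lipschitz ramp that vanishes off O and, for i > 0, equals 1 where the truncated distance is at
    least 1/i; it converges pointwise to the indicator of O. *)
Definition cutoff O (i : nat) x : R := Num.min 1 (i%:R * sup (inner_radii O x)).

Lemma cutoff_ge0 O i x : 0 <= cutoff O i x.
Proof. by rewrite /cutoff le_min ler01 mulr_ge0// sup_inner_radii_ge0. Qed.

Lemma cutoff_le1 O i x : cutoff O i x <= 1.
Proof. by rewrite /cutoff ge_min lexx. Qed.

Lemma cutoff_out O i x : ~ O x -> cutoff O i x = 0.
Proof.
by move=> Ox; rewrite /cutoff sup_inner_radii_eq0// mulr0; apply/min_r; exact: ler01.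
Qed.

Lemma cutoff_lipschitz O i : bounded_set O -> lipschitz_bounded_support (cutoff O i).
Proof.
move=> [M [_ OM]]; split.
  exists i%:R => x y; rewrite /cutoff.
  apply: (@le_trans _ _ `|i%:R * sup (inner_radii O x) - i%:R * sup (inner_radii O y)|).
    exact: min1_lipschitz.
  rewrite -mulrBr normrM ger0_norm// ler_wpM2l//.
  by rewrite -[leRHS]mul1r sup_inner_radii_lipschitz.
exists (`|M| + 1) => x Mx; apply: cutoff_out => Ox.
have := OM (`|M| + 1); rewrite (le_lt_trans (ler_norm _)) ?ltrDl// => /(_ isT x Ox)/= h.
by move: Mx; rewrite ltNge h.
Qed.

Lemma open_lipschitz_approximable O : open O -> bounded_set O ->
  lipschitz_approximable (\1_O).
Proof.
move=> oO bO; have mO := open_lebesgue_measurable oO.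
have mI : measurable_fun setT (\1_O : T -> R) by exact: measurable_indic.
have mc i : measurable_fun setT (cutoff O i : T -> R).
  exact/lipschitz_bounded_support_measurable/cutoff_lipschitz.
split=> // e e0.
have iO : mu.-integrable setT (EFin \o (\1_O : T -> R)).
  by apply: integrable_indic_lty => //; exact: lebesgue_rV_bounded.
have [|x i|N /(_ N (leqnn N))] := L1_dominated mc mI iO _ _ e0.
- move=> x; rewrite indicE; have [xO|xO] := boolP (x \in O); last first.
    rewrite (_ : cutoff O ^~ x = cst 0); first exact: cvg_cst.
    by apply/funext => i; rewrite cutoff_out// => Ox; rewrite mem_set in xO.
  have d0 := sup_inner_radii_gt0 oO (set_mem xO).
  apply/cvgrPdist_lt => d dgt0; near=> i.
  rewrite /cutoff min_l ?subrr ?normr0//.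
  rewrite -ler_pdivrMr// mul1r.
  by near: i; exact: nbhs_infty_ger.
- rewrite indicE; have [xO|xO] := boolP (x \in O).
    by rewrite ger0_norm ?cutoff_ge0// cutoff_le1.
  by rewrite cutoff_out ?normr0// => Ox; rewrite mem_set in xO.
move=> h; exists (cutoff O N); first exact: cutoff_lipschitz.
by apply: le_lt_trans h; under eq_integral do rewrite distrC.
Unshelve. all: by end_near. Qed.

Lemma lipschitz_approximable_trivIset_bigcup (F : nat -> set 'rV[R]_n) B :
  (forall i, measurable (F i : set T)) -> measurable (B : set T) ->
  (mu B < +oo)%E -> trivIset setT F ->
  (forall i, lipschitz_approximable (\1_(F i `&` B))) ->
  lipschitz_approximable (\1_((\bigcup_i F i) `&` B)).
Proof.
move=> mF mB Boo tF aF.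
have mFB : measurable ((\bigcup_i F i) `&` B : set T).
  by apply: measurableI => //; exact: bigcup_measurable.
have mI : measurable_fun setT (\1_((\bigcup_i F i) `&` B) : T -> R).
  exact: measurable_indic.
(* The sets F j being disjoint, the partial sums are again indicators, hence dominated by the
   indicator of B. *)
pose S i x : R := \sum_(j < i) \1_(F j `&` B) x.
have SE i x : S i x = \1_((\bigcup_(j < i) F j) `&` B) x.
  rewrite /S; elim: i => [|i IHi].
    by rewrite big_ord0 bigcup_mkord big_ord0 set0I indic0.
  rewrite big_ord_recr/= IHi !indicE !bigcup_mkord big_ord_recr/=.
  rewrite -!bigcup_mkord !in_setI in_setU.
  have [xB|xB] := boolP (x \in B); rewrite ?andbF ?addr0// !andbT.
  have [xF|xF] := boolP (x \in F i); rewrite ?orbT ?orbF ?addr0//.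
  case: (boolP (x \in _)) => [|]; rewrite ?add0r// => /set_mem[j/= ji Fj].
  have jE : j = i by apply: (tF j i I I); exists x; split => //; exact: set_mem.
  by move: ji; rewrite jE ltnn.
have aS i : lipschitz_approximable (S i).
  elim: i => [|i IHi].
    rewrite (_ : S 0 = fun x => 0 * (\1_(F 0 `&` B) x) + 0 * (\1_(F 0 `&` B) x)).
      exact: lipschitz_approximableD.
    by apply/funext => x; rewrite /S big_ord0 !mul0r addr0.
  rewrite (_ : S i.+1 = fun x => 1 * S i x + 1 * (\1_(F i `&` B) x)).
    exact: lipschitz_approximableD.
  by apply/funext => x; rewrite /S big_ord_recr/= !mul1r.
apply: lipschitz_approximable_closed => // e e0.
have iB : mu.-integrable setT (EFin \o (\1_B : T -> R)).
  exact: integrable_indic_lty.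
have mS i : measurable_fun setT (S i : T -> R) by case: (aS i).
have [|x i|N /(_ N (leqnn N))] := L1_dominated mS mI iB _ _ e0.
- move=> x; have [[[k _ Fkx] Bx]|nx] := pselect (((\bigcup_i F i) `&` B) x).
    apply/cvgrPdist_lt => d d0; near=> i.
    rewrite SE !indicE !mem_set ?subrr ?normr0//; split=> //; last by exists k.
    by exists k => //=; near: i; exact: nbhs_infty_gt.
  rewrite (_ : S ^~ x = cst 0).
    by rewrite indicE memNset//; exact: cvg_cst.
  apply/funext => i; rewrite SE indicE memNset// => -[[j _ Fj] Bx]; apply: nx.
  by split => //; exists j.
- rewrite SE !indicE in_setI; case: (x \in B); rewrite ?andbF ?normr0//.
  by rewrite andbT; case: (x \in _); rewrite ?normr0 ?normr1.
move=> h; exists (S N) => //.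
by apply: le_lt_trans h; under eq_integral do rewrite distrC.
Unshelve. all: by end_near. Qed.

(** A pi-lambda argument: the sets A for which the indicator of the part of A in B is approximable
    form a Dynkin class containing the open sets, which are stable under intersection and generate
    the Borel sets. Intersecting with the bounded set B keeps all measures finite. *)
Lemma borel_lipschitz_approximable A B : measurable A -> open B -> bounded_set B ->
  lipschitz_approximable (\1_(A `&` B)).
Proof.
move=> mA oB bB; have Boo := lebesgue_rV_bounded bB.
have GE : @measurable _ 'rV[R]_n = <<s [set O : set 'rV[R]_n | open O] >>.
  apply/seteqP; split; last first.
    by apply: smallest_sub; [exact: sigma_algebra_measurable|exact: open_measurable_rV].
  apply: smallest_sub.
    exact: smallest_sigma_algebra.
  rewrite -bigcup_seq/= => _ [i _] [Y mY <-].
  have : measurable_fun [set: g_sigma_algebraType [set O : set 'rV[R]_n | open O]]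
      (rV_coord i : g_sigma_algebraType _ -> R).
    apply: (measurability _ (RGenOpens.measurableE R)).
    move=> _ [_ [a [b ->] <-]]; rewrite setTI; apply: sub_sigma_algebra => /=.
    apply: (@open_comp _ _ (fun x : 'rV[R]_n => x ord0 i)); last exact: interval_open.
    by move=> x _; exact: coord_continuous.
  exact.
apply: (@dynkin_induction _ 'rV[R]_n _ (fun A => lipschitz_approximable (\1_(A `&` B))) GE).
- by move=> C D; exact: openI.
- by rewrite setTI; exact: open_lipschitz_approximable.
- move=> C oC; apply: open_lipschitz_approximable; first exact: openI.
  by case: bB => M [Mr h]; exists M; split=> // t Mt x [_ Bx]; exact: h.
- move=> S mS aS.
  rewrite (_ : \1_(~` S `&` B) = fun x => 1 * \1_B x + (-1) * \1_(S `&` B) x).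
    by apply: lipschitz_approximableD; [exact: open_lipschitz_approximable|exact: aS].
  apply/funext => x; rewrite !indicE !in_setI in_setC.
  by case: (x \in S); case: (x \in B); rewrite /=; ring.
- move=> F mF tF aF; apply: lipschitz_approximable_trivIset_bigcup => //.
    by move=> i; exact: lebesgue_space_borel.
  exact: open_lebesgue_measurable.
- by rewrite -GE.
Qed.

(** A lies in B and differs from a Borel hull by a null set, so its indicator coincides in L^1 with
    that of the hull cut down to B. *)
Lemma lebesgue_lipschitz_approximable A B : measurable (A : set T) ->
  open B -> bounded_set B -> A `<=` B -> lipschitz_approximable (\1_A).
Proof.
move=> mA oB bB AB.
have Aoo : (mu A < +oo)%E.
  by rewrite (le_lt_trans (lebesgue_rV_le AB))// lebesgue_rV_bounded.
have [A' [mA' AA' muA']] := lebesgue_rV_borel_hull Aoo.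
have mA'T : measurable (A' : set T) by exact: lebesgue_space_borel.
have mB : measurable (B : set T) by exact: open_lebesgue_measurable.
apply: lipschitz_approximable_closed; first exact: measurable_indic.
move=> e e0; exists (\1_(A' `&` B)); first exact: borel_lipschitz_approximable.
rewrite (eq_integral (fun x : T => (\1_((A' `&` B) `\` A) x)%:E)); last first.
  move=> x _; rewrite !indicE in_setD in_setI.
  have [xA|xA] := boolP (x \in A).
    have -> : x \in A' by apply/mem_set/AA'; exact: set_mem.
    have -> : x \in B by apply/mem_set/AB; exact: set_mem.
    by rewrite subrr normr0.
  by rewrite /= sub0r normrN normr_nat andbT.
rewrite integral_indic//; last first.
  by apply: measurableD => //; exact: measurableI.
rewrite setIT; apply: (@le_lt_trans _ _ (mu (A' `\` A))).
  by apply: lebesgue_rV_le => x [[A'x _] nAx]; split.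
rewrite measureD ?muA'//; last by rewrite [ltLHS]muA'.
rewrite [X in (_ - X)%E](_ : _ = mu A); last exact: (congr1 (fun X : set T => mu X) (setIidr AA')).
by rewrite [X in (X - _)%E]muA' subee ?ge0_fin_numE//.
Qed.

Import HBSimple.

Lemma integrable_lipschitz_approximable g B : open B -> bounded_set B ->
  mu.-integrable setT (EFin \o (g : T -> R)) -> (forall x, ~ B x -> g x = 0) ->
  lipschitz_approximable g.
Proof.
move=> oB bB ig g0; have mB : measurable (B : set T) := open_lebesgue_measurable oB.
have /integrableP[/measurable_EFinP mg _] := ig.
apply: lipschitz_approximable_closed => // e e0.
have [t gt] := integrable_sfun_approx mB e0 ig g0.
exists (fun x => t x * \1_B x).
  rewrite (_ : (fun x => _) = fun x =>
    \sum_(y <- finmap.enum_fset (fset_set (range t))) (y * \1_((t @^-1` [set y]) `&` B) x)%R); last first.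
    by apply/funext => x; exact: sfun_indicE.
  elim: (finmap.enum_fset _) => [|y r IHr].
    rewrite (_ : (fun x => _) = fun x => 0 * \1_B x + 0 * \1_B x).
      by apply: lipschitz_approximableD; exact: open_lipschitz_approximable.
    by apply/funext => x; rewrite big_nil !mul0r addr0.
  rewrite (_ : (fun x => _) = fun x => y * \1_((t @^-1` [set y]) `&` B) x +
     1 * \sum_(y <- r) (y * \1_((t @^-1` [set y]) `&` B) x)%R).
    apply: lipschitz_approximableD; last exact: IHr.
    apply: (@lebesgue_lipschitz_approximable _ B) => //.
    by apply: measurableI => //; exact: measurable_sfunP.
  by apply/funext => x; rewrite big_cons mul1r.
exact: gt.
Qed.

End lipschitz_density.

(** * Partial derivatives and smooth functions *)

Section coordinate_derivatives.
Context {R : realType}.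

(** This is how derivatives are obtained at the singular point of the flat functions and for
    convolutions, where a quadratic remainder can be integrated against g. *)
Lemma is_derive_quadratic (V : normedModType R) (f : V -> R) (x v : V) (d C : R) :
  (forall h : R, `|f (h *: v + x) - f x - h * d| <= C * h ^+ 2) ->
  is_derive x v f d.
Proof.
move=> H.
have cv : (fun h : R => h^-1 *: ((f \o shift x) (h *: v) - f x)) @ 0^' --> d.
  apply/cvgrPdist_lt => e e0; near=> h.
  have h0 : h != 0 by near: h; exact: nbhs_dnbhs_neq.
  have C1 : 0 < `|C| + 1 by rewrite ltr_pwDr.
  rewrite (_ : _ - _ = - (h^-1 * (f (h *: v + x) - f x - h * d))); last first.
    by rewrite /= mulrBr mulKf// opprB.
  rewrite normrN normrM normfV ltr_pdivrMl ?normr_gt0//.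
  apply: (le_lt_trans (H h)); apply: (@le_lt_trans _ _ (`|C| * `|h| ^+ 2)).
    by rewrite real_normK ?num_real// ler_wpM2r ?sqr_ge0// ler_norm.
  rewrite expr2 mulrCA ltr_pM2l ?normr_gt0//.
  apply: (@le_lt_trans _ _ ((`|C| + 1) * `|h|)); first by rewrite ler_wpM2r// lerDl.
  rewrite mulrC -ltr_pdivlMr//; near: h.
  by apply: dnbhs0_lt; rewrite divr_gt0.
by apply: DeriveDef; [apply/cvg_ex; exists d|exact/cvg_lim].
Unshelve. all: by end_near. Qed.

Context {n : nat}.
Implicit Types (f g : 'rV[R]_n -> R) (x y : 'rV[R]_n) (j : 'I_n).
Local Notation e_ j := (delta_mx 0 j : 'rV[R]_n).

Lemma is_derive_line f x j (t d : R) :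
  is_derive (t *: e_ j + x) (e_ j) f d -> is_derive t (1 : R) (fun s => f (s *: e_ j + x)) d.
Proof.
move=> [df <-].
have E : (fun h : R => h^-1 *: (((fun s => f (s *: e_ j + x)) \o shift t) (h *: 1) -
     f (t *: e_ j + x)))
  = (fun h : R => h^-1 *: ((f \o shift (t *: e_ j + x)) (h *: e_ j) - f (t *: e_ j + x))).
  by apply/funext => h /=; rewrite [h%:A]mulr1 scalerDl addrA.
by split; rewrite /derivable /derive E.
Qed.

Lemma is_derive_shift f (c x v : 'rV[R]_n) (d : R) :
  is_derive (c + x) v f d -> is_derive x v (fun y => f (c + y)) d.
Proof.
move=> [df <-].
have E : (fun h : R => h^-1 *: (((fun y => f (c + y)) \o shift x) (h *: v) - f (c + x)))
  = (fun h : R => h^-1 *: ((f \o shift (c + x)) (h *: v) - f (c + x))).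
  by apply/funext => h /=; rewrite addrCA.
by split; rewrite /derivable /derive E.
Qed.

Lemma coordinate_MVT f x j (h : R) : (forall y, derivable f y (e_ j)) ->
  exists2 t : R, `|t| <= `|h| & f (h *: e_ j + x) - f x = h * partial j f (t *: e_ j + x).
Proof.
move=> df.
pose F (s : R) := f (s *: e_ j + x).
have dF s : is_derive s (1 : R) F (partial j f (s *: e_ j + x)).
  by apply: is_derive_line; exact: derivableP.
have cF : continuous F.
  by move=> s; apply/differentiable_continuous/derivable1_diffP; case: (dF s).
have F0 : F 0 = f x by rewrite /F scale0r add0r.
rewrite -F0 -/(F h); have [h0|h0|->] := ltgtP h 0; last first.
- by exists 0; rewrite ?subrr ?mul0r.
- have [c] := MVT h0 (fun s _ => dF s) (continuous_subspaceT cF).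
  rewrite in_itv/= => /andP[c0 ch] ->; exists c; last by rewrite subr0 mulrC.
  by rewrite !gtr0_norm// ltW.
- have [c] := MVT h0 (fun s _ => dF s) (continuous_subspaceT cF).
  rewrite in_itv/= => /andP[c0 ch] E; exists c; last by rewrite -opprB E sub0r mulrN opprK mulrC.
  by rewrite !ltr0_norm// lerN2 ltW.
Qed.

Lemma coordinate_lipschitz f j (C : R) : (forall y, derivable f y (e_ j)) ->
  (forall y, `|partial j f y| <= C) ->
  forall x (h : R), `|f (h *: e_ j + x) - f x| <= C * `|h|.
Proof.
move=> df fC x h; have [t _ ->] := coordinate_MVT x h df.
by rewrite normrM mulrC ler_wpM2r.
Qed.

(** The mean value theorem is applied to f and then to its derivative, which gives the constant C
    where Taylor's formula would give C/2. *)
Lemma coordinate_quadratic f j (C : R) : (forall y, derivable f y (e_ j)) ->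
  (forall y, derivable (partial j f) y (e_ j)) ->
  (forall y, `|partial j (partial j f) y| <= C) ->
  forall x (h : R), `|f (h *: e_ j + x) - f x - h * partial j f x| <= C * h ^+ 2.
Proof.
move=> df ddf fC x h; have [t th ->] := coordinate_MVT x h df.
have C0 : 0 <= C by exact: le_trans (fC x).
rewrite -mulrBr normrM -[h ^+ 2]real_normK ?num_real// expr2 mulrCA ler_wpM2l//.
by rewrite (le_trans (coordinate_lipschitz ddf fC _ _))// ler_wpM2l.
Qed.

Lemma bounded_partial_lipschitz f (C : R) : (forall j y, derivable f y (e_ j)) ->
  (forall j y, `|partial j f y| <= C) ->
  forall x y, `|f x - f y| <= (n%:R * C) * `|x - y|.
Proof.
move=> df fC x y.
(* [z k] has the first k coordinates of x and the others of y, so consecutive points differ in one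
   coordinate only. *)
pose z (k : nat) : 'rV[R]_n := \row_i (if (i < k)%N then x 0 i else y 0 i).
have z0 : z 0%N = y by apply/rowP => i; rewrite mxE.
have zn : z n = x by apply/rowP => i; rewrite mxE ltn_ord.
have step k : (k <= n)%N -> `|f (z k) - f y| <= (k%:R * C) * `|x - y|.
  elim: k => [|k IHk] kn; first by rewrite z0 subrr normr0 mul0r mul0r.
  have zS : z k.+1 = (x 0 (Ordinal kn) - y 0 (Ordinal kn)) *: e_ (Ordinal kn) + z k.
    apply/rowP => i; rewrite !mxE/= -val_eqE/= ltnS leq_eqVlt.
    have [ik|ik] := eqVneq (i : nat) k; last by rewrite mulr0 add0r.
    by rewrite ik ltnn/= mulr1 (_ : i = Ordinal kn) ?subrK//; exact/val_inj.
  rewrite (_ : f (z k.+1) - f y = (f (z k.+1) - f (z k)) + (f (z k) - f y)); last first.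
    by rewrite addrA subrK.
  rewrite (le_trans (ler_normD _ _))// -natr1 mulrDl mulrDl addrC mul1r lerD//.
    by apply: IHk; exact: ltnW.
  rewrite zS (le_trans (coordinate_lipschitz (df _) (fC _) _ _))//.
  have C0 : 0 <= C by exact: le_trans (fC (Ordinal kn) x).
  rewrite ler_wpM2l//; have := rV_coord_le_norm (x - y) (Ordinal kn).
  by rewrite !mxE.
by have := step n (leqnn n); rewrite zn.
Qed.

Lemma partialC_continuous f i j :
  (forall y, derivable f y (e_ i)) -> (forall y, derivable f y (e_ j)) ->
  (forall y, derivable (partial i f) y (e_ j)) ->
  (forall y, derivable (partial j f) y (e_ i)) ->
  continuous (partial i (partial j f)) -> continuous (partial j (partial i f)) ->
  forall x, partial i (partial j f) x = partial j (partial i f) x.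
Proof.
(* The second difference of f in the directions i and j is, by the mean value
   theorem, a value of either mixed derivative at a point near x. *)
move=> dfi dfj dfij dfji cji cij x.
have key i' j' : (forall y, derivable f y (e_ i')) ->
    (forall y, derivable (partial i' f) y (e_ j')) -> forall h : R, 0 < h ->
    exists2 y, `|y - x| <= h + h &
    f (h *: e_ i' + (h *: e_ j' + x)) - f (h *: e_ j' + x) - (f (h *: e_ i' + x) - f x)
    = h * (h * partial j' (partial i' f) y).
  move=> di dij h h0; pose g y := f (h *: e_ j' + y) - f y.
  have dg y : is_derive y (e_ i') g (partial i' f (h *: e_ j' + y) - partial i' f y).
    have d1 := derivableP (di (h *: e_ j' + y)); have d2 := derivableP (di y).
    by apply: is_deriveB; exact: is_derive_shift.
  have [|t th E] := @coordinate_MVT g x i' h; first by move=> y; case: (dg y).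
  have [s sh E'] := coordinate_MVT (t *: e_ i' + x) h dij.
  exists (s *: e_ j' + (t *: e_ i' + x)).
    have nd k (r : R) : `|r *: e_ k| <= `|r|.
      apply/ler_addgt0Pr => d d0; apply: ltW; apply/rV_normP; split.
        by rewrite ltr_wpDl.
      move=> l; rewrite !mxE/=; case: eqP => _; rewrite ?mulr1 ?mulr0 ?normr0 ?ltrDl//.
      by rewrite ltr_wpDl.
    rewrite addrA addrK (le_trans (ler_normD _ _))//.
    by rewrite lerD// (le_trans (nd _ _))// -[leRHS](gtr0_norm h0).
  rewrite -E' [LHS](_ : _ = g (h *: e_ i' + x) - g x).
    by rewrite E; congr (_ * _); have [_] := dg (t *: e_ i' + x); rewrite /partial => ->.
  by rewrite /g [h *: e_ i' + (h *: e_ j' + x)]addrCA; ring.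
apply/eqP; rewrite -subr_eq0 -normr_le0; apply/ler_addgt0Pr => d d0; rewrite add0r.
have d2 : 0 < d / 2 by rewrite divr_gt0.
have /cvgrPdist_lt/(_ _ d2) := cji x; have /cvgrPdist_lt/(_ _ d2) := cij x.
move=> /nbhs_ballP[r1 /= r10 H1] /nbhs_ballP[r2 /= r20 H2].
have [h h0 [hr1 hr2]] : exists2 h : R, 0 < h & h + h < r1 /\ h + h < r2.
  exists (Num.min r1 r2 / 4); first by rewrite divr_gt0// lt_min r10.
  have m0 : 0 < Num.min r1 r2 by rewrite lt_min r10.
  have m1 : Num.min r1 r2 <= r1 by rewrite ge_min lexx.
  have m2 : Num.min r1 r2 <= r2 by rewrite ge_min lexx orbT.
  by split; lra.
have [y1 xy1 E1] := key i j dfi dfij h h0.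
have [y2 xy2 E2] := key j i dfj dfji h h0.
have E : partial j (partial i f) y1 = partial i (partial j f) y2.
  apply: (mulfI (lt0r_neq0 h0)); apply: (mulfI (lt0r_neq0 h0)).
  apply: (etrans (esym E1)); apply: (etrans _ E2).
  rewrite [h *: e_ j + (h *: e_ i + x)]addrCA.
  by move: (f _) (f _) (f _) (f _) => a b c d'; ring.
have h1 : `|partial j (partial i f) x - partial j (partial i f) y1| <= d / 2.
  apply/ltW/(H1 y1)/ball_normP; rewrite distrC.
  exact: le_lt_trans xy1 hr1.
have h2 : `|partial i (partial j f) x - partial i (partial j f) y2| <= d / 2.
  apply/ltW/(H2 y2)/ball_normP; rewrite distrC.
  exact: le_lt_trans xy2 hr2.
move: E h1 h2; move: (partial j _ _) (partial j _ _) (partial i _ _) (partial i _ _).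
move=> a b c c' -> h1 h2; rewrite (le_trans (ler_distD c' _ _))// [leRHS]splitr.
by rewrite lerD// distrC.
Qed.

End coordinate_derivatives.

Section smooth_functions.
Context {R : realType} {n : nat}.
Implicit Types (f g : 'rV[R]_n -> R) (x y : 'rV[R]_n) (j : 'I_n).
Local Notation e_ j := (delta_mx 0 j : 'rV[R]_n).

(** [smooth] unfolded one derivative at a time, with m bounding the order, so that stability under
    sums, products and affine substitutions follows by induction on m. *)
Fixpoint smoothn (m : nat) f : Prop :=
  [/\ continuous f, forall j x, derivable f x (e_ j) &
      if m is m'.+1 then forall j, smoothn m' (partial j f) else True].

Lemma smooth_partial f j : smooth f -> smooth (partial j f).
Proof. by move=> sf s; have := sf (rcons s j); rewrite foldr_rcons. Qed.

Lemma smoothP f : smooth f <-> forall m, smoothn m f.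
Proof.
split=> [sf m|sf s].
  elim: m f sf => [|m IHm] f sf; have [cf df] := sf [::]; split=> // j.
  exact/IHm/smooth_partial.
elim/last_ind: s f sf => [|s j IHs] f sf; first by have [cf df _] := sf 0.
rewrite foldr_rcons; apply: IHs => m.
by have [_ _] := sf m.+1; apply.
Qed.

Lemma smoothnW m f : smoothn m.+1 f -> smoothn m f.
Proof.
elim: m f => [|m IHm] f [cf df pf]; first by split.
by split=> // j; apply: IHm; exact: pf.
Qed.

Lemma smoothn_continuous m f : smoothn m f -> continuous f.
Proof. by case: m => [|m] []. Qed.

Lemma smoothn_partial m f j : smoothn m.+1 f -> smoothn m (partial j f).
Proof. by move=> [_ _ h]; exact: h. Qed.

Lemma is_derive_smoothn m f x j : smoothn m f -> is_derive x (e_ j) f (partial j f x).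
Proof. by case: m => [|m] [_ df _]; apply: derivableP; exact: df. Qed.

Lemma partialE f g j : (forall x, is_derive x (e_ j) f (g x)) -> partial j f = g.
Proof. by move=> H; apply/funext => x; rewrite /partial; have [] := H x. Qed.

Lemma smoothn_intro m f (df : 'I_n -> 'rV[R]_n -> R) : continuous f ->
  (forall j x, is_derive x (e_ j) f (df j x)) ->
  (if m is m'.+1 then forall j, smoothn m' (df j) else True) -> smoothn m f.
Proof.
move=> cf H; case: m => [_|m Hm]; split=> //; try by move=> j x; case: (H j x).
by move=> j; rewrite (partialE (H j)).
Qed.

Lemma smoothn_cst m (c : R) : smoothn m (cst c).
Proof.
elim: m c => [|m IHm] c; apply: (@smoothn_intro _ _ (fun _ => cst 0)) => //;
  by move=> x; exact: cst_continuous.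
Qed.

Lemma smoothnD m f g : smoothn m f -> smoothn m g -> smoothn m (fun x => f x + g x).
Proof.
elim: m f g => [|m IHm] f g sf sg.
  apply: (@smoothn_intro _ _ (fun j x => partial j f x + partial j g x)) => //.
    by move=> x; apply: continuousD; [exact: (smoothn_continuous sf)|exact: (smoothn_continuous sg)].
  by move=> j x; apply: is_deriveD; [exact: (is_derive_smoothn _ _ sf)|exact: (is_derive_smoothn _ _ sg)].
apply: (@smoothn_intro _ _ (fun j x => partial j f x + partial j g x)) => //.
- by move=> x; apply: continuousD; [exact: (smoothn_continuous sf)|exact: (smoothn_continuous sg)].
- by move=> j x; apply: is_deriveD; [exact: (is_derive_smoothn _ _ sf)|exact: (is_derive_smoothn _ _ sg)].
- by move=> j; apply: IHm; exact: smoothn_partial.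
Qed.

Lemma smoothnM m f g : smoothn m f -> smoothn m g -> smoothn m (fun x => f x * g x).
Proof.
elim: m f g => [|m IHm] f g sf sg.
  apply: (@smoothn_intro _ _ (fun j x => f x * partial j g x + g x * partial j f x)) => //.
    by move=> x; apply: continuousM; [exact: (smoothn_continuous sf)|exact: (smoothn_continuous sg)].
  by move=> j x; apply: is_deriveM; [exact: (is_derive_smoothn _ _ sf)|exact: (is_derive_smoothn _ _ sg)].
apply: (@smoothn_intro _ _ (fun j x => f x * partial j g x + g x * partial j f x)) => //.
- by move=> x; apply: continuousM; [exact: (smoothn_continuous sf)|exact: (smoothn_continuous sg)].
- by move=> j x; apply: is_deriveM; [exact: (is_derive_smoothn _ _ sf)|exact: (is_derive_smoothn _ _ sg)].
- move=> j; apply: smoothnD; apply: IHm; try exact: smoothnW.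
    exact: smoothn_partial.
  exact: smoothn_partial.
Qed.

Lemma smooth_cst (c : R) : smooth (cst c : 'rV[R]_n -> R).
Proof. by apply/smoothP => m; exact: smoothn_cst. Qed.

Lemma smoothM f g : smooth f -> smooth g -> smooth (fun x => f x * g x).
Proof. by move=> /smoothP sf /smoothP sg; apply/smoothP => m; exact: smoothnM. Qed.

Lemma smooth_prod (I : Type) (r : seq I) (F : I -> 'rV[R]_n -> R) :
  (forall i, smooth (F i)) -> smooth (fun x => \prod_(i <- r) F i x).
Proof.
move=> sF; elim: r => [|i r IHr].
  by under eq_fun do rewrite big_nil; exact: smooth_cst.
by under eq_fun do rewrite big_cons; exact: smoothM.
Qed.

Lemma smooth_continuous f : smooth f -> continuous f.
Proof. by move=> /(_ [::])[]. Qed.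

Lemma smooth_derivable f j x : smooth f -> derivable f x (e_ j).
Proof. by move=> /(_ [::])[]. Qed.

Lemma partialM f g j x : smooth f -> smooth g ->
  partial j (fun y => f y * g y) x = f x * partial j g x + g x * partial j f x.
Proof.
move=> sf sg; have d : is_derive x (e_ j) (f * g) (f x *: partial j g x + g x *: partial j f x).
  by apply: is_deriveM; apply/derivableP/smooth_derivable.
by have [_] := d.
Qed.

(** Reduces a partial derivative to the derivative of a function of one real variable, where the
    chain rule for affine substitutions is available. *)
Lemma is_derive_lineP f x j (d : R) :
  is_derive x (e_ j) f d <-> is_derive (0 : R) (1 : R) (fun s => f (s *: e_ j + x)) d.
Proof.
split=> [d0|[df <-]]; first by apply: is_derive_line; rewrite scale0r add0r.
have E : (fun h : R => h^-1 *: ((f \o shift x) (h *: e_ j) - f x)) =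
   (fun h : R => h^-1 *: (((fun s => f (s *: e_ j + x)) \o shift 0) (h *: 1) -
     f (0 *: e_ j + x))).
  by apply/funext => h /=; rewrite [h%:A]mulr1 addr0 scale0r add0r.
by split; rewrite /derivable /derive E.
Qed.

Lemma is_derive_affine (F : R -> R) (a b t d : R) : is_derive (a + b * t) 1 F d ->
  is_derive t 1 (fun s => F (a + b * s)) (b * d).
Proof.
move=> dF; rewrite mulrC.
have db : is_derive t 1 (fun s => a + b * s) b.
  have h1 : is_derive t (1 : R) (cst a + b \*: (id : R -> R)) (0 + b *: 1).
    by apply: is_deriveD; apply: is_deriveZ.
  by rewrite add0r [b%:A]mulr1 in h1.
exact: (@is_derive1_comp _ F (fun s => a + b * s)).
Qed.

Lemma affine_continuous (c : 'rV[R]_n) (a : R) : continuous (fun y : 'rV[R]_n => c + a *: y).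
Proof.
move=> x B /nbhs_ballP[e /= e0 eB]; have a1 : 0 < `|a| + 1 by rewrite ltr_pwDr.
apply/nbhs_ballP; exists (e / (`|a| + 1)) => /=; first by rewrite divr_gt0.
move=> y /ball_normP xy; apply/eB/ball_normP.
rewrite (_ : _ - _ = a *: (x - y)); last by rewrite scalerBr opprD addrACA subrr add0r.
rewrite normrZ; apply: (@le_lt_trans _ _ ((`|a| + 1) * `|x - y|)).
  by rewrite ler_wpM2r// lerDl.
by rewrite mulrC -ltr_pdivlMr.
Qed.

Lemma is_derive_affine_rV f (c x : 'rV[R]_n) (a d : R) j :
  is_derive (c + a *: x) (e_ j) f d -> is_derive x (e_ j) (fun y => f (c + a *: y)) (a * d).
Proof.
move=> /is_derive_lineP df; apply/is_derive_lineP.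
have := @is_derive_affine (fun s => f (s *: e_ j + (c + a *: x))) 0 a 0 d.
rewrite mulr0 addr0 => /(_ df); congr (is_derive _ _ _ _).
by apply/funext => s; rewrite add0r scalerDr scalerA addrCA.
Qed.

Lemma is_derive_coordinate (F : R -> R) (i j : 'I_n) x (a b d : R) :
  is_derive (a + b * x 0 i) (1 : R) F d ->
  is_derive x (e_ j) (fun y => F (a + b * y 0 i)) ((b * (j == i)%:R) * d).
Proof.
move=> dF; apply/is_derive_lineP.
have := @is_derive_affine F (a + b * x 0 i) (b * (j == i)%:R) 0 d.
rewrite mulr0 addr0 => /(_ dF); congr (is_derive _ _ _ _).
apply/funext => s; congr F; rewrite !mxE/= [i == j]eq_sym; ring.
Qed.

Lemma smooth_affine f (c : 'rV[R]_n) (a : R) : smooth f -> smooth (fun y => f (c + a *: y)).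
Proof.
move=> /smoothP sf; apply/smoothP => m; have {sf} := sf m.
elim: m f => [|m IHm] f sf.
all: apply: (@smoothn_intro _ _ (fun j y => a * partial j f (c + a *: y))) => //.
1,3: by move=> x; exact: (continuous_comp (@affine_continuous c a x) (@smoothn_continuous _ _ sf (c + a *: x))).
1,2: by move=> j x; apply: is_derive_affine_rV; exact: (is_derive_smoothn _ _ sf).
move=> j; apply: smoothnM; first exact: smoothn_cst.
by apply: IHm; exact: smoothn_partial.
Qed.

Lemma coordinate_affine_continuous (i : 'I_n) (a b : R) :
  continuous (fun y : 'rV[R]_n => a + b * y 0 i).
Proof.
apply: (@lipschitz_continuous_rV _ _ _ `|b|) => x y.
rewrite opprD addrACA subrr add0r -mulrBr normrM ler_wpM2l//.
by have := rV_coord_le_norm (x - y) i; rewrite !mxE.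
Qed.

(** F lists a function of one variable with its successive derivatives; differentiating in x shifts
    the index by one and produces a constant factor. *)
Lemma smooth_coordinate (F : nat -> R -> R) (i : 'I_n) (a b : R) :
  (forall k t, is_derive t (1 : R) (F k) (F k.+1 t)) -> smooth (fun x => F 0 (a + b * x 0 i)).
Proof.
move=> dF.
have cF k : continuous (fun x => F k (a + b * x 0 i)).
  move=> x; apply: (@continuous_comp _ _ _ (fun y : 'rV[R]_n => a + b * y 0 i) (F k)).
    exact: coordinate_affine_continuous.
  by have [/derivable1_diffP/differentiable_continuous + _] := dF k (a + b * x 0 i).
apply/smoothP => m; elim: m 0 => [|m IHm] k.
all: apply: (@smoothn_intro _ _ (fun j x => (b * (j == i)%:R) * F k.+1 (a + b * x 0 i))) => //.
1,2: by move=> j x; exact: is_derive_coordinate.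
by move=> j; apply: smoothnM; [exact: smoothn_cst|exact: IHm].
Qed.

End smooth_functions.

(** * Smooth bump functions *)

Section flat_functions.
Context {R : realType}.
Implicit Types (p : {poly R}) (t u : R).

Lemma poly_le_expR p : exists2 C : R, 0 <= C & forall u, 0 <= u -> `|p.[u]| <= C * expR u.
Proof.
exists (\sum_(i < size p) `|p`_i| * i`!%:R).
  by apply: sumr_ge0 => i _; rewrite mulr_ge0.
move=> u u0; rewrite horner_coef (le_trans (ler_norm_sum _ _ _))// mulr_suml.
apply: ler_sum => i _; rewrite normrM -mulrA ler_wpM2l//.
rewrite normrX (ger0_norm u0) mulrC -ler_pdivrMr ?ltr0n ?fact_gt0//.
case: (i : nat) => [|k]; last first.
  by apply: le_trans (expR_ge1Dxn k u0); rewrite lerDr.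
by rewrite expr0 divr1 (le_trans _ (expR_ge1Dx u))// lerDl.
Qed.

(** The functions p(1/t) exp(-1/t), extended by 0, form a class closed under differentiation, so a
    formula for one derivative yields all of them. *)
Definition flat p t : R := if 0 < t then p.[t^-1] * expR (- t^-1) else 0.

(** For t > 0 the derivative of p(1/t) exp(-1/t) is (p - p')(1/t) t^(-2) exp(-1/t). *)
Definition flat_next p : {poly R} := (p - p^`()) * 'X^2.

Lemma is_derive_flat p t : is_derive t (1 : R) (flat p) (flat (flat_next p) t).
Proof.
have [t0|t0|->] := ltgtP t 0.
- have -> : flat (flat_next p) t = 0 by rewrite /flat ltNge ltW.
  apply: (@near_eq_is_derive _ R R (cst 0 : R -> R)).
  near=> s; rewrite /flat ltNge ltW//=; near: s; exact: lt_nbhsl.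
- apply: (@near_eq_is_derive _ R R ((horner p \o (fun s => s^-1)) *
    (expR \o (fun s => - s^-1)))).
    near=> s; rewrite /flat ifT//; near: s; exact: lt_nbhsr.
  have tn0 : t != 0 by rewrite gt_eqF.
  have dV : is_derive t (1 : R) (fun s : R => s^-1) (- t ^- 2).
    have := @is_deriveV _ (id : R -> R) t 1 1 tn0 (is_derive_id _ _).
    by rewrite [_%:A]mulr1.
  have d1 : is_derive t (1 : R) (horner p \o (fun s => s^-1)) (p^`().[t^-1] * - t ^- 2).
    by apply: is_derive1_comp.
  have d2 : is_derive t (1 : R) (expR \o (fun s => - s^-1)) (expR (- t^-1) * - - t ^- 2).
    by apply: is_derive1_comp; apply: is_deriveN.
  have := is_deriveM d1 d2; congr (is_derive _ _ _ _).
  rewrite /flat t0 /flat_next !hornerE /GRing.scale/= -exprVn; ring.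
- rewrite [X in is_derive _ _ _ X]/flat ltxx.
  (* With u = 1/h, the bound |p(u) u^2| <= C exp(u) reads |flat p h| <= C h^2, so the derivative at
     0 is 0. *)
  have [C C0 HC] := poly_le_expR (p * 'X^2).
  apply: (@is_derive_quadratic _ _ _ _ _ _ C) => h.
  rewrite [h%:A]mulr1 addr0 mulr0 subr0 [flat p 0]/flat ltxx subr0 /flat.
  case: ifPn => [h0|_]; last by rewrite normr0 mulr_ge0// sqr_ge0.
  have hV0 : 0 <= h^-1 by rewrite invr_ge0 ltW.
  have := HC _ hV0; rewrite !hornerE !normrM normfV (gtr0_norm h0) -mulrA -invfM.
  rewrite ler_pdivrMr ?mulr_gt0// => H.
  rewrite expRN normfV (gtr0_norm (expR_gt0 _)) ler_pdivrMr ?expR_gt0//.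
  by apply: le_trans H _; rewrite le_eqVlt; apply/orP; left; apply/eqP => /=; ring.
Unshelve. all: by end_near. Qed.

Lemma flat1_gt0 t : (0 < flat 1 t) = (0 < t).
Proof.
by rewrite /flat; case: ifPn; rewrite ?ltxx// hornerE mul1r expR_gt0.
Qed.

Lemma flat_le0 p t : t <= 0 -> flat p t = 0.
Proof. by rewrite /flat ltNge => ->. Qed.

Lemma flat1_ge0 t : 0 <= flat 1 t.
Proof. by have [t0|/flat_le0->//] := ltP 0 t; rewrite ltW// flat1_gt0. Qed.

End flat_functions.

Section bump_rV.
Context {R : realType} {n : nat}.
Implicit Types (x : 'rV[R]_n).

(** Positive exactly on the open unit box. The factors are written 1 + b * x_i to match
    [smooth_coordinate]. *)
Definition bump_rV x : R := \prod_(i < n) (flat 1 (1 + 1 * x 0 i) * flat 1 (1 + (-1) * x 0 i)).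

Lemma smooth_bump_rV : smooth bump_rV.
Proof.
pose F k := flat (iter k (@flat_next R) 1).
have dF k t : is_derive t (1 : R) (F k) (F k.+1 t) by exact: is_derive_flat.
apply: smooth_prod => i.
by apply: smoothM; exact: (@smooth_coordinate _ _ F).
Qed.

Lemma bump_rV_ge0 x : 0 <= bump_rV x.
Proof. by apply: prodr_ge0 => i _; rewrite mulr_ge0// flat1_ge0. Qed.

Lemma bump_rVN x : bump_rV (- x) = bump_rV x.
Proof. by apply: eq_bigr => i _; rewrite mxE mulrC; congr (flat _ _ * flat _ _); ring. Qed.

Lemma bump_rV_gt0 x : `|x| < 1 -> 0 < bump_rV x.
Proof.
move=> /rV_normP[_ x1]; apply: prodr_gt0 => i _; have := x1 i.
by rewrite ltr_norml => /andP[? ?]; rewrite mulr_gt0// flat1_gt0; lra.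
Qed.

Lemma bump_rV_eq0 x : 1 <= `|x| -> bump_rV x = 0.
Proof.
move=> x1; have [i xi] : exists i, 1 <= `|x 0 i|.
  apply: contrapT => /forallNP H; have : `|x| < 1.
    by apply/rV_normP; split=> // i; rewrite ltNge; exact/negP.
  by rewrite ltNge x1.
rewrite /bump_rV (bigD1 i)//= ; move: xi; rewrite ler_normr => /orP[xi|xi].
  by rewrite [flat 1 (1 + -1 * _)]flat_le0 ?mulr0 ?mul0r//; lra.
by rewrite [flat 1 (1 + 1 * _)]flat_le0 ?mul0r//; lra.
Qed.

End bump_rV.

Section real_integrals.
Context d (T : measurableType d) (R : realType) (mu : {measure set T -> \bar R}).
Implicit Types (f g : T -> R) (B D : set T).

Lemma integrable_bounded_on f (M : R) B : measurable_fun setT f ->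
  measurable B -> (mu B < +oo)%E -> (forall x, `|f x| <= M) ->
  (forall x, ~ B x -> f x = 0) -> mu.-integrable setT (EFin \o f).
Proof.
move=> mf mB Boo fM f0.
have iB := integrable_indic_lty mB Boo.
apply: (@le_integrable _ _ _ mu _ measurableT _ (fun x => (M%:E * (EFin \o \1_B) x)%E)).
- exact/measurable_EFinP.
- move=> x _ /=; rewrite lee_fin indicE.
  have [xB|xB] := boolP (x \in B).
    by rewrite mulr1 (le_trans (fM x))// ler_norm.
  by rewrite f0 ?normr0// => Bx; rewrite mem_set in xB.
- exact: integrableZl.
Qed.

Lemma integrable_mulr_bounded D f g (M : R) : measurable D -> mu.-integrable D (EFin \o f) ->
  measurable_fun D g -> (forall x, D x -> `|g x| <= M) ->
  mu.-integrable D (EFin \o (fun x => f x * g x)).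
Proof.
move=> mD intf mg gM.
have /integrableP[/measurable_EFinP mf _] := intf.
apply: (@le_integrable _ _ _ mu _ mD _ (fun x => (M%:E * (EFin \o f) x)%E)).
- by apply/measurable_EFinP; exact: measurable_funM.
- move=> x Dx /=; rewrite lee_fin !normrM mulrC ler_wpM2r//.
  by rewrite (le_trans (gM x Dx))// ler_norm.
- exact: integrableZl.
Qed.

Lemma le_normr_Rintegral_bound f (M : R) B : measurable_fun setT f ->
  measurable B -> (mu B < +oo)%E -> (forall x, `|f x| <= M) ->
  (forall x, ~ B x -> f x = 0) -> `|Rintegral mu setT f| <= M * fine (mu B).
Proof.
move=> mf mB Boo fM f0.
have intf := integrable_bounded_on mf mB Boo fM f0.
rewrite (le_trans (le_normr_Rintegral measurableT intf))//.
have E : M * fine (mu B) = (\int[mu]_x (M * \1_B x))%R.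
  rewrite RintegralZl//; last exact: integrable_indic_lty.
  by rewrite /Rintegral integral_indic// setIT.
rewrite E; apply: le_Rintegral => //.
- exact: integrable_norm.
- rewrite (_ : EFin \o _ = fun x => (M%:E * (EFin \o \1_B) x)%E)//.
  by apply: integrableZl => //; exact: integrable_indic_lty.
- move=> x _; rewrite indicE; have [xB|xB] := boolP (x \in B); first by rewrite mulr1.
  by rewrite mulr0 f0 ?normr0// => Bx; rewrite mem_set in xB.
Qed.

End real_integrals.

Section test_functions.
Context {R : realType} {n : nat}.
Implicit Types (f g phi : 'rV[R]_n -> R) (x y : 'rV[R]_n) (j : 'I_n) (U K C : set 'rV[R]_n).
Local Notation e_ j := (delta_mx 0 j : 'rV[R]_n).
Local Notation mu := (@lebesgue_rV R n).
Local Notation T := (@lebesgue_space R n).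

Lemma compact_in_open K U : compact K -> open U -> K `<=` U ->
  exists2 r : R, 0 < r & forall x, K x -> ball x r `<=` U.
Proof.
move=> cK oU KU; have [K0|K0] := pselect (K !=set0); last first.
  by exists 1 => // x Kx; exfalso; apply: K0; exists x.
have cf : continuous (fun x => sup (inner_radii U x)).
  exact: lipschitz_continuous_rV (sup_inner_radii_lipschitz U).
(* The truncated distance to the complement of U attains a positive minimum on K; half of it is a
   uniform radius. *)
have [c /set_mem Kc cmin] := EVT_min_rV K0 cK (continuous_subspaceT cf).
have c0 := sup_inner_radii_gt0 oU (KU _ Kc).
exists (sup (inner_radii U c) / 2) => [|x Kx]; first by rewrite divr_gt0.
have cx := cmin x (mem_set Kx).
have [r [_ rU] cr] : exists2 r, inner_radii U x r & sup (inner_radii U c) / 2 < r.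
  have e0 : 0 < sup (inner_radii U x) - sup (inner_radii U c) / 2 by lra.
  have [r xr] := sup_adherent e0 (inner_radii_sup U x).
  by rewrite opprB addrCA subrr addr0 => h; exists r.
by apply: subset_trans rU; apply: le_ball; exact: ltW.
Qed.

Lemma test_function_intro U C phi : smooth phi -> closed C -> bounded_set C -> C `<=` U ->
  (forall x, phi x != 0 -> C x) -> test_function U phi.
Proof.
move=> sphi cC bC CU supp.
have sC : closure [set x | phi x != 0] `<=` C.
  by rewrite [X in _ `<=` X](closure_id C).1//; exact: closureS.
split=> //; last exact: subset_trans CU.
apply: bounded_closed_compact; last exact: closed_closure.
by case: bC => M [Mr h]; exists M; split=> // t Mt x /sC; exact: h.
Qed.

Lemma test_function_supp U phi x : test_function U phi -> phi x != 0 -> U x.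
Proof. by move=> [_ _ sU] px; apply: sU; exact: subset_closure. Qed.

Lemma test_function_out U phi x : test_function U phi -> ~ U x -> phi x = 0.
Proof.
by move=> tphi; apply: contra_notP => /eqP; exact: test_function_supp.
Qed.

Lemma test_function_partial U phi j : test_function U phi -> test_function U (partial j phi).
Proof.
move=> [sphi cphi sU].
have H : closure [set x | partial j phi x != 0] `<=` closure [set x | phi x != 0].
  rewrite [X in _ `<=` X](closure_id _).1; last exact: closed_closure.
  apply: closureS => x /=; apply: contraNP => nx; apply/eqP.
  have oC : open (~` closure [set x | phi x != 0]).
    by apply: closed_openC; exact: closed_closure.
  have : is_derive x (e_ j) phi 0; last by case.
  apply: (@near_eq_is_derive _ _ _ (cst 0 : 'rV[R]_n -> R)).
  near=> y; apply/esym/eqP/negPn/negP => py.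
  have : (~` closure [set x | phi x != 0]) y.
    by near: y; exact: (open_nbhs_nbhs (conj oC nx)).
  by apply; exact: subset_closure.
split; [exact: smooth_partial| |exact: subset_trans sU].
by apply: subclosed_compact cphi H; exact: closed_closure.
Unshelve. all: by end_near. Qed.

Lemma test_functionM U phi g : test_function U phi -> smooth g ->
  test_function U (fun x => phi x * g x).
Proof.
move=> [sphi cphi sU] sg.
have H : closure [set x | phi x * g x != 0] `<=` closure [set x | phi x != 0].
  by apply: closureS => x /=; apply: contra_neq => ->; rewrite mul0r.
split; [exact: smoothM| |exact: subset_trans sU].
by apply: subclosed_compact cphi H; exact: closed_closure.
Qed.

Lemma test_function_bounded U phi : test_function U phi ->
  exists M : R, forall x, `|phi x| <= M.
Proof.
move=> [/smooth_continuous cphi cK _].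
have /compact_bounded[M [_ HM]] := continuous_compact (continuous_subspaceT cphi) cK.
exists (`|M| + 1) => x; have [p0|p0] := eqVneq (phi x) 0.
  by rewrite p0 normr0 addr_ge0.
apply: (HM (`|M| + 1)) => /=; first by rewrite (le_lt_trans (ler_norm _))// ltrDl.
by exists x => //; exact: subset_closure.
Qed.

Lemma test_function_bounded_support U phi : test_function U phi ->
  exists2 M : R, 0 < M & forall x, M < `|x| -> phi x = 0.
Proof.
move=> [_ /compact_bounded[M [_ HM]] _]; exists (`|M| + 1); first by rewrite ltr_pwDr.
move=> x; apply: contraTeq => px; rewrite -leNgt.
apply: (HM (`|M| + 1)) => /=; first by rewrite (le_lt_trans (ler_norm _))// ltrDl.
exact: subset_closure.
Qed.

Lemma smooth_measurable f : smooth f -> measurable_fun setT (f : T -> R).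
Proof. by move=> sf; apply: continuous_lebesgue_measurable; exact: smooth_continuous. Qed.

Lemma test_function_smooth U phi : test_function U phi -> smooth phi.
Proof. by case. Qed.

Lemma test_function_integrable U phi : test_function U phi ->
  mu.-integrable setT (EFin \o (phi : T -> R)).
Proof.
move=> tphi; have [M HM] := test_function_bounded tphi.
have [N N0 HN] := test_function_bounded_support tphi.
have b0 : 0 < N + 1 by rewrite addr_gt0.
apply: (@integrable_bounded_on _ T R mu phi M (ball (0 : 'rV[R]_n) (N + 1))) => //.
- by apply: smooth_measurable; exact: test_function_smooth tphi.
- by apply: lebesgue_space_borel; exact: measurable_rV_ball.
- by rewrite lebesgue_rV_ball// ltry.
- move=> x /ball_normP; rewrite sub0r normrN => /negP; rewrite -leNgt => xN.
  by apply: HN; rewrite (lt_le_trans _ xN)// ltrDl.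
Qed.

(** By translation invariance phi and its translates have the same integral, so only the
    second-order remainder contributes: h |I| <= C h^2 mu(B) for 0 < h <= 1. *)
Lemma Rintegral_partial0 U phi j : test_function U phi ->
  Rintegral mu setT (partial j phi : T -> R) = 0.
Proof.
move=> tphi; have tp := test_function_partial j tphi.
have sphi := test_function_smooth tphi; have sp := test_function_smooth tp.
have [C HC] := test_function_bounded (test_function_partial j tp).
have [N N0 HN] := test_function_bounded_support tphi.
have [N' N'0 HN'] := test_function_bounded_support tp.
(* Outside B, a point and its translate by a vector of norm at most 1 both avoid the supports of phi
   and of its derivative, so the remainder vanishes there. *)
pose B := ball (0 : 'rV[R]_n) (N + N' + 2).
have b0 : 0 < N + N' + 2 by rewrite !addr_gt0.
have mB : measurable (B : set T) by apply: lebesgue_space_borel; exact: measurable_rV_ball.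
have Boo : (mu B < +oo)%E by rewrite lebesgue_rV_ball// ltry.
have iphi := test_function_integrable tphi.
have ip := test_function_integrable tp.
have C0 : 0 <= C by exact: le_trans (HC 0).
set I := Rintegral _ _ _.
have key (h : R) : 0 < h -> h <= 1 -> `|I| <= (C * fine (mu B)) * h.
  move=> h0 h1.
  pose D x := phi (h *: e_ j + x) - phi x - h * partial j phi x.
  have its : mu.-integrable setT (EFin \o ((fun x => phi (h *: e_ j + x)) : T -> R)).
    exact: (integrable_translate (h *: e_ j) iphi).
  have i1 : mu.-integrable setT (EFin \o ((fun x => phi (h *: e_ j + x) - phi x) : T -> R)).
    by have := integrableB measurableT its iphi.
  have i2 : mu.-integrable setT (EFin \o ((fun x => h * partial j phi x) : T -> R)).
    by have := integrableZl measurableT h ip.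
  have ID : Rintegral mu setT (D : T -> R) = - (h * I).
    rewrite /D (RintegralB measurableT i1 i2) (RintegralB measurableT its iphi).
    rewrite (RintegralZl h measurableT ip).
    rewrite [X in X - _ - _](_ : _ = Rintegral mu setT (phi : T -> R)).
      by rewrite subrr sub0r.
    by congr fine; exact: (integral_translate (h *: e_ j) iphi).
  have := @le_normr_Rintegral_bound _ T R mu (D : T -> R) (C * h ^+ 2) B.
  rewrite ID normrN normrM (gtr0_norm h0) => H.
  have {}H : h * `|I| <= C * h ^+ 2 * fine (mu B).
    apply: H => //.
    - have /integrableP[/measurable_EFinP m1 _] := i1.
      have /integrableP[/measurable_EFinP m2 _] := i2.
      exact: (measurable_funB m1 m2).
    - by move=> x; apply: coordinate_quadratic => // y; exact: smooth_derivable.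
    - move=> x; rewrite /B => /ball_normP; rewrite sub0r normrN => /negP; rewrite -leNgt => xN.
      rewrite /D HN ?HN ?HN' ?mulr0 ?subrr//; try lra.
      have e1 : `|h *: e_ j| <= 1.
        apply/ler_addgt0Pr => d d0; apply: ltW; apply/rV_normP; split; first by rewrite addr_gt0.
        move=> l; rewrite !mxE/=; case: eqP => _; rewrite ?mulr1 ?mulr0 ?normr0 ?addr_gt0//.
        by rewrite gtr0_norm//; lra.
      have := ler_normB (h *: e_ j + x) (h *: e_ j); rewrite addrAC subrr add0r; lra.
  by rewrite -(ler_pM2l h0); move: H; lra.
apply/eqP; rewrite -normr_le0; apply/ler_addgt0Pr => e e0; rewrite add0r.
have V0 : 0 <= C * fine (mu B) by rewrite mulr_ge0// fine_ge0.
pose h := Num.min 1 (e / (C * fine (mu B) + 1)).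
have c0 : 0 < C * fine (mu B) + 1 by rewrite ltr_pwDr.
have h0 : 0 < h by rewrite lt_min ltr01 divr_gt0.
apply: (le_trans (key h h0 _)); first by rewrite ge_min lexx.
apply: (@le_trans _ _ ((C * fine (mu B) + 1) * h)).
  by rewrite ler_wpM2r ?(ltW h0)// lerDl.
by rewrite mulrC -ler_pdivlMr// ge_min lexx orbT.
Qed.

End test_functions.

(** * Mollification *)

Section markov_kernel.
Context d (T : measurableType d) (R : realType)
  (mu : {sigma_finite_measure set T -> \bar R}).
Variables (K : T -> T -> R) (M : R).
Hypotheses (K_ge0 : forall x y, 0 <= K x y) (K_le : forall x y, K x y <= M)
  (measurable_K : measurable_fun setT (fun p : T * T => K p.1 p.2))
  (K1 : forall x, (\int[mu]_y (K x y)%:E = 1)%E)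
  (K2 : forall y, (\int[mu]_x (K x y)%:E = 1)%E).

(** K is doubly stochastic: integral 1 in y gives Jensen's inequality at each x, and integral 1 in x
    gives the contraction after Tonelli's theorem. Convolution with a mollifier is the case K x y =
    rho(x - y). *)
Definition kernel_mean (g : T -> R) (x : T) : R := (\int[mu]_y (g y * K x y))%R.

(** Convexity of the power: its graph lies above the tangent at s. In the induction step the two
    lower bounds differ by (k + 1) s^k (t - s)^2. *)
Lemma exprn_tangent (k : nat) (s t : R) : 0 <= s -> 0 <= t ->
  s ^+ k.+1 + k.+1%:R * s ^+ k * (t - s) <= t ^+ k.+1.
Proof.
move=> s0 t0; elim: k => [|k IHk].
  by rewrite expr0 !expr1 !mul1r addrC subrK.
rewrite [leRHS]exprS; apply: (le_trans _ (ler_wpM2l t0 IHk)).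
rewrite -subr_ge0 (_ : _ - _ = k.+1%:R * s ^+ k * (t - s) ^+ 2).
  by rewrite mulr_ge0 ?sqr_ge0// mulr_ge0// exprn_ge0.
by rewrite -[in k.+2%:R]natr1 !exprS; move: (s ^+ k) (k.+1%:R : R) => a b; ring.
Qed.

Let mK x : measurable_fun setT (K x).
Proof. exact: (measurableT_comp measurable_K (pair1_measurable x)). Qed.

Lemma kernel_integrable g x : mu.-integrable setT (EFin \o g) ->
  mu.-integrable setT (EFin \o (fun y => g y * K x y)).
Proof.
move=> ig; apply: (@integrable_mulr_bounded _ _ _ _ _ _ _ M) => // y _.
by rewrite ger0_norm.
Qed.

Lemma kernel_mean_jensen g (k : nat) x : mu.-integrable setT (EFin \o g) ->
  mu.-integrable setT (EFin \o (fun y => `|g y| ^+ k.+1)) ->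
  ((`|kernel_mean g x| ^+ k.+1)%:E <= \int[mu]_y (`|g y| ^+ k.+1 * K x y)%:E)%E.
Proof.
move=> ig igk.
have ian : mu.-integrable setT (EFin \o (fun y => `|g y|)) by exact: integrable_norm.
have iK : mu.-integrable setT (EFin \o K x).
  apply/integrableP; split; first exact/measurable_EFinP.
  under eq_integral do rewrite /= ger0_norm//.
  by rewrite K1 ltry.
have K1' : (\int[mu]_y K x y)%R = 1 by rewrite /Rintegral K1.
have i1 := kernel_integrable x ian; have i2 := kernel_integrable x igk.
set s := (\int[mu]_y (`|g y| * K x y))%R.
have s0 : 0 <= s by apply: Rintegral_ge0 => y _; rewrite mulr_ge0.
have gs : `|kernel_mean g x| <= s.
  apply: (le_trans (le_normr_Rintegral measurableT (kernel_integrable x ig))).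
  rewrite le_eqVlt; apply/orP; left; apply/eqP/eq_Rintegral => y _.
  by rewrite normrM (ger0_norm (K_ge0 x y)).
have sE : s ^+ k.+1 <= (\int[mu]_y (`|g y| ^+ k.+1 * K x y))%R.
  (* The tangent at the mean s integrates to s^(k+1), because its linear term has mean zero under K
     x. *)
  have E : s ^+ k.+1 = (\int[mu]_y (s ^+ k.+1 * K x y + (k.+1%:R * s ^+ k) * (`|g y| * K x y)
      - (k.+1%:R * s ^+ k * s) * K x y))%R.
    have j1 : mu.-integrable setT (EFin \o (fun y => s ^+ k.+1 * K x y)).
      exact: (integrableZl measurableT (s ^+ k.+1) iK).
    have j2 : mu.-integrable setT (EFin \o (fun y => (k.+1%:R * s ^+ k) * (`|g y| * K x y))).
      exact: (integrableZl measurableT (k.+1%:R * s ^+ k) i1).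
    have j3 : mu.-integrable setT (EFin \o (fun y => (k.+1%:R * s ^+ k * s) * K x y)).
      exact: (integrableZl measurableT (k.+1%:R * s ^+ k * s) iK).
    have j12 : mu.-integrable setT (EFin \o (fun y => s ^+ k.+1 * K x y + (k.+1%:R * s ^+ k) * (`|g y| * K x y))).
      exact: (integrableD measurableT j1 j2).
    rewrite (RintegralB measurableT j12 j3) (RintegralD measurableT j1 j2).
    rewrite (RintegralZl _ measurableT iK) (RintegralZl _ measurableT i1).
    by rewrite (RintegralZl _ measurableT iK) K1' -/s !mulr1 addrK.
  rewrite [leLHS]E; apply: le_Rintegral => //.
    have j1 : mu.-integrable setT (EFin \o (fun y => s ^+ k.+1 * K x y)).
      exact: (integrableZl measurableT (s ^+ k.+1) iK).
    have j2 : mu.-integrable setT (EFin \o (fun y => (k.+1%:R * s ^+ k) * (`|g y| * K x y))).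
      exact: (integrableZl measurableT (k.+1%:R * s ^+ k) i1).
    have j3 : mu.-integrable setT (EFin \o (fun y => (k.+1%:R * s ^+ k * s) * K x y)).
      exact: (integrableZl measurableT (k.+1%:R * s ^+ k * s) iK).
    exact: (integrableB measurableT (integrableD measurableT j1 j2) j3).
  move=> y _; have := ler_wpM2r (K_ge0 x y) (exprn_tangent k s0 (normr_ge0 (g y))).
  by apply: le_trans; rewrite le_eqVlt; apply/orP; left; apply/eqP; ring.
rewrite -[leRHS]fineK; last by apply: integrable_fin_num => //; exact: i2.
by rewrite lee_fin (le_trans _ sE)// lerXn2r// ?nnegrE.
Qed.

Lemma kernel_mean_contraction g (k : nat) : measurable_fun setT (kernel_mean g) ->
  mu.-integrable setT (EFin \o g) ->
  mu.-integrable setT (EFin \o (fun y => `|g y| ^+ k.+1)) ->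
  (\int[mu]_x (`|kernel_mean g x| ^+ k.+1)%:E <= \int[mu]_y (`|g y| ^+ k.+1)%:E)%E.
Proof.
move=> mc ig igk; have /integrableP[/measurable_EFinP mgk _] := igk.
pose F (p : T * T) : \bar R := (`|g p.2| ^+ k.+1 * K p.1 p.2)%:E.
have mF : measurable_fun setT F.
  apply/measurable_EFinP; apply: measurable_funM => //.
  exact: (measurableT_comp mgk measurable_snd).
have F0 p : (0 <= F p)%E by rewrite lee_fin mulr_ge0// exprn_ge0.
apply: (@le_trans _ _ (\int[mu]_x \int[mu]_y F (x, y))%E).
  apply: ge0_le_integral => //.
  - apply/measurable_EFinP; apply: measurable_funX; exact: (measurableT_comp (@normr_measurable _ _) mc).
  - exact: measurable_fun_fubini_tonelli_F.
  - by move=> x _; exact: kernel_mean_jensen.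
rewrite (fubini_tonelli F mF F0) le_eqVlt; apply/orP; left; apply/eqP.
apply: eq_integral => y _; rewrite /F /=.
under eq_integral do rewrite EFinM.
rewrite ge0_integralZl//.
- by rewrite K2 mule1.
- by apply/measurable_EFinP; exact: (measurableT_comp measurable_K (pair2_measurable y)).
- by move=> x _; rewrite lee_fin.
Qed.

End markov_kernel.

Lemma bounded_mul_Rintegral d (S : measurableType d) (R : realType) (nu : {measure set S -> \bar R})
    (h a : S -> R) (M : R) : nu.-integrable setT (EFin \o h) ->
  measurable_fun setT a -> (forall y, `|a y| <= M) ->
  `|Rintegral nu setT (fun y => h y * a y)| <= M * Rintegral nu setT (fun y => `|h y|).
Proof.
move=> ih ma aM.
have iha : nu.-integrable setT (EFin \o (fun y => h y * a y)).
  exact: (integrable_mulr_bounded measurableT ih ma (fun y _ => aM y)).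
rewrite (le_trans (le_normr_Rintegral measurableT iha))//.
rewrite -(RintegralZl M measurableT (integrable_norm ih)).
apply: le_Rintegral => //.
- exact: (integrable_norm iha).
- exact: (integrableZl measurableT M (integrable_norm ih)).
- by move=> y _; rewrite normrM mulrC ler_wpM2r.
Qed.

Section convolution_smooth.
Context {R : realType} {n : nat}.
Implicit Types (f g rho : 'rV[R]_n -> R) (x y : 'rV[R]_n) (j : 'I_n).
Local Notation e_ j := (delta_mx 0 j : 'rV[R]_n).
Local Notation mu := (@lebesgue_rV R n).
Local Notation T := (@lebesgue_space R n).

Definition convolution g rho x : R := Rintegral mu setT ((fun y => g y * rho (x - y)) : T -> R).

Lemma test_functionT_reflect rho x : test_function setT rho ->
  measurable_fun setT ((fun y => rho (x - y)) : T -> R).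
Proof.
move=> /test_function_smooth sr; apply: smooth_measurable.
by have := smooth_affine x (-1) sr; congr smooth; apply/funext => y; rewrite scaleN1r.
Qed.

Lemma convolution_integrable g rho x : mu.-integrable setT (EFin \o (g : T -> R)) ->
  test_function setT rho -> mu.-integrable setT (EFin \o ((fun y => g y * rho (x - y)) : T -> R)).
Proof.
move=> ig tr; have [M HM] := test_function_bounded tr.
exact: (integrable_mulr_bounded measurableT ig (test_functionT_reflect x tr) (fun y _ => HM (x - y))).
Qed.

Lemma convolution_lipschitz g rho : mu.-integrable setT (EFin \o (g : T -> R)) ->
  test_function setT rho ->
  exists L : R, forall x y, `|convolution g rho x - convolution g rho y| <= L * `|x - y|.
Proof.
move=> ig tr; have sr := test_function_smooth tr.
have /choice[C HC] : forall j, exists C : R, forall x, `|partial j rho x| <= C.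
  by move=> j; exact: (test_function_bounded (test_function_partial j tr)).
pose C' : R := \sum_j `|C j|.
have HC' j x : `|partial j rho x| <= C'.
  rewrite (le_trans (HC j x))// /C' (bigD1 j)//= (le_trans (ler_norm _))// lerDl.
  exact: sumr_ge0.
have lr := bounded_partial_lipschitz (fun j y => @smooth_derivable _ _ rho j y sr) HC'.
exists (n%:R * C' * Rintegral mu setT ((fun z => `|g z|) : T -> R)) => x y.
rewrite /convolution -(RintegralB measurableT (convolution_integrable x ig tr) (convolution_integrable y ig tr)).
rewrite mulrAC; have ma := measurable_funB (test_functionT_reflect x tr) (test_functionT_reflect y tr).
have := @bounded_mul_Rintegral _ T R mu g _ (n%:R * C' * `|x - y|) ig ma.
under [in X in _ -> X]eq_Rintegral do rewrite -mulrBr.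
apply => z; apply: le_trans (lr _ _) _.
by rewrite opprB addrA subrK.
Qed.

(** The second-order remainder of rho is at most C h^2 everywhere, so its integral against g is a
    quadratic remainder for the convolution. *)
Lemma is_derive_convolution g rho j x : mu.-integrable setT (EFin \o (g : T -> R)) ->
  test_function setT rho ->
  is_derive x (e_ j) (convolution g rho) (convolution g (partial j rho) x).
Proof.
move=> ig tr; have sr := test_function_smooth tr.
have tp := test_function_partial j tr; have sp := test_function_smooth tp.
have [C HC] := test_function_bounded (test_function_partial j tp).
apply: (@is_derive_quadratic _ _ _ _ _ _ (C * Rintegral mu setT ((fun z => `|g z|) : T -> R))) => h.
have i1 := convolution_integrable (h *: e_ j + x) ig tr.
have i2 := convolution_integrable x ig tr; have i3 := convolution_integrable x ig tp.
have i3' : mu.-integrable setT (EFin \o ((fun y => h * (g y * partial j rho (x - y))) : T -> R)).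
  exact: (integrableZl measurableT h i3).
have i12 : mu.-integrable setT (EFin \o
    ((fun y => g y * rho (h *: e_ j + x - y) - g y * rho (x - y)) : T -> R)).
  exact: (integrableB measurableT i1 i2).
rewrite /convolution -(RintegralB measurableT i1 i2) -(RintegralZl h measurableT i3).
rewrite -(RintegralB measurableT i12 i3') mulrAC.
have ma := measurable_funB (measurable_funB (test_functionT_reflect (h *: e_ j + x) tr)
  (test_functionT_reflect x tr)) (measurable_funM (measurable_cst h) (test_functionT_reflect x tp)).
have := @bounded_mul_Rintegral _ T R mu g _ (C * h ^+ 2) ig ma.
rewrite [X in (_ -> `|X| <= _) -> _](_ : _ = Rintegral mu setT ((fun y =>
  g y * rho (h *: e_ j + x - y) - g y * rho (x - y) - h * (g y * partial j rho (x - y))) : T -> R)).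
  apply => y /=; rewrite -[h *: e_ j + x - y]addrA; apply: coordinate_quadratic => // z; exact: smooth_derivable.
apply: eq_Rintegral => y _ /=; ring.
Qed.

Lemma partial_convolution g rho j : mu.-integrable setT (EFin \o (g : T -> R)) ->
  test_function setT rho -> partial j (convolution g rho) = convolution g (partial j rho).
Proof. by move=> ig tr; apply: partialE => x; exact: is_derive_convolution. Qed.

Lemma smooth_convolution g rho : mu.-integrable setT (EFin \o (g : T -> R)) ->
  test_function setT rho -> smooth (convolution g rho).
Proof.
move=> ig tr; apply/smoothP => m; elim: m rho tr => [|m IHm] rho tr.
all: apply: (@smoothn_intro _ _ _ _ (fun j => convolution g (partial j rho))) => //.
1,3: by have [L HL] := convolution_lipschitz ig tr; exact: lipschitz_continuous_rV HL.
1,2: by move=> j x; exact: is_derive_convolution.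
by move=> j; apply: IHm; exact: test_function_partial.
Qed.

End convolution_smooth.

Section Lk_tools.
Context d (T : measurableType d) (R : realType) (mu : {measure set T -> \bar R}).
Implicit Types (f g h a b c : T -> R).

Lemma le_exprn_sum3 (k : nat) (t a b c : R) : 0 <= t -> 0 <= a -> 0 <= b -> 0 <= c ->
  t <= a + b + c -> t ^+ k <= 3%:R ^+ k * (a ^+ k + b ^+ k + c ^+ k).
Proof.
move=> t0 a0 b0 c0 tabc.
have [m [m0 hm mk]] : exists m : R, [/\ 0 <= m, t <= 3%:R * m & m ^+ k <= a ^+ k + b ^+ k + c ^+ k].
  have ak := exprn_ge0 k a0; have bk := exprn_ge0 k b0; have ck := exprn_ge0 k c0.
  have [ab|ab] := leP a b; have [bc|bc] := leP b c; have [ac|ac] := leP a c;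
    [exists c|exists c|exists b|exists b|exists c|exists a|exists c|exists a]; split=> //; lra.
apply: le_trans (_ : (3%:R * m) ^+ k <= _); first by rewrite lerXn2r ?nnegrE// mulr_ge0.
by rewrite exprMn ler_wpM2l// exprn_ge0.
Qed.

(** A substitute for Minkowski's inequality that stays with integrals of k-th powers, at the cost of
    the factor 3^k. *)
Lemma Lk_split3 (k : nat) f a b c : measurable_fun setT f -> measurable_fun setT a ->
  measurable_fun setT b -> measurable_fun setT c ->
  (forall x, `|f x| <= `|a x| + `|b x| + `|c x|) ->
  (\int[mu]_x (`|f x| ^+ k)%:E <= (3%:R ^+ k)%:E * (\int[mu]_x (`|a x| ^+ k)%:E +
    \int[mu]_x (`|b x| ^+ k)%:E + \int[mu]_x (`|c x| ^+ k)%:E))%E.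
Proof.
move=> mf ma mb mc fabc.
have mk (h : T -> R) : measurable_fun setT h -> measurable_fun setT (fun x : T => (`|h x| ^+ k)%:E).
  by move=> mh; apply/measurable_EFinP; apply: measurable_funX; exact: measurableT_comp.
have k0 (h : T -> R) (x : T) : (0 <= (`|h x| ^+ k)%:E)%E by rewrite lee_fin exprn_ge0.
rewrite -ge0_integralD//; [|exact: mk..].
rewrite -ge0_integralD//; [|by move=> x _; rewrite adde_ge0|by apply: emeasurable_funD; exact: mk|exact: mk].
have m3 : measurable_fun setT (fun x => ((`|a x| ^+ k)%:E + (`|b x| ^+ k)%:E + (`|c x| ^+ k)%:E)%E).
  by apply: emeasurable_funD; [apply: emeasurable_funD|]; exact: mk.
rewrite -ge0_integralZl//; try by [move=> x _; rewrite !adde_ge0|rewrite lee_fin exprn_ge0].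
apply: ge0_le_integral => //.
- exact: mk.
- exact: emeasurable_funM.
- by move=> x _; rewrite -!EFinD -EFinM lee_fin; exact: le_exprn_sum3.
Qed.

(** Large values are replaced by 0 instead of being clipped, so that g - truncate N g is everywhere
    either 0 or g and is dominated by |g|. *)
Definition truncate (N : R) g (x : T) : R := if `|g x| <= N then g x else 0.

Lemma measurable_truncate N g : measurable_fun setT g -> measurable_fun setT (truncate N g).
Proof.
move=> mg; apply: measurable_fun_ifT => //.
by apply: measurable_fun_ler => //; exact: measurableT_comp.
Qed.

Lemma truncate_le N g x : 0 <= N -> `|truncate N g x| <= N.
Proof. by rewrite /truncate; case: ifP => // _; rewrite normr0. Qed.

Lemma Lk_truncate (k : nat) g : measurable_fun setT g ->
  mu.-integrable setT (EFin \o (fun x => `|g x| ^+ k.+1)) ->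
  forall e : R, 0 < e -> exists2 N : R, 0 <= N &
    (\int[mu]_x (`|g x - truncate N g x| ^+ k.+1)%:E < e%:E)%E.
Proof.
move=> mg igk e e0.
have m1 (N : nat) : measurable_fun setT (fun x => `|g x - truncate N%:R g x| ^+ k.+1).
  apply: measurable_funX; apply: measurableT_comp => //.
  by apply: measurable_funB => //; exact: measurable_truncate.
have [|x i|N /(_ N (leqnn N))] := @L1_dominated _ T R mu _ (cst 0) _ m1 (measurable_cst _) igk _ _ e e0.
- move=> x; apply/cvgrPdist_lt => r r0; near=> N.
  rewrite /truncate ifT; first by rewrite subrr normr0 expr0n/= subrr normr0.
  by near: N; exact: nbhs_infty_ger.
- rewrite ger0_norm ?exprn_ge0// lerXn2r ?nnegrE// /truncate.
  by case: ifP => _; rewrite ?subrr ?normr0 ?subr0.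
move=> H; exists N%:R => //; apply: le_lt_trans H.
rewrite le_eqVlt; apply/orP; left; apply/eqP/eq_integral => x _.
by rewrite subr0 normrX normr_id.
Unshelve. all: by end_near. Qed.

Lemma integrable_of_Lk (k : nat) g B : measurable_fun setT g -> measurable B ->
  (mu B < +oo)%E -> (forall x, ~ B x -> g x = 0) ->
  mu.-integrable setT (EFin \o (fun x => `|g x| ^+ k.+1)) -> mu.-integrable setT (EFin \o g).
Proof.
move=> mg mB Boo g0 igk.
have iB := integrable_indic_lty mB Boo.
(* On B a value of modulus at most 1 is bounded by the indicator, a larger one by its own power. *)
apply: (@le_integrable _ _ _ mu _ measurableT _ (EFin \o (fun x => \1_B x + `|g x| ^+ k.+1))).
- exact/measurable_EFinP.
- move=> x _ /=; rewrite lee_fin [leRHS]ger0_norm ?addr_ge0 ?exprn_ge0// indicE.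
  have [xB|xB] := boolP (x \in B); last first.
    by rewrite g0 ?normr0 ?add0r ?exprn_ge0// => Bx; rewrite mem_set in xB.
  have [g1|g1] := leP `|g x| 1; first by rewrite (le_trans g1)// lerDl exprn_ge0.
  rewrite (@le_trans _ _ (`|g x| ^+ k.+1))// ?lerDr//.
  by rewrite exprS ler_peMr// exprn_ege1// ltW.
- exact: (integrableD measurableT iB igk).
Qed.

Lemma measurable_fun_normrX (k : nat) f : measurable_fun setT f ->
  measurable_fun setT (fun x => (`|f x| ^+ k)%:E).
Proof.
by move=> mf; apply/measurable_EFinP; apply: measurable_funX; exact: measurableT_comp.
Qed.

Lemma le_integral_subset (V : set T) f g : measurable V -> measurable_fun setT f ->
  measurable_fun setT g -> (forall x, V x -> `|f x| <= `|g x|) ->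
  (\int[mu]_(x in V) `|f x|%:E <= \int[mu]_x `|g x|%:E)%E.
Proof.
move=> mV mf mg fg; rewrite integral_mkcond; apply: ge0_le_integral => //.
- by move=> x _; rewrite patchE; case: ifP.
- apply/(measurable_restrictT _ _).1 => //.
  by apply: measurable_funTS; apply/measurable_EFinP; exact: measurableT_comp.
- by apply/measurable_EFinP; exact: measurableT_comp.
- move=> x _; rewrite patchE; case: ifPn => [/set_mem xV|_]; last by rewrite lee_fin.
  by rewrite lee_fin fg.
Qed.

Lemma integral_norm_le_measure (V : set T) f : measurable V -> measurable_fun setT f ->
  (forall x, `|f x| <= \1_V x) -> (\int[mu]_x `|f x|%:E <= mu V)%E.
Proof.
move=> mV mf fV; have <- : (\int[mu]_x (\1_V x)%:E = mu V)%E by rewrite integral_indic// setIT.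
apply: ge0_le_integral => //.
- by apply/measurable_EFinP; exact: measurableT_comp.
- by apply/measurable_EFinP; exact: measurable_indic.
- by move=> x _; rewrite lee_fin.
Qed.

Lemma Lk_scale (k : nat) (M : R) f g : 0 <= M -> measurable_fun setT f -> measurable_fun setT g ->
  (forall x, `|f x| <= M * `|g x|) ->
  (\int[mu]_x (`|f x| ^+ k)%:E <= (M ^+ k)%:E * \int[mu]_x (`|g x| ^+ k)%:E)%E.
Proof.
move=> M0 mf mg fg; rewrite -ge0_integralZl//; last 2 first.
- exact: measurable_fun_normrX.
- by rewrite lee_fin exprn_ge0.
apply: ge0_le_integral => //; first exact: measurable_fun_normrX.
  by apply: emeasurable_funM => //; exact: measurable_fun_normrX.
move=> x _; rewrite -EFinM lee_fin -exprMn.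
by rewrite lerXn2r ?nnegrE// mulr_ge0.
Qed.

End Lk_tools.

Section mollifiers.
Context {R : realType} {n : nat}.
Implicit Types (f g s rho : 'rV[R]_n -> R) (x y : 'rV[R]_n) (j : 'I_n) (B : set 'rV[R]_n).
Local Notation mu := (@lebesgue_rV R n).
Local Notation nu := (@completed_measure_extension _ _ _ (@borel_lebesgue R n)).
Local Notation T := (@lebesgue_space R n).

(** Evenness makes the kernel rho(x - y) symmetric, so that it has integral 1 in each variable. *)
Definition mollifier (e : R) rho : Prop :=
  [/\ test_function setT rho, forall x, 0 <= rho x, forall x, rho (- x) = rho x,
      forall x, e <= `|x| -> rho x = 0 & (\int[mu]_x (rho x)%:E = 1)%E].

Lemma smooth_Rintegral_gt0 f x : test_function setT f -> (forall y, 0 <= f y) -> 0 < f x ->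
  0 < Rintegral mu setT (f : T -> R).
Proof.
move=> tf f0 fx; have cf := smooth_continuous (test_function_smooth tf).
have fx2 : 0 < f x / 2 by rewrite divr_gt0.
have /cvgrPdist_lt/(_ _ fx2)/nbhs_ballP[r /= r0 H] := cf x.
have mB : measurable (ball x r : set T) by apply: lebesgue_space_borel; exact: measurable_rV_ball.
have Boo : (mu (ball x r) < +oo)%E by rewrite lebesgue_rV_ball// ltry.
have iB := @integrable_indic_lty _ T R mu (ball x r) mB Boo.
have V0 : 0 < fine (mu (ball x r)).
  by rewrite lebesgue_rV_ball//= exprn_gt0// mulrn_wgt0.
apply: (@lt_le_trans _ _ (f x / 2 * fine (mu (ball x r)))); first by rewrite mulr_gt0.
have -> : f x / 2 * fine (mu (ball x r)) =
    Rintegral mu setT ((fun y => f x / 2 * \1_(ball x r) y) : T -> R).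
  by rewrite (RintegralZl _ measurableT iB) /Rintegral integral_indic// setIT.
apply: le_Rintegral => //.
- exact: (integrableZl measurableT (f x / 2) iB).
- exact: test_function_integrable tf.
move=> y _; rewrite indicE; have [yB|yB] := boolP (y \in _); last by rewrite mulr0.
have := H y (set_mem yB); rewrite ltr_norml => /andP[h1 h2]; rewrite mulr1; lra.
Qed.

Lemma mollifier_exists (e : R) : 0 < e -> exists rho, mollifier e rho.
Proof.
move=> e0; pose b x : R := bump_rV (0 + e^-1 *: x).
have b_supp x : e <= `|x| -> b x = 0.
  move=> ex; apply: bump_rV_eq0; rewrite add0r normrZ gtr0_norm ?invr_gt0//.
  by rewrite mulrC ler_pdivlMr// mul1r.
have tb : test_function setT b.
  apply: (@test_function_intro _ _ _ [set x | `|x| <= e]) => //.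
  - by apply: smooth_affine; exact: smooth_bump_rV.
  - have -> : [set x : 'rV[R]_n | `|x| <= e] = (fun x => `|x|) @^-1` [set t | t <= e] by [].
    apply: closed_comp; last exact: closed_le.
    by move=> x _; apply: (@lipschitz_continuous_rV _ _ _ 1) => u v; rewrite mul1r ler_dist_dist.
  - by exists e; split; [exact: num_real|move=> t et x /= xe; exact: le_trans (ltW et)].
  - by move=> x /=; apply: contraNT; rewrite -ltNge => /ltW/b_supp ->.
have b0 x : 0 <= b x by exact: bump_rV_ge0.
have bx0 : 0 < b 0 by apply: bump_rV_gt0; rewrite scaler0 addr0 normr0.
have I0 := smooth_Rintegral_gt0 tb b0 bx0.
set I := Rintegral _ _ _ in I0.
exists (fun x => I^-1 * b x); split.
- by have := test_functionM tb (smooth_cst I^-1); congr test_function; apply/funext => x; rewrite mulrC.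
- by move=> x; rewrite mulr_ge0// invr_ge0 ltW.
- by move=> x; rewrite /b !add0r scalerN bump_rVN.
- by move=> x /b_supp ->; rewrite mulr0.
- have ib := test_function_integrable tb.
  under eq_integral do rewrite EFinM.
  rewrite (integralZl measurableT ib) -[X in (_ * X)%E]fineK; last exact: integrable_fin_num.
  by rewrite -EFinM -[fine _]/I mulVf// gt_eqF.
Qed.

Variables (e : R) (rho : 'rV[R]_n -> R).
Hypothesis mrho : mollifier e rho.

Let trho : test_function setT rho. Proof. by case: mrho. Qed.

Lemma mollifier_int_translate x : (\int[mu]_y (rho (x - y))%:E = 1)%E.
Proof.
have [_ r0 rN _ r1] := mrho; rewrite -r1.
rewrite -(@ge0_integral_translate _ _ (- x) (fun y => (rho y)%:E)).
- by apply: eq_integral => y _; rewrite -rN opprB addrC.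
- by apply/measurable_EFinP; exact: smooth_measurable (test_function_smooth trho).
- by move=> y; rewrite lee_fin.
Qed.

Lemma mollifier_int_translate' y : (\int[mu]_x (rho (x - y))%:E = 1)%E.
Proof.
have [_ _ rN _ _] := mrho; rewrite -(mollifier_int_translate y).
by apply: eq_integral => x _; rewrite -rN opprB.
Qed.

Lemma mollifier_measurable2 :
  measurable_fun setT ((fun p : T * T => rho ((p.1 : 'rV[R]_n) - (p.2 : 'rV[R]_n))) : T * T -> R).
Proof.
have mr : measurable_fun [set: 'rV[R]_n] rho.
  by apply: continuous_measurable_rV; exact: smooth_continuous (test_function_smooth trho).
have md : measurable_fun setT
    ((fun p => (p.1 : 'rV[R]_n) - (p.2 : 'rV[R]_n)) : T * T -> 'rV[R]_n).
  apply: measurable_fun_rVP => i.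
  have mi : measurable_fun setT ((fun x : 'rV[R]_n => x 0 i) : T -> R).
    by apply: borel_lebesgue_measurable; exact: measurable_rV_coord.
  rewrite (_ : _ \o _ = (fun p : T * T => (p.1 : 'rV[R]_n) 0 i - (p.2 : 'rV[R]_n) 0 i)).
    apply: measurable_funB.
      exact: (measurableT_comp mi measurable_fst).
    exact: (measurableT_comp mi measurable_snd).
  by apply/funext => p; rewrite /rV_coord /= !mxE.
exact: (measurableT_comp mr md).
Qed.

Lemma convolution_contraction g (k : nat) : mu.-integrable setT (EFin \o (g : T -> R)) ->
  mu.-integrable setT (EFin \o ((fun y => `|g y| ^+ k.+1) : T -> R)) ->
  (\int[mu]_x (`|convolution g rho x| ^+ k.+1)%:E <= \int[mu]_y (`|g y| ^+ k.+1)%:E)%E.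
Proof.
move=> ig igk; have [_ r0 _ _ _] := mrho.
have [M HM] := test_function_bounded trho.
apply: (@kernel_mean_contraction _ T R nu (fun x y : T => rho ((x : 'rV[R]_n) - y)) M).
- by move=> x y; exact: r0.
- by move=> x y; exact: le_trans (ler_norm _) (HM _).
- exact: mollifier_measurable2.
- exact: mollifier_int_translate.
- exact: mollifier_int_translate'.
- exact: (smooth_measurable (smooth_convolution ig trho)).
- exact: ig.
- exact: igk.
Qed.

Lemma convolution_lipschitz_close s (L : R) x : mu.-integrable setT (EFin \o (s : T -> R)) ->
  (forall x y, `|s x - s y| <= L * `|x - y|) ->
  `|convolution s rho x - s x| <= `|L| * e.
Proof.
move=> is_ sL; have [_ r0 rN rs _] := mrho.
have ir : mu.-integrable setT (EFin \o ((fun y => rho (x - y)) : T -> R)).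
  apply/integrableP; split; first exact/measurable_EFinP/test_functionT_reflect.
  under eq_integral do rewrite /= ger0_norm//.
  by rewrite mollifier_int_translate ltry.
have i1 := convolution_integrable x is_ trho.
have i2 : mu.-integrable setT (EFin \o ((fun y => s x * rho (x - y)) : T -> R)).
  exact: (integrableZl measurableT (s x) ir).
have r1 : Rintegral mu setT ((fun y => rho (x - y)) : T -> R) = 1.
  by rewrite /Rintegral mollifier_int_translate.
have i3 : mu.-integrable setT (EFin \o ((fun y => (`|L| * e) * rho (x - y)) : T -> R)).
  exact: (integrableZl measurableT (`|L| * e) ir).
have -> : s x = Rintegral mu setT ((fun y => s x * rho (x - y)) : T -> R).
  by rewrite (RintegralZl _ measurableT ir) r1 mulr1.
rewrite /convolution -(RintegralB measurableT i1 i2).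
have i12 := integrableB measurableT i1 i2.
apply: (le_trans (le_normr_Rintegral measurableT i12)).
have -> : `|L| * e = Rintegral mu setT ((fun y => (`|L| * e) * rho (x - y)) : T -> R).
  by rewrite (RintegralZl _ measurableT ir) r1 mulr1.
apply: le_Rintegral => //; first exact: (integrable_norm i12).
move=> y _; rewrite -mulrBl normrM (ger0_norm (r0 _)).
have [xy|xy] := leP e `|x - y|; first by rewrite rs// !mulr0.
rewrite ler_wpM2r//; apply: (le_trans (sL _ _)); rewrite distrC.
apply: (@le_trans _ _ (`|L| * `|x - y|)); first by rewrite ler_wpM2r// ler_norm.
by rewrite ler_wpM2l// ltW.
Qed.

Lemma convolution_supp s (M : R) x : (forall y, M < `|y| -> s y = 0) -> M + e < `|x| ->
  convolution s rho x = 0.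
Proof.
move=> sM Mx; have [_ _ _ rs _] := mrho.
rewrite /convolution (_ : (fun y : T => _) = cst 0); first by rewrite /Rintegral integral0.
apply/funext => y; have [yM|yM] := ltP M `|(y : 'rV[R]_n)|; first by rewrite sM// mul0r.
rewrite rs ?mulr0//.
have := ler_normD (x - y) y; rewrite subrK => h.
by move: (le_trans h (lerD (lexx _) yM)) Mx; lra.
Qed.

End mollifiers.

Section bounded_integral.
Context d (T : measurableType d) (R : realType) (mu : {measure set T -> \bar R}).
Implicit Types (f : T -> R) (B : set T).

Lemma integral_exprn_le_bound f (C : R) B (k : nat) : measurable_fun setT f -> measurable B ->
  0 <= C -> (forall x, `|f x| <= C) -> (forall x, ~ B x -> f x = 0) ->
  (\int[mu]_x (`|f x| ^+ k.+1)%:E <= (C ^+ k.+1)%:E * mu B)%E.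
Proof.
move=> mf mB C0 fC f0.
have -> : ((C ^+ k.+1)%:E * mu B = \int[mu]_x ((C ^+ k.+1)%:E * (\1_B x)%:E))%E.
  rewrite ge0_integralZl//; first by rewrite integral_indic// setIT.
  - exact/measurable_EFinP/measurable_indic.
  - by rewrite lee_fin exprn_ge0.
apply: ge0_le_integral => //.
- by apply/measurable_EFinP; apply: measurable_funX; exact: measurableT_comp.
- by apply: emeasurable_funM => //; exact/measurable_EFinP/measurable_indic.
- move=> x _; rewrite -EFinM lee_fin indicE; have [xB|xB] := boolP (x \in B).
    by rewrite mulr1 lerXn2r ?nnegrE.
  by rewrite mulr0 f0 ?normr0 ?expr0n// => Bx; rewrite mem_set in xB.
Qed.

Lemma integral_exprn_le_bounded f (C : R) (k : nat) : measurable_fun setT f ->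
  0 <= C -> (forall x, `|f x| <= C) ->
  (\int[mu]_x (`|f x| ^+ k.+1)%:E <= (C ^+ k)%:E * \int[mu]_x (`|f x|)%:E)%E.
Proof.
move=> mf C0 fC; rewrite -ge0_integralZl//; last 2 first.
- by apply/measurable_EFinP; exact: measurableT_comp.
- by rewrite lee_fin exprn_ge0.
apply: ge0_le_integral => //.
- by apply/measurable_EFinP; apply: measurable_funX; exact: measurableT_comp.
- by apply: emeasurable_funM => //; apply/measurable_EFinP; exact: measurableT_comp.
- move=> x _; rewrite -EFinM lee_fin exprSr ler_wpM2r//.
  by rewrite lerXn2r ?nnegrE.
Qed.

Lemma integrable_of_distance f g (e : R) : measurable_fun setT f -> measurable_fun setT g ->
  mu.-integrable setT (EFin \o g) -> (\int[mu]_x `|g x - f x|%:E < e%:E)%E ->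
  mu.-integrable setT (EFin \o f).
Proof.
move=> mf mg ig gf.
have i1 : mu.-integrable setT (EFin \o (fun x => g x - f x)).
  apply/integrableP; split; first by apply/measurable_EFinP; exact: measurable_funB.
  by apply: lt_trans gf _; rewrite ltry.
have := integrableB measurableT ig i1; congr (integrable _ _ _).
by apply/funext => x /=; rewrite -EFinB subKr.
Qed.

End bounded_integral.

Section mollification.
Context {R : realType} {n : nat}.
Implicit Types (f g s rho : 'rV[R]_n -> R) (x y : 'rV[R]_n) (j : 'I_n) (B : set 'rV[R]_n).
Local Notation mu := (@lebesgue_rV R n).
Local Notation T := (@lebesgue_space R n).

Lemma convolutionB g s rho x : mu.-integrable setT (EFin \o (g : T -> R)) ->
  mu.-integrable setT (EFin \o (s : T -> R)) -> test_function setT rho ->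
  convolution (fun y => g y - s y) rho x = convolution g rho x - convolution s rho x.
Proof.
move=> ig is_ tr.
rewrite /convolution -(RintegralB measurableT (convolution_integrable x ig tr) (convolution_integrable x is_ tr)).
by apply: eq_Rintegral => y _; rewrite mulrBl.
Qed.

(** As mollification contracts L^1, g may be replaced by a Lipschitz function s of bounded support,
    which is moved by at most |L| e on a ball of fixed volume V. *)
Lemma mollification_L1 g B : open B -> bounded_set B ->
  mu.-integrable setT (EFin \o (g : T -> R)) -> (forall x, ~ B x -> g x = 0) ->
  forall eta : R, 0 < eta -> exists2 e0 : R, 0 < e0 & forall (e : R) rho,
    e <= e0 -> mollifier e rho ->
    (\int[mu]_x `|convolution g rho x - g x|%:E < eta%:E)%E.
Proof.
move=> oB bB ig g0 eta eta0.
have [mg app] := integrable_lipschitz_approximable oB bB ig g0.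
(* Three errors enter with the factor 3 of [Lk_split3], and 3 * 3 * eta / 12 < eta. *)
have d0 : 0 < eta / 12%:R by rewrite divr_gt0.
have [s ls gs] := app _ d0; have [[L HL] [M HM]] := ls.
have ms := lipschitz_bounded_support_measurable ls.
have is_ : mu.-integrable setT (EFin \o (s : T -> R)).
  exact: (@integrable_of_distance _ T R mu s g (eta / 12%:R) ms mg ig gs).
(* For e <= 1 the mollified s still vanishes outside this ball. *)
pose C := ball (0 : 'rV[R]_n) (`|M| + 2%:R).
have b0 : 0 < `|M| + 2%:R by rewrite ltr_wpDl.
have mC : measurable (C : set T) by apply: lebesgue_space_borel; exact: measurable_rV_ball.
have CV : mu C = (((`|M| + 2%:R) *+ 2) ^+ n)%:E by rewrite lebesgue_rV_ball.
set V := ((`|M| + 2%:R) *+ 2) ^+ n in CV.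
have V0 : 0 <= V by rewrite exprn_ge0// mulrn_wge0// ltW.
have LV0 : 0 < `|L| * V + 1 by rewrite ltr_wpDl// mulr_ge0.
exists (Num.min 1 (eta / 12%:R / (`|L| * V + 1))) => [|e rho].
  by rewrite lt_min ltr01 divr_gt0.
rewrite le_min => /andP[e1 e2] mr; have [tr r0 _ _ _] := mr.
have igs : mu.-integrable setT (EFin \o ((fun y => g y - s y) : T -> R)).
  exact: (integrableB measurableT ig is_).
have mcg := smooth_measurable (smooth_convolution ig tr).
have mcs := smooth_measurable (smooth_convolution is_ tr).
have mcgs := smooth_measurable (smooth_convolution igs tr).
have mf := measurable_funB mcg mg; have mb := measurable_funB mcs ms.
have mc := measurable_funB ms mg.
have := @Lk_split3 _ T R mu 1 _ _ _ _ mf mcgs mb mc.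
have igs1 : mu.-integrable setT (EFin \o ((fun y => `|g y - s y| ^+ 1) : T -> R)).
  by under eq_fun do rewrite expr1; exact: (integrable_norm igs).
have ha : (\int[mu]_x (`|convolution (fun y => (g y - s y)%R) rho x| ^+ 1)%:E < (eta / 12%:R)%:E)%E.
  exact: le_lt_trans (convolution_contraction mr igs igs1) gs.
have e0 : 0 <= e.
  rewrite leNgt; apply/negP => eneg; have [_ _ _ rs r1] := mr.
  move: r1; under eq_integral => x _ do rewrite rs ?(le_trans (ltW eneg))//.
  by rewrite integral0 => /eqP; rewrite eqe eq_sym oner_eq0.
have hb : (\int[mu]_x (`|convolution s rho x - s x| ^+ 1)%:E < (eta / 12%:R)%:E)%E.
  have Le : 0 <= `|L| * e by rewrite mulr_ge0.
  apply: le_lt_trans (@integral_exprn_le_bound _ T R mu _ (`|L| * e) C 0 mb mC Le _ _) _.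
  - by move=> x; exact: (convolution_lipschitz_close mr x is_ HL).
  - move=> x /ball_normP; rewrite sub0r normrN => /negP; rewrite -leNgt => xC.
    have MM := ler_norm M.
    rewrite /= (convolution_supp mr HM) ?HM ?subrr//; lra.
  rewrite CV expr1 -EFinM lte_fin.
  apply: (@le_lt_trans _ _ (e * (`|L| * V))); first by rewrite mulrCA mulrA.
  have [->|ne] := eqVneq e 0; first by rewrite mul0r.
  apply: (@lt_le_trans _ _ (e * (`|L| * V + 1))).
    by rewrite ltr_pM2l ?ltrDl// lt_neqAle eq_sym ne.
  by rewrite -ler_pdivlMr.
have hc : (\int[mu]_x (`|s x - g x| ^+ 1)%:E < (eta / 12%:R)%:E)%E.
  by apply: le_lt_trans gs; under eq_integral do rewrite distrC.
move=> H; apply: (@lt_le_trans _ _ ((3%:R ^+ 1)%:E *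
    ((eta / 12%:R)%:E + (eta / 12%:R)%:E + (eta / 12%:R)%:E))%E); last first.
  by rewrite -!EFinD -EFinM lee_fin expr1; lra.
apply: le_lt_trans (H _) _.
  move=> x /=; rewrite convolutionB//.
  rewrite (_ : _ - g x = (convolution g rho x - convolution s rho x) +
    (convolution s rho x - s x) + (s x - g x)); last by ring.
  by rewrite (le_trans (ler_normD _ _))// lerD2r ler_normD.
rewrite lte_pmul2l ?lte_fin//; apply: lteD => //; exact: lteD.
Qed.

(** Truncation reduces to the case |g| <= N, where the power k + 1 of the error is at most (2 N)^k
    times the error itself and the L^1 statement applies. The tail is handled by the contraction in
    L^(k+1). *)
Lemma mollification_Lk g B (k : nat) : open B -> bounded_set B ->
  measurable_fun setT (g : T -> R) -> (forall x, ~ B x -> g x = 0) ->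
  mu.-integrable setT (EFin \o ((fun y => `|g y| ^+ k.+1) : T -> R)) ->
  forall eta : R, 0 < eta -> exists2 e0 : R, 0 < e0 & forall (e : R) rho,
    e <= e0 -> mollifier e rho ->
    (\int[mu]_x (`|convolution g rho x - g x| ^+ k.+1)%:E < eta%:E)%E.
Proof.
move=> oB bB mg g0 igk eta eta0.
have mB := open_lebesgue_measurable oB; have Boo := lebesgue_rV_bounded bB.
have ig := integrable_of_Lk mg mB Boo g0 igk.
(* The factor 4 leaves room for three errors after the factor 3^(k+1) of [Lk_split3]. *)
pose d := eta / (3%:R ^+ k.+1 * 4%:R).
have k3 : 0 < 3%:R ^+ k.+1 :> R by rewrite exprn_gt0.
have d0 : 0 < d by rewrite divr_gt0// mulr_gt0.
have [N N0 gN] := @Lk_truncate _ T R mu k g mg igk d d0.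
pose gT : 'rV[R]_n -> R := @truncate _ T R N g.
have mgT : measurable_fun setT (gT : T -> R) by exact: measurable_truncate.
have gT0 x : ~ B x -> gT x = 0 by rewrite /gT /truncate => /g0 ->; case: ifP.
have gTN x : `|gT x| <= N by exact: truncate_le.
have igT : mu.-integrable setT (EFin \o (gT : T -> R)).
  exact: (@integrable_bounded_on _ T R mu gT N B mgT mB Boo gTN gT0).
have c0 : 0 < d / ((N + N) ^+ k + 1).
  by rewrite divr_gt0// ltr_wpDl// exprn_ge0// addr_ge0.
have [e0 e00 He] := mollification_L1 oB bB igT gT0 c0.
exists e0 => // e rho ee mr; have [tr r0 _ _ r1] := mr.
have iggT : mu.-integrable setT (EFin \o ((fun y => g y - gT y) : T -> R)).
  exact: (integrableB measurableT ig igT).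
have mggT := measurable_funB mg mgT.
have iggTk : mu.-integrable setT (EFin \o ((fun y => `|g y - gT y| ^+ k.+1) : T -> R)).
  apply/integrableP; split.
    by apply/measurable_EFinP; apply: measurable_funX; exact: measurableT_comp.
  under eq_integral do rewrite /= ger0_norm ?exprn_ge0//.
  by apply: lt_trans gN _; rewrite ltry.
have mcg := smooth_measurable (smooth_convolution ig tr).
have mcT := smooth_measurable (smooth_convolution igT tr).
have mcgT := smooth_measurable (smooth_convolution iggT tr).
have mf := measurable_funB mcg mg; have mb := measurable_funB mcT mgT.
have mc := measurable_funB mgT mg.
have := @Lk_split3 _ T R mu k.+1 _ _ _ _ mf mcgT mb mc.
have ha : (\int[mu]_x (`|convolution (fun y => (g y - gT y)%R) rho x| ^+ k.+1)%:E < d%:E)%E.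
  exact: le_lt_trans (convolution_contraction mr iggT iggTk) gN.
have hb : (\int[mu]_x (`|convolution gT rho x - gT x| ^+ k.+1)%:E < d%:E)%E.
  have bN x : `|convolution gT rho x - gT x| <= N + N.
    rewrite (le_trans (ler_normB _ _))// lerD//.
    have ir : mu.-integrable setT (EFin \o ((fun y => rho (x - y)) : T -> R)).
      apply/integrableP; split; first exact/measurable_EFinP/test_functionT_reflect.
      under eq_integral do rewrite /= ger0_norm//.
      by rewrite (mollifier_int_translate mr) ltry.
    have := @bounded_mul_Rintegral _ T R mu (fun y => rho (x - y)) gT N ir mgT gTN.
    rewrite [X in (_ <= N * X)](_ : _ = 1); last first.
      rewrite /Rintegral; under eq_integral do rewrite /= ger0_norm//.
      by rewrite (mollifier_int_translate mr).
    rewrite mulr1; apply: le_trans; rewrite le_eqVlt; apply/orP; left; apply/eqP.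
    by congr `| _ |; apply: eq_Rintegral => y _; rewrite mulrC.
  have NN0 : 0 <= N + N by rewrite addr_ge0.
  apply: le_lt_trans (@integral_exprn_le_bounded _ T R mu _ (N + N) k mb NN0 bN) _.
  apply: (@le_lt_trans _ _ (((N + N) ^+ k)%:E * (d / ((N + N) ^+ k + 1))%:E)%E).
    by rewrite lee_wpmul2l ?lee_fin ?exprn_ge0//; apply: ltW; exact: (He e rho ee mr).
  rewrite -EFinM lte_fin mulrCA gtr_pMr// ltr_pdivrMr ?mul1r ?ltrDl//.
  by rewrite ltr_wpDl// exprn_ge0.
have hc : (\int[mu]_x (`|gT x - g x| ^+ k.+1)%:E < d%:E)%E.
  by apply: le_lt_trans gN; under eq_integral do rewrite distrC.
move=> H; apply: (@lt_le_trans _ _ ((3%:R ^+ k.+1)%:E * (d%:E + d%:E + d%:E))%E); last first.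
  rewrite -!EFinD -EFinM lee_fin /d.
  have c0' : (3%:R ^+ k.+1 : R) != 0 by rewrite lt0r_neq0.
  move: (3%:R ^+ k.+1 : R) c0' => c c0'.
  rewrite [leLHS](_ : _ = (3%:R / 4%:R) * eta); last by field.
  lra.
apply: le_lt_trans (H _) _.
  move=> x /=; rewrite convolutionB//.
  rewrite (_ : _ - g x = (convolution g rho x - convolution gT rho x) +
    (convolution gT rho x - gT x) + (gT x - g x)); last by ring.
  by rewrite (le_trans (ler_normD _ _))// lerD2r ler_normD.
rewrite lte_pmul2l ?lte_fin//; apply: lteD => //; exact: lteD.
Qed.

End mollification.

(** * Weak gradients *)

Section weak_gradients.
Context {R : realType} {n : nat}.
Implicit Types (f g u phi rho : 'rV[R]_n -> R) (x y : 'rV[R]_n) (j : 'I_n) (U : set 'rV[R]_n).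
Local Notation e_ j := (delta_mx 0 j : 'rV[R]_n).
Local Notation mu := (@lebesgue_rV R n).
Local Notation T := (@lebesgue_space R n).

(** A mollifier of width below r centred at such a point is a test function on U. *)
Definition inner_set U (r : R) : set 'rV[R]_n := [set x | r < sup (inner_radii U x)].

Lemma sup_inner_radii_continuous U : continuous (fun x => sup (inner_radii U x)).
Proof. exact: lipschitz_continuous_rV (sup_inner_radii_lipschitz U). Qed.

Lemma open_inner_set U r : open (inner_set U r).
Proof.
rewrite (_ : inner_set U r = (fun x => sup (inner_radii U x)) @^-1` `]r, +oo[%classic).
  apply: open_comp; last exact: interval_open.
  by move=> x _; exact: sup_inner_radii_continuous.
by apply/seteqP; split => x; rewrite /inner_set /= in_itv/= andbT.
Qed.

Lemma inner_set_ball U r x : inner_set U r x -> ball x r `<=` U.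
Proof.
rewrite /inner_set /= -subr_gt0 => h.
have [r' [_ r'U]] := sup_adherent h (inner_radii_sup U x).
rewrite opprB addrCA subrr addr0 => rr'.
by apply: subset_trans r'U; apply: le_ball; exact: ltW.
Qed.

Lemma inner_set_sub U r : 0 <= r -> inner_set U r `<=` U.
Proof.
move=> r0 x xU; apply: contrapT => /sup_inner_radii_eq0 h.
by move: xU; rewrite /inner_set /= h ltNge r0.
Qed.

Lemma closed_inner_radii_ge U (r : R) : closed [set x | r <= sup (inner_radii U x)].
Proof.
rewrite (_ : [set x | _] = (fun x => sup (inner_radii U x)) @^-1` [set t | r <= t])//.
apply: closed_comp; last exact: closed_ge.
by move=> x _; exact: sup_inner_radii_continuous.
Qed.

Lemma mollifier_test_function U (e r : R) rho x : mollifier e rho -> e < r ->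
  ball x r `<=` U -> test_function U (fun y => rho (x - y)).
Proof.
move=> [tr _ _ rs _] er xU.
have E : (fun y => rho (x - y)) = (fun y => rho (x + (-1) *: y)).
  by apply/funext => y; rewrite scaleN1r.
apply: (@test_function_intro _ _ _ [set y | `|x - y| <= e]).
- by rewrite E; apply: smooth_affine; exact: test_function_smooth tr.
- rewrite (_ : [set y | _] = (fun y => `|x - y|) @^-1` [set t | t <= e])//.
  apply: closed_comp; last exact: closed_le.
  move=> y _; apply: (@lipschitz_continuous_rV _ _ _ 1) => a b.
  by rewrite mul1r (le_trans (ler_dist_dist _ _))// opprB addrC addrA subrK distrC.
- exists (`|x| + e); split; first exact: num_real.
  move=> t et y /= xy; rewrite (le_trans _ (ltW et))//.
  by rewrite -{1}(subKr x y) (le_trans (ler_normB _ _))// lerD2l.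
- by move=> y /= xy; apply/xU/ball_normP; exact: le_lt_trans er.
- by move=> y /=; apply: contraNT; rewrite -ltNge => /ltW/rs ->.
Qed.

Lemma mollifier_partial_reflect (e : R) rho x j y : mollifier e rho ->
  partial j (fun y => rho (x - y)) y = - partial j rho (x - y).
Proof.
move=> [tr _ _ _ _].
have -> : (fun y => rho (x - y)) = (fun y => rho (x + (-1) *: y)).
  by apply/funext => z; rewrite scaleN1r.
have := derivableP (@smooth_derivable _ _ rho j (x + (-1) *: y) (test_function_smooth tr)).
move=> /is_derive_affine_rV[_ E].
by apply: etrans E _; rewrite mulN1r scaleN1r.
Qed.

Lemma ae0_of_L1_small g (V : set T) : measurable V -> mu.-integrable setT (EFin \o (g : T -> R)) ->
  (forall e : R, 0 < e -> (\int[mu]_(x in V) `|g x|%:E <= e%:E)%E) ->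
  {ae mu, forall x, V x -> g x = 0}.
Proof.
move=> mV ig H.
have igV := integrableS measurableT mV (@subsetT _ V) ig.
have I0 : (\int[mu]_(x in V) `|(EFin \o (g : T -> R)) x|)%E = 0%E.
  apply/eqP; rewrite eq_le integral_ge0 ?andbT//.
  by apply/lee_addgt0Pr => e e0; rewrite add0e; exact: H.
have /integrableP[mgV _] := igV.
have := (ae_eq_integral_abs mu mV mgV).1 I0.
by apply: filterS => x h Vx; have /= [] := h Vx.
Qed.

(** At a point of [inner_set U r], a mollification of g of width below r is a pairing with a test
    function, hence 0; it is also close to g in L^1. So g vanishes almost everywhere on each of
    countably many sets that exhaust U. *)
Lemma du_bois_reymond U g : open U -> bounded_set U ->
  mu.-integrable setT (EFin \o (g : T -> R)) -> (forall x, ~ U x -> g x = 0) ->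
  (forall phi, test_function U phi -> Rintegral mu setT ((fun x => g x * phi x) : T -> R) = 0) ->
  {ae mu, forall x, g x = 0}.
Proof.
move=> oU bU ig g0 H.
have mg : measurable_fun setT (g : T -> R) by have /integrableP[/measurable_EFinP] := ig.
have key (m : nat) : {ae mu, forall x, inner_set U m.+1%:R^-1 x -> g x = 0}.
  apply: (@ae0_of_L1_small g (inner_set U m.+1%:R^-1)) => //.
    by apply: open_lebesgue_measurable; exact: open_inner_set.
  move=> eta eta0; have [e0 e00 He] := mollification_L1 oU bU ig g0 eta0.
  have m0 : 0 < (m.+1%:R^-1 : R) by [].
  move: (m.+1%:R^-1 : R) m0 => r r0.
  have [e [ep ee er]] : exists e, [/\ 0 < e, e <= e0 & e < r].
    exists (Num.min e0 (r / 2)); rewrite lt_min e00 divr_gt0// ge_min lexx; split=> //.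
    by rewrite gt_min; apply/orP; right; rewrite ltr_pdivrMr// ltr_pMr ?ltr1n.
  have [rho mr] := mollifier_exists (n := n) ep.
  have [tr _ _ _ _] := mr; apply: le_trans (ltW (He e rho ee mr)).
  have mc := smooth_measurable (smooth_convolution ig tr).
  apply: (@le_integral_subset _ T R mu _ g _ _ mg (measurable_funB mc mg)).
    by apply: open_lebesgue_measurable; exact: open_inner_set.
  move=> x xV /=; have -> : convolution g rho x = 0.
    by apply: H; exact: (mollifier_test_function mr er (inner_set_ball xV)).
  by rewrite sub0r normrN.
have /ae_foralln := key; apply: filterS => x h.
have [Ux|/g0//] := pselect (U x); have s0 := sup_inner_radii_gt0 oU Ux.
have [m _ /(_ m (leqnn m)) hm] := near_infty_natSinv_lt (PosNum s0).
exact: (h m hm).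
Qed.

(** Functions on U are represented by their extension by zero, so that integrals and convolutions
    are taken over the whole space. *)
Definition Lk_on U (k : nat) u : Prop :=
  [/\ measurable_fun setT (u : T -> R), forall x, ~ U x -> u x = 0 &
      mu.-integrable setT (EFin \o ((fun x => `|u x| ^+ k) : T -> R))].

Definition weak_gradient U u (d : 'I_n -> 'rV[R]_n -> R) : Prop :=
  forall phi j, test_function U phi ->
    Rintegral mu setT ((fun x => u x * partial j phi x) : T -> R) =
    - Rintegral mu setT ((fun x => d j x * phi x) : T -> R).

Lemma Lk_on_integrable U (k : nat) u : open U -> bounded_set U ->
  Lk_on U k.+1 u -> mu.-integrable setT (EFin \o (u : T -> R)).
Proof.
move=> oU bU [mu_ u0 iu].
exact: (integrable_of_Lk mu_ (open_lebesgue_measurable oU) (lebesgue_rV_bounded bU) u0 iu).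
Qed.

(** The inverse of 1 plus the sum of the inverses replaces the minimum, which would be undefined for
    n = 0. *)
Lemma positive_lower_bound (F : 'I_n -> R) : (forall j, 0 < F j) ->
  exists2 e : R, 0 < e & forall j, e <= F j.
Proof.
move=> F0; have S0 : 0 <= \sum_j (F j)^-1 by apply: sumr_ge0 => j _; rewrite invr_ge0 ltW.
exists (1 + \sum_j (F j)^-1)^-1; first by rewrite invr_gt0 ltr_pwDl.
move=> j; rewrite -[leRHS]invrK lef_pV2 ?posrE ?invr_gt0 ?ltr_pwDl//.
rewrite (bigD1 j)//= addrCA lerDl addr_ge0//.
by apply: sumr_ge0 => i _; rewrite invr_ge0 ltW.
Qed.

(** The extension of u by zero has in general no weak gradient across the boundary of U, so
    gradients can be approximated only away from it; this is why they are compared after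
    multiplication by phi. *)
Lemma smooth_approximation U (k : nat) u (d : 'I_n -> 'rV[R]_n -> R) phi (eta : R) :
  open U -> bounded_set U -> Lk_on U k.+1 u -> (forall j, Lk_on U k.+1 (d j)) ->
  weak_gradient U u d -> test_function U phi -> 0 < eta ->
  exists h, [/\ smooth h,
    (\int[mu]_x (`|u x - h x| ^+ k.+1)%:E < eta%:E)%E &
    forall j, (\int[mu]_x (`|phi x * (d j x - partial j h x)| ^+ k.+1)%:E < eta%:E)%E].
Proof.
move=> oU bU Lu Ld wd tphi eta0.
have [M HM] := test_function_bounded tphi.
have M0 : 0 <= M by exact: le_trans (HM 0).
have Mk0 : 0 < M ^+ k.+1 + 1 by rewrite ltr_wpDl// exprn_ge0.
have eta'0 : 0 < eta / (M ^+ k.+1 + 1) by rewrite divr_gt0.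
have [mu_ u0 iuk] := Lu; have iu := Lk_on_integrable oU bU Lu.
have [e0 e00 He0] := mollification_Lk oU bU mu_ u0 iuk eta0.
have /choice[e1 He1] : forall j, exists e1 : R, 0 < e1 /\ forall (e : R) rho,
    e <= e1 -> mollifier e rho ->
    (\int[mu]_x (`|convolution (d j) rho x - d j x| ^+ k.+1)%:E < (eta / (M ^+ k.+1 + 1))%:E)%E.
  move=> j; have [md d0 idk] := Ld j.
  by have [e1 e10 He1] := mollification_Lk oU bU md d0 idk eta'0; exists e1.
have [e2 e20 He2] := positive_lower_bound (fun j => (He1 j).1).
have [sphi cphi suppU] := tphi; have [r r0 Hr] := compact_in_open cphi oU suppU.
have [e [ep ee ee2 er]] : exists e, [/\ 0 < e, e <= e0, e <= e2 & e < r].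
  exists (Num.min e0 (Num.min e2 (r / 2))); rewrite !lt_min e00 e20 divr_gt0//.
  by split=> //; rewrite ?gt_min ?ge_min ?lexx ?orbT//; apply/orP; right; apply/orP; right; lra.
have [rho mr] := mollifier_exists (n := n) ep; have [tr _ _ _ _] := mr.
exists (convolution u rho); split.
- exact: smooth_convolution.
- by apply: le_lt_trans (He0 e rho ee mr); under eq_integral do rewrite distrC.
move=> j; have [md d0 idk] := Ld j; have id_ := Lk_on_integrable oU bU (Ld j).
have mcd := smooth_measurable (smooth_convolution id_ tr).
have mph := smooth_measurable sphi.
have mh := smooth_measurable (smooth_convolution iu tr).
have mB := measurable_funB md mcd.
apply: (@le_lt_trans _ _ ((M ^+ k.+1)%:E * \int[mu]_x (`|convolution (d j) rho x - d j x| ^+ k.+1)%:E)%E).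
  have -> : (\int[mu]_x (`|phi x * (d j x - partial j (convolution u rho) x)| ^+ k.+1)%:E =
    \int[mu]_x (`|phi x * (d j x - convolution (d j) rho x)| ^+ k.+1)%:E)%E.
    apply: eq_integral => x _; have [->|px] := eqVneq (phi x) 0; first by rewrite !mul0r.
    congr ((`| _ * (_ - _) | ^+ _)%:E); rewrite (partial_convolution _ iu tr) /convolution.
    (* On the support of phi the mollifier centred at x is a test function on U, so the gradient of
       the mollified u is the mollified gradient. *)
    have sx : closure [set y | phi y != 0] x by exact: subset_closure.
    have tx := mollifier_test_function mr er (Hr x sx).
    have := wd _ j tx.
    rewrite (_ : Rintegral _ _ _ = - Rintegral mu setT ((fun y => u y * partial j rho (x - y)) : T -> R)).
      by move/oppr_inj.
    rewrite -mulN1r -(RintegralZl _ measurableT (convolution_integrable x iu (test_function_partial j tr))).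
    apply: eq_Rintegral => y _; rewrite (mollifier_partial_reflect x j y mr); ring.
  apply: (@Lk_scale _ T R mu k.+1 M _ _ M0 (measurable_funM mph mB) (measurable_funB mcd md)).
  by move=> x /=; rewrite normrM distrC ler_wpM2r.
apply: (@le_lt_trans _ _ ((M ^+ k.+1)%:E * (eta / (M ^+ k.+1 + 1))%:E)%E).
  rewrite lee_wpmul2l ?lee_fin ?exprn_ge0//.
  exact: (ltW ((He1 j).2 e rho (le_trans ee2 (He2 j)) mr)).
by rewrite -EFinM lte_fin mulrCA gtr_pMr// ltr_pdivrMr ?mul1r ?ltrDl.
Qed.

End weak_gradients.

(** * Jacobian minors *)

Section determinants.
Context {R : realType}.

Definition cons_row (A : Type) (k : nat) (a : A) (d : 'I_k -> A) : 'I_k.+1 -> A :=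
  fun i => if unlift ord0 i is Some i' then d i' else a.

Lemma cons_row0 (A : Type) k (a : A) (d : 'I_k -> A) : cons_row a d ord0 = a.
Proof. by rewrite /cons_row unlift_none. Qed.

Lemma cons_rowS (A : Type) k (a : A) (d : 'I_k -> A) i : cons_row a d (lift ord0 i) = d i.
Proof. by rewrite /cons_row liftK. Qed.

Lemma cons_row_eta (A : Type) k (d : 'I_k.+1 -> A) :
  d = cons_row (d ord0) (fun i => d (lift ord0 i)).
Proof.
by apply/funext => i; case: (unliftP ord0 i) => [j|] ->; rewrite ?cons_row0 ?cons_rowS.
Qed.

(** The rows are covector fields indexed by any type N and J picks the columns, so that deleting a
    column in a cofactor expansion is composition of J with [lift c]. For k = 0 it is the constant
    1. *)
Definition jac (T N : Type) (k : nat) (d : 'I_k -> N -> T -> R) (J : 'I_k -> N) (x : T) : R :=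
  \det (\matrix_(i < k, c < k) d i (J c) x).

Lemma jac_cons (T N : Type) k (a : N -> T -> R) (d : 'I_k -> N -> T -> R) (J : 'I_k.+1 -> N) x :
  jac (cons_row a d) J x =
  \sum_c a (J c) x * ((-1) ^+ c * jac d (fun e => J (lift c e)) x).
Proof.
rewrite /jac (expand_det_row _ ord0); apply: eq_bigr => c _.
rewrite mxE cons_row0 /cofactor add0n; congr (_ * (_ * \det _)).
by apply/matrixP => i e; rewrite !mxE cons_rowS.
Qed.

Lemma prod_le_sum_exprn (k : nat) (x : 'I_k.+1 -> R) : (forall i, 0 <= x i) ->
  \prod_i x i <= \sum_i x i ^+ k.+1.
Proof.
move=> x0; case: (@arg_maxP _ _ _ (ord0 : 'I_k.+1) xpredT x isT) => i0 _ xmax.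
apply: (@le_trans _ _ (\prod_(i < k.+1) x i0)).
  by apply: ler_prod => i _; rewrite x0/=; exact: xmax.
rewrite prodr_const card_ord (bigD1 i0)//= lerDl.
by apply: sumr_ge0 => i _; exact: exprn_ge0.
Qed.

(* Young's inequality for a product, with the weight moved to the first factor. *)
Lemma young_prod (k : nat) (eta : R) : 0 < eta -> exists2 C : R, 0 <= C &
  forall (a : R) (b : 'I_k -> R), 0 <= a -> (forall i, 0 <= b i) ->
    a * \prod_i b i <= C * a ^+ k.+1 + eta * \sum_i b i ^+ k.+1.
Proof.
(* Dividing a by t^k and multiplying each b i by t leaves the product unchanged, while t^(k+1) <=
   eta makes the weight of the b i small. *)
move=> eta0; pose t := Num.min 1 eta.
have t0 : 0 < t by rewrite lt_min ltr01.
have t1 : t <= 1 by rewrite ge_min lexx.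
have tk : t ^+ k.+1 <= eta.
  rewrite exprS (@le_trans _ _ t)//; last by rewrite ge_min lexx orbT.
  by rewrite ler_piMr// ?exprn_ile1// ltW.
exists (t ^- k ^+ k.+1) => [|a b a0 b0]; first by rewrite exprn_ge0// invr_ge0 exprn_ge0// ltW.
pose x (i : 'I_k.+1) := cons_row (t ^- k * a) (fun i => t * b i) i.
have x0 i : 0 <= x i.
  rewrite /x; case: (unliftP ord0 i) => [j|] ->; rewrite ?cons_row0 ?cons_rowS mulr_ge0//.
    exact: ltW.
  by rewrite invr_ge0 exprn_ge0// ltW.
have := prod_le_sum_exprn x0; rewrite !big_ord_recl /x cons_row0.
under [X in _ * X <= _]eq_bigr do rewrite cons_rowS.
under [X in _ <= _ + X]eq_bigr do rewrite cons_rowS exprMn.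
rewrite big_split/= prodr_const card_ord exprMn -mulr_sumr => H.
have E : a * \prod_i b i = t ^- k * a * (t ^+ k * \prod_i b i).
  have tk0 : t ^+ k != 0 by rewrite expf_neq0// gt_eqF.
  by move: (t ^+ k) tk0 => u u0; field.
rewrite E (le_trans H)// lerD2l ler_wpM2r//.
by apply: sumr_ge0 => i _; exact: exprn_ge0.
Qed.

(** Young's inequality on each term of the Leibniz formula, in the role of Hoelder's: after
    integration the determinant is small as soon as the first row is small in L^(k+1) and the others
    are bounded there. *)
Lemma det_young (k : nat) (eta : R) : 0 < eta -> exists2 C : R, 0 <= C &
  forall M : 'M[R]_k.+1, `|\det M| <= C * \sum_c `|M ord0 c| ^+ k.+1 +
    eta * \sum_i \sum_c `|M (lift ord0 i) c| ^+ k.+1.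
Proof.
(* The number of permutations; each term of the Leibniz formula receives the share eta / (N + 1). *)
move=> eta0; pose N : R := #|(fun=> true) : pred 'S_k.+1|%:R.
have N0 : 0 <= N by exact: ler0n.
have e0 : 0 < eta / (N + 1) by rewrite divr_gt0// ltr_wpDl.
have [C C0 HC] := young_prod k e0.
exists (N * C) => [|M]; first by rewrite mulr_ge0.
set S0 := \sum_c `|M ord0 c| ^+ k.+1; set S1 := \sum_i \sum_c `|M (lift ord0 i) c| ^+ k.+1.
have S10 : 0 <= S1.
  by apply: sumr_ge0 => i _; apply: sumr_ge0 => c _; rewrite exprn_ge0.
apply: (@le_trans _ _ (\sum_(s : 'S_k.+1) (C * S0 + eta / (N + 1) * S1))).
  rewrite (le_trans (ler_norm_sum _ _ _))//; apply: ler_sum => s _.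
  rewrite normrM normr_sign mul1r normr_prod big_ord_recl.
  apply: (le_trans (HC _ (fun i => `|M (lift ord0 i) (s (lift ord0 i))|) (normr_ge0 _) (fun i => normr_ge0 _))).
  apply: lerD.
    by rewrite ler_wpM2l// /S0 (bigD1 (s ord0))//= lerDl; apply: sumr_ge0 => c _; exact: exprn_ge0.
  rewrite ler_wpM2l ?(ltW e0)//; apply: ler_sum => i _.
  by rewrite (bigD1 (s (lift ord0 i)))//= lerDl; apply: sumr_ge0 => c _; exact: exprn_ge0.
rewrite sumr_const -mulr_natl -[_%:R]/N mulrDr mulrA lerD2l.
rewrite mulrA ler_wpM2r// mulrCA -[leRHS]mulr1 ler_wpM2l ?(ltW eta0)//.
by rewrite ler_pdivrMr ?mul1r ?lerDl// ltr_wpDl.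
Qed.

(* This is d(dg) = 0 for the Hessian H of g: the terms cancel in pairs when
   the indices of the first two rows are exchanged. *)
Lemma symmetric_alternating_sum (N : Type) k (H : N -> N -> R) (d : 'I_k -> N -> R)
    (J : 'I_k.+2 -> N) : (forall a b, H a b = H b a) ->
  \sum_(c < k.+2) (-1) ^+ c * \det (\matrix_(i < k.+1, e < k.+1)
    cons_row (H (J c)) d i (J (lift c e))) = 0.
Proof.
move=> Hsym.
(* [A c] has the c-th unit vector as first row, which turns the signed cofactors into full
   determinants whose Leibniz formula runs over all permutations. *)
pose A (c : 'I_k.+2) : 'M[R]_k.+2 := \matrix_(i, e) cons_row (fun e => (e == c)%:R)
  (cons_row (fun e => H (J c) (J e)) (fun i e => d i (J e))) i e.
have detA (c : 'I_k.+2) : (-1) ^+ c * \det (\matrix_(i < k.+1, e < k.+1)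
    cons_row (H (J c)) d i (J (lift c e))) = \det (A c).
  rewrite [RHS](expand_det_row _ ord0) (bigD1 c)//= big1 ?addr0; last first.
    by move=> j jc; rewrite mxE cons_row0 (negbTE jc) mul0r.
  rewrite mxE cons_row0 eqxx mul1r /cofactor add0n; congr (_ * \det _).
  apply/matrixP => i e; rewrite !mxE cons_rowS.
  by case: (unliftP ord0 i) => [j|] ->; rewrite ?cons_row0 ?cons_rowS.
pose i1 : 'I_k.+2 := lift ord0 ord0.
pose P (s : 'S_k.+2) := \prod_(i < k) d i (J (s (lift ord0 (lift ord0 i)))).
have detE (c : 'I_k.+2) : \det (A c) = \sum_(s : 'S_k.+2) (-1) ^+ s * ((s ord0 == c)%:R * (H (J c) (J (s i1)) * P s)).
  apply: eq_bigr => s _; congr (_ * _); rewrite !big_ord_recl !mxE cons_row0 cons_rowS cons_row0.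
  by congr (_ * (_ * _)); apply: eq_bigr => i _; rewrite !mxE !cons_rowS.
have -> : \sum_(c < k.+2) (-1) ^+ c * \det (\matrix_(i < k.+1, e < k.+1)
    cons_row (H (J c)) d i (J (lift c e))) =
  \sum_(s : 'S_k.+2) (-1) ^+ s * (H (J (s ord0)) (J (s i1)) * P s).
  under eq_bigr do rewrite detA detE.
  rewrite exchange_big/=; apply: eq_bigr => s _.
  rewrite (bigD1 (s ord0))//= eqxx mul1r big1 ?addr0// => c.
  by rewrite eq_sym => /negbTE ->; rewrite mul0r mulr0.
set S := \sum_s _.
have SN : S = - S.
  rewrite {1}/S (reindex_inj (mulgI (tperm ord0 i1)))/= -sumrN.
  apply: eq_bigr => s _; rewrite odd_permM odd_tperm/=.
  rewrite !permM tpermL tpermR Hsym signrN mulNr.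
  congr (- (_ * (_ * _))); apply: eq_bigr => i _; rewrite permM tpermD//.
by move: SN => /eqP; rewrite -addr_eq0 -mulr2n mulrn_eq0/= => /eqP.
Qed.

End determinants.

Section jacobian_integrals.
Context d (T : measurableType d) (R : realType) (mu : {measure set T -> \bar R}).

Lemma measurable_jac (N : Type) k (D : 'I_k -> N -> T -> R) (J : 'I_k -> N) :
  (forall i c, measurable_fun setT (D i (J c))) -> measurable_fun setT (jac D J).
Proof.
elim: k D J => [|k IHk] D J mD.
  rewrite (_ : jac D J = cst 1)//; apply/funext => x.
  by rewrite /jac (_ : \matrix_(_, _) _ = 1%:M) ?det1//; apply/matrixP => -[].
rewrite (cons_row_eta D).
rewrite (_ : jac _ J = fun x => \sum_c D ord0 (J c) x *
  ((-1) ^+ c * jac (fun i => D (lift ord0 i)) (fun e => J (lift c e)) x)); last first.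
  by apply/funext => x; rewrite jac_cons.
apply: measurable_sum => c; apply: measurable_funM => //; apply: measurable_funM => //.
by apply: IHk => i e; exact: mD.
Qed.

Lemma Rintegral_sum (I : Type) (r : seq I) (F : I -> T -> R) :
  (forall i, mu.-integrable setT (EFin \o F i)) ->
  mu.-integrable setT (EFin \o (fun x => \sum_(i <- r) F i x)) /\
  Rintegral mu setT (fun x => \sum_(i <- r) F i x) = \sum_(i <- r) Rintegral mu setT (F i).
Proof.
move=> iF; elim: r => [|i r [IH1 IH2]].
  have E : (fun x : T => \sum_(i <- [::]) F i x) = cst 0 by apply/funext => x; rewrite big_nil.
  by rewrite E big_nil /Rintegral integral0; split => //; exact: integrable0.
have E : (fun x => \sum_(j <- i :: r) F j x) = (fun x => F i x + \sum_(j <- r) F j x).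
  by apply/funext => x; rewrite big_cons.
rewrite E big_cons (RintegralD measurableT (iF i) IH1) IH2; split => //.
exact: (integrableD measurableT (iF i) IH1).
Qed.

(** delta depends on k, S and e only, so one choice serves every member of a sequence of gradients
    with a common bound. *)
Lemma jac_small (k : nat) (S e : R) : 0 <= S -> 0 < e -> exists2 delta : R, 0 < delta &
  forall (N : Type) (a : N -> T -> R) (D : 'I_k -> N -> T -> R) (J : 'I_k.+1 -> N),
    (forall c, measurable_fun setT (a (J c))) ->
    (forall i c, measurable_fun setT (D i (J c))) ->
    (\sum_i \sum_c \int[mu]_x (`|D i (J c) x| ^+ k.+1)%:E <= S%:E)%E ->
    (forall c, \int[mu]_x (`|a (J c) x| ^+ k.+1)%:E <= delta%:E)%E ->
    (\int[mu]_x `|jac (cons_row a D) J x|%:E <= e%:E)%E.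
Proof.
move=> S0 e0; have eta0 : 0 < e / 2%:R / (S + 1) by rewrite !divr_gt0// ltr_wpDl.
have [C C0 HC] := det_young k eta0.
have C1 : 0 < C * k.+1%:R + 1 by rewrite ltr_wpDl// mulr_ge0.
exists (e / 2%:R / (C * k.+1%:R + 1)) => [|N a D J ma mD DS aS]; first by rewrite !divr_gt0.
have mak c : measurable_fun setT (fun x => (`|a (J c) x| ^+ k.+1)%:E) by exact: measurable_fun_normrX.
have mDk i c : measurable_fun setT (fun x => (`|D i (J c) x| ^+ k.+1)%:E) by exact: measurable_fun_normrX.
have p0 (f : T -> R) x : (0 <= (`|f x| ^+ k.+1)%:E)%E by rewrite lee_fin exprn_ge0.
have ms1 : measurable_fun setT (fun x => \sum_c (`|a (J c) x| ^+ k.+1)%:E)%E.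
  by apply: emeasurable_sum => c.
have ms2 : measurable_fun setT (fun x => \sum_i \sum_c (`|D i (J c) x| ^+ k.+1)%:E)%E.
  by apply: emeasurable_sum => i; apply: emeasurable_sum => c.
have s10 x : (0 <= \sum_c (`|a (J c) x| ^+ k.+1)%:E)%E by exact: sume_ge0.
have s20 x : (0 <= \sum_i \sum_c (`|D i (J c) x| ^+ k.+1)%:E)%E.
  by apply: sume_ge0 => i _; exact: sume_ge0.
apply: (@le_trans _ _ (\int[mu]_x (C%:E * (\sum_c (`|a (J c) x| ^+ k.+1)%:E) +
    (e / 2%:R / (S + 1))%:E * (\sum_i \sum_c (`|D i (J c) x| ^+ k.+1)%:E)))%E).
  apply: ge0_le_integral => //.
  - apply/measurable_EFinP; apply: measurableT_comp => //; apply: measurable_jac => i c.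
    by case: (unliftP ord0 i) => [j|] ->; rewrite ?cons_row0 ?cons_rowS.
  - by apply: emeasurable_funD; apply: emeasurable_funM.
  - move=> x _; rewrite sumEFin.
    rewrite (eq_bigr (fun i => (\sum_c `|D i (J c) x| ^+ k.+1)%:E)); last by move=> i _; rewrite sumEFin.
    rewrite sumEFin -!EFinM -EFinD lee_fin (le_trans (HC _))// le_eqVlt; apply/orP; left; apply/eqP.
    congr (_ * _ + _ * _); apply: eq_bigr => i _; first by rewrite mxE cons_row0.
    by apply: eq_bigr => c _; rewrite mxE cons_rowS.
rewrite ge0_integralD//; last 4 first.
- by move=> x _; rewrite mule_ge0.
- exact: emeasurable_funM.
- by move=> x _; rewrite mule_ge0// lee_fin ltW.
- exact: emeasurable_funM.
rewrite !ge0_integralZl//; last by rewrite lee_fin ltW.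
rewrite ge0_integral_sum//.
rewrite (@ge0_integral_sum _ T R mu setT measurableT _ (fun i x => \sum_c (`|D i (J c) x| ^+ k.+1)%:E)%E)//; last 2 first.
- by move=> i; apply: emeasurable_sum => c.
- by move=> i x _; exact: sume_ge0.
under [X in (_ + _ * X)%E]eq_bigr => i _ do rewrite ge0_integral_sum//.
apply: (@le_trans _ _ (C%:E * (\sum_(c < k.+1) (e / 2%:R / (C * k.+1%:R + 1))%:E) + (e / 2%:R / (S + 1))%:E * S%:E)%E).
  by apply: leeD; rewrite lee_wpmul2l ?lee_fin// ?(ltW eta0)//; apply: lee_sum => c _.
rewrite sumEFin sumr_const card_ord -!EFinM -EFinD lee_fin.
have h1 : C * (e / 2%:R / (C * k.+1%:R + 1) *+ k.+1) <= e / 2%:R.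
  rewrite -mulr_natr (_ : C * _ = e / 2%:R * (C * k.+1%:R) / (C * k.+1%:R + 1)); last by ring.
  by rewrite ler_pdivrMr// ler_wpM2l ?lerDl// divr_ge0// ltW.
have h2 : e / 2%:R / (S + 1) * S <= e / 2%:R.
  by rewrite mulrAC ler_pdivrMr ?ler_wpM2l ?divr_ge0 ?(ltW e0) ?lerDl// ltr_wpDl.
by rewrite [leRHS]splitr lerD.
Qed.

Lemma jac_integrable (N : Type) k (D : 'I_k.+1 -> N -> T -> R) (J : 'I_k.+1 -> N) :
  (forall i c, measurable_fun setT (D i (J c))) ->
  (forall i c, mu.-integrable setT (EFin \o (fun x => `|D i (J c) x| ^+ k.+1))) ->
  mu.-integrable setT (EFin \o jac D J).
Proof.
move=> mD iD; have [C C0 HC] := det_young k (@ltr01 R).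
have i1 := (@Rintegral_sum _ (index_enum _) (fun c x => `|D ord0 (J c) x| ^+ k.+1) (iD ord0)).1.
have i2 i := (@Rintegral_sum _ (index_enum _) (fun c x => `|D (lift ord0 i) (J c) x| ^+ k.+1)
  (iD (lift ord0 i))).1.
have i3 := (@Rintegral_sum _ (index_enum _) _ i2).1.
apply: (@le_integrable _ _ _ mu _ measurableT _ (EFin \o (fun x => C * (\sum_c `|D ord0 (J c) x| ^+ k.+1) +
    \sum_i \sum_c `|D (lift ord0 i) (J c) x| ^+ k.+1))).
- by apply/measurable_EFinP; exact: measurable_jac.
- move=> x _ /=; rewrite lee_fin [leRHS]ger0_norm; last first.
    rewrite addr_ge0 ?mulr_ge0//; first by apply: sumr_ge0 => c _; exact: exprn_ge0.
    by apply: sumr_ge0 => i _; apply: sumr_ge0 => c _; exact: exprn_ge0.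
  rewrite (le_trans (HC _))// le_eqVlt; apply/orP; left; apply/eqP; rewrite mul1r.
  congr (_ * _ + _); apply: eq_bigr => i _; first by rewrite mxE.
  by apply: eq_bigr => c _; rewrite mxE.
- exact: (integrableD measurableT (integrableZl measurableT C i1) i3).
Qed.

Lemma normr_Rintegral_le (f : T -> R) (e : R) : measurable_fun setT f ->
  (\int[mu]_x `|f x|%:E <= e%:E)%E ->
  mu.-integrable setT (EFin \o f) /\ `|Rintegral mu setT f| <= e.
Proof.
move=> mf fe; have if_ : mu.-integrable setT (EFin \o f).
  apply/integrableP; split; first exact/measurable_EFinP.
  by apply: le_lt_trans fe _; rewrite ltry.
split=> //; apply: (le_trans (le_normr_Rintegral measurableT if_)).
by rewrite -lee_fin fineK// integrable_fin_num//; exact: (integrable_norm if_).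
Qed.

End jacobian_integrals.

Section jacobian_linearity.
Context {R : realType} {T N : Type}.

Lemma jac_consD k (a b : N -> T -> R) (D : 'I_k -> N -> T -> R) (J : 'I_k.+1 -> N) x :
  jac (cons_row (fun j y => a j y + b j y) D) J x =
  jac (cons_row a D) J x + jac (cons_row b D) J x.
Proof. by rewrite !jac_cons -big_split; apply: eq_bigr => c _; rewrite mulrDl. Qed.

Lemma jac_consZ k (h : T -> R) (b : N -> T -> R) (D : 'I_k -> N -> T -> R) (J : 'I_k.+1 -> N) x :
  jac (cons_row (fun j y => h y * b j y) D) J x = h x * jac (cons_row b D) J x.
Proof. by rewrite !jac_cons mulr_sumr; apply: eq_bigr => c _; rewrite mulrA. Qed.

End jacobian_linearity.

Section null_lagrangian.
Context {R : realType} {n : nat}.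
Variable U : set 'rV[R]_n.
Hypotheses (oU : open U) (bU : bounded_set U).
Implicit Types (u h phi : 'rV[R]_n -> R) (j : 'I_n).
Local Notation mu := (@lebesgue_rV R n).
Local Notation T := (@lebesgue_space R n).
Local Notation grad phi := (fun j => partial j phi).

Definition W1k_on (k : nat) u (d : 'I_n -> 'rV[R]_n -> R) : Prop :=
  [/\ Lk_on U k u, forall j, Lk_on U k (d j) & weak_gradient U u d].

Lemma Lk_on_le k u : Lk_on U k.+2 u -> Lk_on U k.+1 u.
Proof.
move=> [mu_ u0 iu]; split=> //.
have iI := integrable_indic_lty (open_lebesgue_measurable oU) (lebesgue_rV_bounded bU).
apply: (@le_integrable _ T R mu _ measurableT _ (EFin \o ((fun x => \1_U x + `|u x| ^+ k.+2) : T -> R))).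
- by apply/measurable_EFinP; apply: measurable_funX; exact: measurableT_comp.
- move=> x _ /=; rewrite lee_fin [leRHS]ger0_norm ?addr_ge0 ?exprn_ge0// normrX normr_id indicE.
  have [xU|xU] := boolP (x \in U); last first.
    by rewrite u0 ?normr0 ?expr0n//= ?addr0// => Ux; rewrite mem_set in xU.
  have [u1|u1] := leP `|u x| 1.
    by rewrite (@le_trans _ _ 1)// ?exprn_ile1// lerDl exprn_ge0.
  by rewrite (@le_trans _ _ (`|u x| ^+ k.+2)) ?lerDr// ler_weXn2l// ltW.
- exact: (integrableD measurableT iI iu).
Qed.

Lemma W1k_on_le k u d : W1k_on k.+2 u d -> W1k_on k.+1 u d.
Proof.
by move=> [Lu Ld wd]; split => //; [exact: Lk_on_le|move=> j; exact: Lk_on_le].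
Qed.

(** For k = 0 the index i does not exist; otherwise the exponent is lowered by one, the measure of U
    being finite. *)
Lemma W1k_on_pred k (w : 'I_k -> 'rV[R]_n -> R) (d : 'I_k -> 'I_n -> 'rV[R]_n -> R) i :
  (forall i, W1k_on k.+1 (w i) (d i)) -> W1k_on k (w i) (d i).
Proof. by case: k w d i => [? ? []//|k w d i Wd]; exact: W1k_on_le. Qed.

Lemma test_function_Lk_on k phi : test_function U phi -> Lk_on U k.+1 phi.
Proof.
move=> tphi; have mphi := smooth_measurable (test_function_smooth tphi).
split=> //; first by move=> x; exact: test_function_out tphi.
have [M HM] := test_function_bounded tphi.
apply: (@integrable_bounded_on _ T R mu _ (M ^+ k.+1) U).
- by apply: measurable_funX; exact: measurableT_comp.
- exact: open_lebesgue_measurable.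
- exact: lebesgue_rV_bounded.
- move=> x; rewrite normrX normr_id lerXn2r ?nnegrE//.
  exact: le_trans (HM x).
- by move=> x /(test_function_out tphi) ->; rewrite normr0 expr0n.
Qed.

Lemma Lk_onM_bounded k u h (M : R) : measurable_fun setT (h : T -> R) ->
  (forall x, `|h x| <= M) -> Lk_on U k u -> Lk_on U k (fun x => h x * u x).
Proof.
move=> mh hM [mu_ u0 iu]; split.
- exact: (measurable_funM mh mu_).
- by move=> x /u0 ->; rewrite mulr0.
- have -> : (fun x : T => `|h x * u x| ^+ k) = (fun x : T => `|u x| ^+ k * `|h x| ^+ k).
    by apply/funext => x; rewrite normrM exprMn mulrC.
  apply: (@integrable_mulr_bounded _ T R mu _ _ _ (M ^+ k) measurableT iu).
    by apply: measurable_funX; exact: measurableT_comp.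
  move=> x _; rewrite normrX normr_id lerXn2r ?nnegrE//.
  exact: le_trans (hM x).
Qed.

Lemma jac_Lk_on_integrable k (d : 'I_k.+1 -> 'I_n -> 'rV[R]_n -> R) (J : 'I_k.+1 -> 'I_n) :
  (forall i j, Lk_on U k.+1 (d i j)) -> mu.-integrable setT (EFin \o (jac d J : T -> R)).
Proof.
by move=> Ld; apply: (@jac_integrable _ T R mu) => i c; case: (Ld i (J c)).
Qed.

Lemma cons_row_Lk_on k m (a : 'I_n -> 'rV[R]_n -> R) (d : 'I_k -> 'I_n -> 'rV[R]_n -> R) :
  (forall j, Lk_on U m (a j)) -> (forall i j, Lk_on U m (d i j)) ->
  forall i j, Lk_on U m (cons_row a d i j).
Proof.
by move=> La Ld i j; case: (unliftP ord0 i) => [i'|] ->; rewrite ?cons_row0 ?cons_rowS.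
Qed.

Lemma sum_Lk_on_bound k m (d : 'I_k -> 'I_n -> 'rV[R]_n -> R) (J : 'I_m -> 'I_n) p :
  (forall i j, Lk_on U p (d i j)) -> exists2 S : R, 0 <= S &
  (\sum_i \sum_c \int[mu]_x (`|d i (J c) x| ^+ p)%:E <= S%:E)%E.
Proof.
move=> Ld.
have fin i c : (\int[mu]_x (`|d i (J c) x| ^+ p)%:E \is a fin_num)%E.
  by apply: integrable_fin_num => //; case: (Ld i (J c)).
exists (\sum_i \sum_c fine (\int[mu]_x (`|d i (J c) x| ^+ p)%:E)).
  apply: sumr_ge0 => i _; apply: sumr_ge0 => c _; apply: fine_ge0.
  by apply: integral_ge0 => x _; rewrite lee_fin exprn_ge0.
rewrite -sumEFin; apply: lee_sum => i _; rewrite -sumEFin; apply: lee_sum => c _.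
by rewrite fineK.
Qed.

(** The form dphi /\ dw_0 /\ ... /\ dw_(k-1) is the differential of phi dw_0 /\ ... /\ dw_(k-1),
    which has compact support. Its first row is bounded, so gradients in L^k make it integrable. *)
Definition null_lagrangian (k : nat) : Prop :=
  forall (w : 'I_k -> 'rV[R]_n -> R) (d : 'I_k -> 'I_n -> 'rV[R]_n -> R) (J : 'I_k.+1 -> 'I_n) phi,
  (forall i, W1k_on k (w i) (d i)) -> test_function U phi ->
  Rintegral mu setT (jac (cons_row (grad phi) d) J : T -> R) = 0.

(** Integration by parts in the first row: w_0 is left undifferentiated and the derivative moves to
    phi. *)
Definition weak_jacobian (k : nat) : Prop :=
  forall (w : 'I_k.+1 -> 'rV[R]_n -> R) (d : 'I_k.+1 -> 'I_n -> 'rV[R]_n -> R)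
    (J : 'I_k.+1 -> 'I_n) phi,
  (forall i, W1k_on k.+1 (w i) (d i)) -> test_function U phi ->
  Rintegral mu setT ((fun x => phi x * jac d J x) : T -> R) =
  - Rintegral mu setT ((fun x => w ord0 x *
      jac (cons_row (grad phi) (fun i => d (lift ord0 i))) J x) : T -> R).

(** If w_0 is a smooth h, the two sides differ by the integral of d(phi h) /\ dw_1 /\ ..., which
    vanishes. In general w_0 is approximated by such an h; the errors sit in the first row and are
    small in L^(k+1), while the other rows stay fixed. *)
Lemma weak_jacobian_of_null_lagrangian k : null_lagrangian k -> weak_jacobian k.
Proof.
move=> NL w d J phi Wd tphi.
have [Lw0 Ld0 wd0] := Wd ord0.
pose d' i := d (lift ord0 i); pose w' i := w (lift ord0 i).
have Ld' i j : Lk_on U k.+1 (d' i j) by have [_ + _] := Wd (lift ord0 i); exact.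
have Wd' i : W1k_on k (w' i) (d' i) by apply: W1k_on_pred => i'; exact: Wd.
have [M HM] := test_function_bounded tphi.
have mphi := smooth_measurable (test_function_smooth tphi).
have /choice[M' HM'] : forall j, exists M : R, forall x, `|partial j phi x| <= M.
  by move=> j; exact: (test_function_bounded (test_function_partial j tphi)).
have mdphi j := smooth_measurable (test_function_smooth (test_function_partial j tphi)).
pose a1 j x := phi x * d ord0 j x.
pose a2 j x := w ord0 x * partial j phi x.
have La1 j : Lk_on U k.+1 (a1 j) by exact: Lk_onM_bounded mphi HM (Ld0 j).
have La2 j : Lk_on U k.+1 (a2 j).
  have := Lk_onM_bounded (mdphi j) (HM' j) Lw0; congr (Lk_on _ _).
  by apply/funext => x; rewrite mulrC.
have int_jac b : (forall j, Lk_on U k.+1 (b j)) ->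
    mu.-integrable setT (EFin \o (jac (cons_row b d') J : T -> R)).
  by move=> Lb; apply: jac_Lk_on_integrable; exact: cons_row_Lk_on.
have i1 := int_jac _ La1; have i2 := int_jac _ La2.
have E1 : (fun x => phi x * jac d J x) = jac (cons_row a1 d') J.
  by apply/funext => x; rewrite jac_consZ -cons_row_eta.
have E2 : (fun x => w ord0 x * jac (cons_row (grad phi) d') J x) = jac (cons_row a2 d') J.
  by apply/funext => x; rewrite jac_consZ.
rewrite E1 E2; apply/eqP; rewrite -addr_eq0 -normr_le0; apply/ler_addgt0Pr => e e0.
rewrite add0r -(RintegralD measurableT i1 i2).
have [S S0 dS] := sum_Lk_on_bound J Ld'.
have e2 : 0 < e / 2%:R by rewrite divr_gt0.
have [delta delta0 Hdelta] := @jac_small _ T R mu k S (e / 2%:R) S0 e2.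
have [M2 M20 HM2] : exists2 M2 : R, 0 <= M2 & forall j x, `|partial j phi x| <= M2.
  exists (\sum_j `|M' j|) => [|j x]; first exact: sumr_ge0.
  by rewrite (le_trans (HM' j x))// (bigD1 j)//= (le_trans (ler_norm _))// lerDl sumr_ge0.
have Mk : 0 < M2 ^+ k.+1 + 1 by rewrite ltr_wpDl// exprn_ge0.
(* The second argument of the minimum absorbs the bound M2 on the derivatives of phi. *)
have eta0 : 0 < Num.min delta (delta / (M2 ^+ k.+1 + 1)) by rewrite lt_min delta0 divr_gt0.
have [h [sh uh dh]] := smooth_approximation oU bU Lw0 Ld0 wd0 tphi eta0.
have tph := test_functionM tphi sh.
pose b1 j x := phi x * (d ord0 j x - partial j h x).
pose b2 j x := (w ord0 x - h x) * partial j phi x.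
have mb1 j : measurable_fun setT (b1 j : T -> R).
  apply: (measurable_funM mphi); apply: measurable_funB; first by case: (Ld0 j).
  by apply: smooth_measurable; exact: smooth_partial.
have mwh : measurable_fun setT ((fun x => w ord0 x - h x) : T -> R).
  by apply: measurable_funB; [case: Lw0|exact: smooth_measurable].
have mb2 j : measurable_fun setT (b2 j : T -> R) by exact: (measurable_funM mwh (mdphi j)).
have md' i c : measurable_fun setT (d' i (J c) : T -> R) by case: (Ld' i (J c)).
have s1 : (\int[mu]_x `|jac (cons_row b1 d') J x|%:E <= (e / 2%:R)%:E)%E.
  apply: (Hdelta _ b1 d' J (fun c => mb1 (J c)) md' dS) => c.
  by rewrite (le_trans (ltW (dh (J c))))// lee_fin ge_min lexx.
have s2 : (\int[mu]_x `|jac (cons_row b2 d') J x|%:E <= (e / 2%:R)%:E)%E.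
  apply: (Hdelta _ b2 d' J (fun c => mb2 (J c)) md' dS) => c.
  apply: (@le_trans _ _ ((M2 ^+ k.+1)%:E * \int[mu]_x (`|w ord0 x - h x| ^+ k.+1)%:E)%E).
    apply: (@Lk_scale _ T R mu k.+1 M2 _ _ M20 (mb2 (J c)) mwh) => x.
    by rewrite /b2 normrM mulrC ler_wpM2r.
  apply: (@le_trans _ _ ((M2 ^+ k.+1)%:E * (delta / (M2 ^+ k.+1 + 1))%:E)%E).
    rewrite lee_wpmul2l ?lee_fin ?exprn_ge0// (le_trans (ltW uh))// lee_fin.
    by rewrite ge_min lexx orbT.
  rewrite -EFinM lee_fin mulrCA ler_piMr ?(ltW delta0)// ler_pdivrMr// mul1r.
  by rewrite lerDl.
have mj b : (forall j, measurable_fun setT (b j : T -> R)) ->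
    measurable_fun setT (jac (cons_row b d') J : T -> R).
  move=> mb; apply: (@measurable_jac _ T R) => i c.
  by case: (unliftP ord0 i) => [i'|] ->; rewrite ?cons_row0 ?cons_rowS.
have [j1 r1] := normr_Rintegral_le (mj _ mb1) s1.
have [j2 r2] := normr_Rintegral_le (mj _ mb2) s2.
have Lp j : Lk_on U k.+1 (partial j (fun x => phi x * h x)).
  by apply: test_function_Lk_on; exact: test_function_partial.
have j3 := int_jac _ Lp.
have N0 := NL w' d' J _ Wd' tph.
(* On first rows: phi d_0 + w_0 grad phi = phi (d_0 - grad h) + (w_0 - h) grad phi + grad (phi
   h). *)
have E : (fun x => jac (cons_row a1 d') J x + jac (cons_row a2 d') J x) =
    (fun x => jac (cons_row b1 d') J x + jac (cons_row b2 d') J x +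
              jac (cons_row (grad (fun x => phi x * h x)) d') J x).
  apply/funext => x; rewrite -!jac_consD; congr (jac (cons_row _ _) _ _).
  apply/funext => j; apply/funext => y.
  rewrite (partialM j y (test_function_smooth tphi) sh) /a1 /a2 /b1 /b2; ring.
have j12 := integrableD measurableT j1 j2.
rewrite E (RintegralD measurableT j12 j3) (RintegralD measurableT j1 j2) N0 addr0.
by rewrite (le_trans (ler_normD _ _))// [leRHS]splitr lerD.
Qed.

Lemma null_lagrangian0 : null_lagrangian 0.
Proof.
move=> w d J phi _ tphi; rewrite -(Rintegral_partial0 (J ord0) tphi).
apply: eq_Rintegral => x _; apply: etrans; first exact: jac_cons.
rewrite big_ord_recl big_ord0 addr0.
rewrite expr0 mul1r /jac (_ : \matrix_(_, _) _ = 1%:M) ?det1 ?mulr1//.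
by apply/matrixP => -[].
Qed.

(** Expanding along grad phi gives minors of order k + 1 tested against derivatives of phi.
    Integrating them by parts leaves w_0 times an alternating sum whose first rows come from the
    Hessian of phi, and this sum vanishes by symmetry. *)
Lemma null_lagrangianS k : weak_jacobian k -> null_lagrangian k.+1.
Proof.
move=> WJ w d J phi Wd tphi.
have Lw0 : Lk_on U k.+1 (w ord0) by case: (Wd ord0).
have Ld i j : Lk_on U k.+1 (d i j) by case: (Wd i).
pose d' i := d (lift ord0 i).
have Ld' i j : Lk_on U k.+1 (d' i j) by exact: Ld.
pose J' (c : 'I_k.+2) e := J (lift c e).
have tp c := test_function_partial (J c) tphi.
pose F (c : 'I_k.+2) x := (-1) ^+ c * (partial (J c) phi x * jac d (J' c) x).
have iphij (c : 'I_k.+2) : mu.-integrable setT (EFin \o ((fun x => partial (J c) phi x * jac d (J' c) x) : T -> R)).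
  have [M HM] := test_function_bounded (tp c).
  have ij := @jac_Lk_on_integrable k d (J' c) Ld.
  have := integrable_mulr_bounded measurableT ij (smooth_measurable (test_function_smooth (tp c))) (fun x _ => HM x).
  by congr (integrable _ _ _); apply/funext => x; rewrite /= mulrC.
have iF (c : 'I_k.+2) : mu.-integrable setT (EFin \o (F c : T -> R)).
  exact: (integrableZl measurableT ((-1) ^+ c) (iphij c)).
have EJ : jac (cons_row (grad phi) d) J = fun x => \sum_c F c x.
  by apply/funext => x; rewrite jac_cons; apply: eq_bigr => c _; rewrite /F mulrCA.
rewrite EJ (@Rintegral_sum _ T R mu _ (index_enum _) F iF).2.
pose G (c : 'I_k.+2) x := w ord0 x * ((-1) ^+ c * jac (cons_row (grad (partial (J c) phi)) d') (J' c) x).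
have La c j : Lk_on U k.+1 (fun x => w ord0 x * partial j (partial (J c) phi) x).
  have [M HM] := test_function_bounded (test_function_partial j (tp c)).
  have := Lk_onM_bounded (smooth_measurable (test_function_smooth (test_function_partial j (tp c)))) HM Lw0.
  by congr (Lk_on _ _); apply/funext => x; rewrite mulrC.
have iwj (c : 'I_k.+2) : mu.-integrable setT (EFin \o ((fun x => w ord0 x *
    jac (cons_row (grad (partial (J c) phi)) d') (J' c) x) : T -> R)).
  have := @jac_Lk_on_integrable k _ (J' c) (cons_row_Lk_on (La c) Ld').
  by congr (integrable _ _ _); apply/funext => x; rewrite /= jac_consZ.
have EG (c : 'I_k.+2) : (G c : T -> R) = (fun x => (-1) ^+ c * (w ord0 x *
    jac (cons_row (grad (partial (J c) phi)) d') (J' c) x)).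
  by apply/funext => x; rewrite /G mulrCA.
have iG (c : 'I_k.+2) : mu.-integrable setT (EFin \o (G c : T -> R)).
  by rewrite EG; exact: (integrableZl measurableT ((-1) ^+ c) (iwj c)).
have FG c : Rintegral mu setT (F c : T -> R) = - Rintegral mu setT (G c : T -> R).
  rewrite EG /F (RintegralZl _ measurableT (iphij c)) (RintegralZl _ measurableT (iwj c)).
  by rewrite (WJ w d (J' c) _ Wd (tp c)) mulrN.
under eq_bigr do rewrite FG.
rewrite sumrN -(@Rintegral_sum _ T R mu _ (index_enum _) G iG).2.
rewrite (_ : (fun x : T => \sum_c G c x) = cst 0); first by rewrite /Rintegral integral0 oppr0.
apply/funext => x; rewrite /G -mulr_sumr.
have sphi := test_function_smooth tphi.
have Hsym a b : partial b (partial a phi) x = partial a (partial b phi) x.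
  apply: partialC_continuous => //.
  - by move=> y; exact: smooth_derivable.
  - by move=> y; exact: smooth_derivable.
  - by move=> y; apply: smooth_derivable; exact: smooth_partial.
  - by move=> y; apply: smooth_derivable; exact: smooth_partial.
  - by apply: smooth_continuous; do 2 apply: smooth_partial.
  - by apply: smooth_continuous; do 2 apply: smooth_partial.
have := @symmetric_alternating_sum R 'I_n k (fun a b => partial b (partial a phi) x)
  (fun i j => d' i j x) J Hsym.
move=> H0; rewrite (_ : \sum_c _ = 0) ?mulr0// -[RHS]H0.
apply: eq_bigr => c _; congr (_ * \det _); apply/matrixP => i e; rewrite !mxE.
by case: (unliftP ord0 i) => [i'|] ->; rewrite ?cons_row0 ?cons_rowS.
Qed.

Theorem null_lagrangianP k : null_lagrangian k.
Proof.
elim: k => [|k IHk]; first exact: null_lagrangian0.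
exact/null_lagrangianS/weak_jacobian_of_null_lagrangian.
Qed.

Theorem weak_jacobianP k : weak_jacobian k.
Proof. exact/weak_jacobian_of_null_lagrangian/null_lagrangianP. Qed.

End null_lagrangian.

(** * Weak compactness in L^q *)

Section powR_inequalities.
Context {R : realType}.
Implicit Types a c q eta : R.

(** Pointwise interpolation between the exponents 1 and q. With s = q - k - 1, the threshold N =
    eta^(-1/s) is where a^s reaches 1/eta; below it the power is at most N^k a. *)
Lemma exprn_le_linear_powR (k : nat) q eta : k.+1%:R < q -> 0 < eta ->
  exists2 K, 0 <= K & forall a, 0 <= a -> a ^+ k.+1 <= K * a + eta * a `^ q.
Proof.
move=> kq eta0; pose s := q - k.+1%:R; have s0 : 0 < s by rewrite subr_gt0.
pose N := eta^-1 `^ s^-1; have N0 : 0 < N by rewrite powR_gt0// invr_gt0.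
have q0 : 0 < q by apply: le_lt_trans kq.
exists (N ^+ k) => [|a a0]; first by rewrite exprn_ge0// ltW.
have [aN|Na] := leP a N.
  rewrite exprS mulrC ler_wpDr ?mulr_ge0 ?powR_ge0 ?(ltW eta0)//.
  by rewrite ler_wpM2r// lerXn2r// nnegrE// ltW.
have a1 : 0 < a by exact: lt_trans Na.
rewrite ler_wpDl ?mulr_ge0 ?exprn_ge0 ?(ltW N0)//.
have -> : q = k.+1%:R + s by rewrite /s addrC subrK.
rewrite (_ : a `^ _ = a ^+ k.+1 * a `^ s); last by rewrite powRD ?powR_mulrn// (gt_eqF a1) implybT.
rewrite mulrCA ler_peMr ?exprn_ge0//.
rewrite -ler_pdivrMl// mulr1 (_ : eta^-1 = N `^ s).
  by rewrite ge0_ler_powR ?nnegrE// ltW.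
by rewrite -powRrM mulVf ?gt_eqF// powRr1// invr_ge0 ltW.
Qed.

Lemma linear_le_powR q eta : 1 < q -> 0 < eta ->
  exists2 K, 0 <= K & forall a, 0 <= a -> a <= K + eta * a `^ q.
Proof.
move=> q1 eta0; pose s := q - 1; have s0 : 0 < s by rewrite subr_gt0.
pose N := eta^-1 `^ s^-1; have N0 : 0 < N by rewrite powR_gt0// invr_gt0.
have q0 : 0 < q by apply: lt_trans q1.
exists N => [|a a0]; first exact: ltW.
have [aN|Na] := leP a N; first by rewrite ler_wpDr// mulr_ge0 ?powR_ge0 ?(ltW eta0).
rewrite ler_wpDl ?(ltW N0)// -(mulr_powRB1 a0 q0) mulrCA ler_peMr//.
rewrite -ler_pdivrMl// mulr1 (_ : eta^-1 = N `^ s).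
  by rewrite ge0_ler_powR ?nnegrE// ltW.
by rewrite -powRrM mulVf ?gt_eqF// powRr1// invr_ge0 ltW.
Qed.

(** A form of Young's inequality with coefficient 1/2 on c^q, to be absorbed on the left when c is
    the truncated limit itself. The cases are c <= 2 a and c > 2 a. *)
Lemma mulr_powR_le q a c : 1 < q -> 0 <= a -> 0 <= c ->
  a * c `^ (q - 1) <= 2%:R `^ q * a `^ q + 2%:R^-1 * c `^ q.
Proof.
move=> q1 a0 c0; have q0 : 0 < q by apply: lt_trans q1.
have [ca|ac] := leP c (2%:R * a).
  rewrite ler_wpDr ?mulr_ge0 ?powR_ge0// -powRM// -(mulr_powRB1 _ q0) ?mulr_ge0//.
  apply: ler_pM; rewrite ?powR_ge0//; first lra.
  by rewrite ge0_ler_powR ?nnegrE ?subr_ge0 ?mulr_ge0// ltW.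
rewrite ler_wpDl ?mulr_ge0 ?powR_ge0// -(mulr_powRB1 c0 q0) mulrA.
rewrite ler_wpM2r ?powR_ge0//; lra.
Qed.

Lemma powR_distance_le q a c : 1 < q -> 0 <= a -> 0 <= c ->
  (a + c) `^ q <= 2%:R `^ q * (a `^ q + c `^ q).
Proof.
move=> q1 a0 c0; have q0 : 0 <= q by rewrite (le_trans ler01)// ltW.
wlog ac : a c a0 c0 / a <= c.
  by move=> H; case: (leP a c) => [|/ltW]/H; last rewrite addrC [X in _ * X]addrC; exact.
apply: (@le_trans _ _ ((2%:R * c) `^ q)).
  by rewrite ge0_ler_powR ?nnegrE ?addr_ge0 ?mulr_ge0//; lra.
by rewrite powRM// ler_wpM2l ?powR_ge0// ler_wpDl// powR_ge0.
Qed.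

End powR_inequalities.

(** * Uniform integrability and convergence of pairings *)

Section uniform_integrability.
Context d (T : measurableType d) (R : realType) (mu : {measure set T -> \bar R}).
Implicit Types (g h chi : T -> R) (q e : R).

Definition Lq_le q (C : R) g : Prop :=
  measurable_fun setT g /\ (\int[mu]_x (`|g x| `^ q)%:E <= C%:E)%E.

(** Uniform integrability in dual form. The bound 2 on h suits differences of two functions bounded
    by 1. *)
Definition unif_int (I : Type) (g : I -> T -> R) : Prop :=
  forall e, 0 < e -> exists2 K, 0 <= K & forall i h (H : R), measurable_fun setT h ->
    (forall x, `|h x| <= 2) -> (\int[mu]_x `|h x|%:E <= H%:E)%E ->
    `|Rintegral mu setT (fun x => g i x * h x)| <= K * H + e.

Lemma measurable_powR_norm q g : measurable_fun setT g ->
  measurable_fun setT (fun x => (`|g x| `^ q)%:E).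
Proof.
move=> mg; apply/measurable_EFinP.
by apply: (measurableT_comp (measurable_powR _)); exact: measurableT_comp.
Qed.

Lemma normr_Rintegral_le_combination (f a b : T -> R) (A B : R) (K L : R) :
  measurable_fun setT f -> measurable_fun setT a -> measurable_fun setT b ->
  0 <= K -> 0 <= L -> (forall x, 0 <= a x) -> (forall x, 0 <= b x) ->
  (forall x, `|f x| <= K * a x + L * b x) ->
  (\int[mu]_x (a x)%:E <= A%:E)%E -> (\int[mu]_x (b x)%:E <= B%:E)%E ->
  (\int[mu]_x `|f x|%:E <= (K * A + L * B)%:E)%E.
Proof.
move=> mf ma mb K0 L0 a0 b0 fab aA bB.
apply: (@le_trans _ _ (\int[mu]_x (K%:E * (a x)%:E + L%:E * (b x)%:E))%E).
  apply: ge0_le_integral => //.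
  - by apply/measurable_EFinP; exact: measurableT_comp.
  - by apply: emeasurable_funD; apply: emeasurable_funM => //; exact/measurable_EFinP.
  - by move=> x _; rewrite -!EFinM -EFinD lee_fin.
rewrite ge0_integralD//; last 4 first.
- by move=> x _; rewrite mule_ge0// lee_fin.
- by apply: emeasurable_funM => //; exact/measurable_EFinP.
- by move=> x _; rewrite mule_ge0// lee_fin.
- by apply: emeasurable_funM => //; exact/measurable_EFinP.
rewrite !ge0_integralZl//; last 4 first.
- exact/measurable_EFinP.
- by move=> x _; rewrite lee_fin.
- exact/measurable_EFinP.
- by move=> x _; rewrite lee_fin.
by rewrite EFinD !EFinM; apply: leeD; rewrite lee_wpmul2l ?lee_fin.
Qed.

Lemma unif_int_Lq (I : Type) (g : I -> T -> R) q C : 1 < q -> 0 <= C ->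
  (forall i, Lq_le q C (g i)) -> unif_int g.
Proof.
move=> q1 C0 gC e e0; have C1 : 0 < 2%:R * C + 1 by rewrite ltr_wpDl// mulr_ge0.
have eta0 : 0 < e / (2%:R * C + 1) by rewrite divr_gt0.
have [K K0 HK] := linear_le_powR q1 eta0; exists K => // i h H mh h2 hH.
have [mg gq] := gC i.
have mgh := measurable_funM mg mh.
have mh1 : measurable_fun setT (fun x => `|h x|) by exact: measurableT_comp.
have mgq : measurable_fun setT (fun x => `|g i x| `^ q).
  by apply/measurable_EFinP; exact: measurable_powR_norm.
have L0 : 0 <= 2%:R * (e / (2%:R * C + 1)) by rewrite mulr_ge0// ltW.
have fab x : `|g i x * h x| <= K * `|h x| + 2%:R * (e / (2%:R * C + 1)) * `|g i x| `^ q.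
  rewrite normrM (le_trans (ler_wpM2r (normr_ge0 _) (HK _ (normr_ge0 (g i x)))))//.
  rewrite mulrDl lerD2l -[leRHS]mulrA [leRHS]mulrC.
  by rewrite ler_wpM2l// mulr_ge0 ?powR_ge0// ltW.
have := normr_Rintegral_le_combination mgh mh1 mgq K0 L0 (fun x => normr_ge0 _)
  (fun x => powR_ge0 _ _) fab hH gq.
move=> /(normr_Rintegral_le mgh)[_ /le_trans]; apply.
rewrite lerD2l mulrAC mulrA ler_pdivrMr//.
by rewrite [leLHS]mulrC ler_wpM2l ?lerDl// ltW.
Qed.

(** The index type [unit] lets a single limit function be treated by the same lemmas as a
    sequence. *)
Lemma unif_int_integrable g : mu.-integrable setT (EFin \o g) -> unif_int (fun _ : unit => g).
Proof.
move=> ig e e0.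
have ig1 : mu.-integrable setT (EFin \o (fun x => `|g x| ^+ 1)).
  by have := integrable_norm ig; congr (integrable _ _ _); apply/funext => x; rewrite /= expr1.
have mg : measurable_fun setT g by have /integrableP[/measurable_EFinP] := ig.
have e2 : 0 < e / 2%:R by rewrite divr_gt0.
have [N N0 HN] := Lk_truncate mg ig1 e2; exists N => // _ h H mh h2 hH.
have mgh := measurable_funM mg mh.
have mt := measurable_truncate N mg.
have ma : measurable_fun setT (fun x => `|h x|) by exact: measurableT_comp.
have mb : measurable_fun setT (fun x => `|g x - truncate N g x|).
  by apply: measurableT_comp => //; exact: measurable_funB.
have fab x : `|g x * h x| <= N * `|h x| + 2%:R * `|g x - truncate N g x|.
  rewrite -{1}(subrK (truncate N g x) (g x)) mulrDl addrC.
  rewrite (le_trans (ler_normD _ _))// !normrM lerD//.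
    by rewrite ler_wpM2r// truncate_le.
  by rewrite [leRHS]mulrC ler_wpM2l.
have HN' : (\int[mu]_x (`|g x - truncate N g x|)%:E <= (e / 2%:R)%:E)%E.
  by apply: le_trans (ltW HN); under [leRHS]eq_integral do rewrite expr1.
have := normr_Rintegral_le_combination mgh ma mb N0 (ler0n R 2) (fun x => normr_ge0 _)
  (fun x => normr_ge0 _) fab hH HN'.
move=> /(normr_Rintegral_le mgh)[_ /le_trans]; apply.
by rewrite mulrCA divff ?mulr1// pnatr_eq0.
Qed.

End uniform_integrability.

Section approximation_of_limits.
Context {R : realType}.
Implicit Types (u v : R^nat) (l : R).

Lemma cvgr_approx u l :
  (forall e : R, 0 < e -> exists v l', [/\ v @ \oo --> l',
    \forall m \near \oo, `|u m - v m| <= e & `|l - l'| <= e]) ->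
  u @ \oo --> l.
Proof.
move=> H; apply/cvgrPdist_le => e e0.
have e3 : 0 < e / 3%:R by rewrite divr_gt0.
have [v [l' [/cvgrPdist_le/(_ _ e3) vl uv ll']]] := H _ e3.
near=> m.
have h1 : `|u m - v m| <= e / 3%:R by near: m.
have h2 : `|l' - v m| <= e / 3%:R by near: m.
move: h1 h2 ll'; rewrite !ler_norml => /andP[? ?] /andP[? ?] /andP[? ?].
by apply/andP; split; lra.
Unshelve. all: by end_near. Qed.

Lemma is_cvg_approx u :
  (forall e : R, 0 < e -> exists2 v : R^nat, cvgn v & forall m, `|u m - v m| <= e) ->
  cvgn u.
Proof.
move=> H; apply/cauchy_cvgP/cauchy_exP => e e0.
have e3 : 0 < e / 4%:R by rewrite divr_gt0.
have [v cv uv] := H _ e3; exists (lim (v @ \oo)); rewrite /nbhs/=.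
have /cvgrPdist_le/(_ _ e3) vl : v @ \oo --> lim (v @ \oo) by exact: cv.
near=> m; rewrite -ball_normE /=.
have h1 := uv m.
have h2 : `|lim (v @ \oo) - v m| <= e / 4%:R by near: m.
move: h1 h2; rewrite !ler_norml => /andP[? ?] /andP[? ?].
by rewrite ltr_norml; apply/andP; split; lra.
Unshelve. all: by end_near. Qed.

End approximation_of_limits.

Lemma cvg_sumr {R : realType} (I : Type) (r : seq I) (u : I -> R^nat) (l : I -> R) :
  (forall i, u i m @[m --> \oo] --> l i) ->
  (\sum_(i <- r) u i m) @[m --> \oo] --> \sum_(i <- r) l i.
Proof. by move=> H; apply: cvg_big => [|i _]; [exact: add_continuous|exact: H]. Qed.

Section pairings.
Context d (T : measurableType d) (R : realType) (mu : {measure set T -> \bar R}).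
Implicit Types (g : nat -> T -> R) (h chi phi : T -> R) (q e : R).

Lemma RintegralMB (g0 : T -> R) chi phi : mu.-integrable setT (EFin \o g0) ->
  measurable_fun setT chi -> measurable_fun setT phi ->
  (forall x, `|chi x| <= 1) -> (forall x, `|phi x| <= 1) ->
  Rintegral mu setT (fun x => g0 x * chi x) - Rintegral mu setT (fun x => g0 x * phi x) =
  Rintegral mu setT (fun x => g0 x * (chi x - phi x)).
Proof.
move=> ig mc mp c1 p1.
rewrite -(RintegralB measurableT (integrable_mulr_bounded measurableT ig mc (fun x _ => c1 x))
  (integrable_mulr_bounded measurableT ig mp (fun x _ => p1 x))).
by apply: eq_Rintegral => x _; rewrite mulrBr.
Qed.

(** Uniform integrability makes the pairings equicontinuous in chi for the L^1 distance among
    functions bounded by 1, so convergence passes from an L^1-dense class of chi to all of them. *)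
Lemma unif_int_pairing_close (I : Type) (g : I -> T -> R) (e : R) :
  (forall i, mu.-integrable setT (EFin \o g i)) -> unif_int mu g -> 0 < e ->
  exists2 eta : R, 0 < eta & forall i chi phi, measurable_fun setT chi -> measurable_fun setT phi ->
  (forall x, `|chi x| <= 1) -> (forall x, `|phi x| <= 1) ->
  (\int[mu]_x `|chi x - phi x|%:E <= eta%:E)%E ->
  `|Rintegral mu setT (fun x => g i x * chi x) - Rintegral mu setT (fun x => g i x * phi x)| <= e.
Proof.
move=> ig ug e0; have e2 : 0 < e / 2%:R by rewrite divr_gt0.
have [K K0 HK] := ug _ e2; have K1 : 0 < K + 1 by rewrite ltr_wpDl.
exists (e / 2%:R / (K + 1)) => [|i chi phi mc mp c1 p1 H]; first by rewrite divr_gt0.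
rewrite RintegralMB//; apply: (le_trans (HK i _ _ (measurable_funB mc mp) _ H)).
  move=> x; rewrite (le_trans (ler_normB _ _))//.
  by rewrite (_ : 2 = 1 + 1) ?lerD// -natr1.
rewrite [leRHS]splitr lerD2r mulrCA ler_piMr ?(ltW e2)//.
by rewrite ler_pdivrMr ?mul1r ?lerDl.
Qed.

Lemma pairing_is_cvg g chi :
  (forall m, mu.-integrable setT (EFin \o g m)) -> unif_int mu g ->
  measurable_fun setT chi -> (forall x, `|chi x| <= 1) ->
  (forall e : R, 0 < e -> exists phi, [/\ measurable_fun setT phi, forall x, `|phi x| <= 1,
     (\int[mu]_x `|chi x - phi x|%:E <= e%:E)%E &
     cvgn (fun m => Rintegral mu setT (fun x => g m x * phi x))]) ->
  cvgn (fun m => Rintegral mu setT (fun x => g m x * chi x)).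
Proof.
move=> ig ug mc c1 H; apply: is_cvg_approx => e e0.
have [eta eta0 He] := unif_int_pairing_close ig ug e0.
have [phi [mp p1 cp cv]] := H _ eta0.
by exists (fun m => Rintegral mu setT (fun x => g m x * phi x)) => // m; exact: He.
Qed.

Lemma pairing_cvg g (g0 : T -> R) chi :
  (forall m, mu.-integrable setT (EFin \o g m)) -> unif_int mu g ->
  mu.-integrable setT (EFin \o g0) ->
  measurable_fun setT chi -> (forall x, `|chi x| <= 1) ->
  (forall e : R, 0 < e -> exists phi, [/\ measurable_fun setT phi, forall x, `|phi x| <= 1,
     (\int[mu]_x `|chi x - phi x|%:E <= e%:E)%E &
     Rintegral mu setT (fun x => g m x * phi x) @[m --> \oo] -->
     Rintegral mu setT (fun x => g0 x * phi x)]) ->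
  Rintegral mu setT (fun x => g m x * chi x) @[m --> \oo] -->
  Rintegral mu setT (fun x => g0 x * chi x).
Proof.
move=> ig ug ig0 mc c1 H; apply: cvgr_approx => e e0.
have [eta1 eta10 He1] := unif_int_pairing_close ig ug e0.
have [eta2 eta20 He2] := unif_int_pairing_close (fun _ : unit => ig0) (unif_int_integrable ig0) e0.
have eta0 : 0 < Num.min eta1 eta2 by rewrite lt_min eta10.
have [phi [mp p1 cp cv]] := H _ eta0.
exists (fun m => Rintegral mu setT (fun x => g m x * phi x)),
  (Rintegral mu setT (fun x => g0 x * phi x)); split => //.
- near=> m; apply: He1 => //; apply: le_trans cp _.
  by rewrite lee_fin ge_min lexx.
- apply: (He2 tt) => //; apply: le_trans cp _.
  by rewrite lee_fin ge_min lexx orbT.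
Unshelve. all: by end_near. Qed.

(** The sum counts the integers from 1 to M that do not exceed t, which is the integer part of t. *)
Lemma grid_approximation (M : nat) (t : R) : 0 <= t -> t <= M%:R ->
  `|t - \sum_(j < M) ((j.+1%:R <= t)%R)%:R| <= 1.
Proof.
elim: M => [|M IH] t0 tM.
  by rewrite big_ord0 subr0 ger0_norm// (le_trans tM).
rewrite big_ord_recr/=; have [h|h] := leP t M%:R.
  rewrite (_ : (M.+1%:R <= t) = false) ?addr0 ?IH//.
  by apply/negbTE; rewrite -ltNge (le_lt_trans h)// ltr_nat.
rewrite (eq_bigr (fun=> 1)) => [|j _]; last first.
  by rewrite (_ : (j.+1%:R <= t) = true)// (le_trans _ (ltW h))// ler_nat.
rewrite sumr_const card_ord -natr1 in tM *.
have -> : 1 *+ M = M%:R :> R by [].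
by case: (_ <= t); rewrite /= ler_norml; apply/andP; split; lra.
Qed.

Variable D : set T.
Hypotheses (mD : measurable D) (Doo : (mu D < +oo)%E).

(** On D the function chi + 1 takes values in [0, 2]; rounding it down to multiples of 1/N writes
    chi, up to 1/N, through the indicators of 2 N superlevel sets. *)
Lemma indic_steps_approximation chi e : measurable_fun setT chi ->
  (forall x, `|chi x| <= 1) -> (forall x, ~ D x -> chi x = 0) -> 0 < e ->
  exists N : nat, exists A : 'I_N -> set T, exists c : R,
   [/\ forall j, measurable (A j),
    forall x, `|c * (\sum_j \1_(A j `&` D) x) - \1_D x| <= 1 &
    (\int[mu]_x `|chi x - (c * (\sum_j \1_(A j `&` D) x) - \1_D x)|%:E <= e%:E)%E].
Proof.
move=> mc c1 cD e0.
have [N [N0 Ne]] : exists N : nat, (0 < N)%N /\ N%:R^-1 * fine (mu D) <= e.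
  exists (Num.truncn (e^-1 * fine (mu D))).+1; split=> //.
  have h := truncnS_gt (e^-1 * fine (mu D)).
  by rewrite ler_pdivrMl// mulrC -ler_pdivrMl// ltW.
have N1 : 0 < N%:R :> R by rewrite ltr0n.
pose A (j : 'I_(N + N)) : set T := [set x | j.+1%:R <= N%:R * (chi x + 1)].
pose s (x : T) : R := N%:R^-1 * (\sum_j \1_(A j `&` D) x) - \1_D x.
have sD x : D x -> s x = N%:R^-1 * (\sum_(j < N + N) ((j.+1%:R <= N%:R * (chi x + 1))%R)%:R) - 1.
  move=> Dx; rewrite /s indicE mem_set//; congr (_ * _ - _); apply: eq_bigr => j _.
  rewrite indicE in_setI [x \in D]mem_set// andbT.
  rewrite (_ : (x \in A j) = (j.+1%:R <= N%:R * (chi x + 1))%R)//.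
  by apply/idP/idP; rewrite inE.
have sD0 x : ~ D x -> s x = 0.
  move=> Dx; rewrite /s indicE memNset// subr0 big1 ?mulr0// => j _.
  by rewrite indicE memNset// => -[].
have s1 x : `|s x| <= 1.
  have [Dx|/sD0->] := pselect (D x); last by rewrite normr0.
  rewrite sD//; set S := \sum_j _.
  have S0 : 0 <= S by apply: sumr_ge0 => j _.
  have S2 : S <= N%:R + N%:R.
    apply: (@le_trans _ _ (\sum_(j < N + N) 1)); last by rewrite sumr_const card_ord natrD.
    by apply: ler_sum => j _; rewrite lern1 leq_b1.
  rewrite ler_norml lerBlDr lerBrDr addNr mulr_ge0 ?invr_ge0 ?(ltW N1)//=.
  by rewrite ler_pdivrMl// mulrDr mulr1.
have mA j : measurable (A j).
  rewrite -[A j]setTI; apply: measurable_fun_le => //.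
  by apply: measurable_funM => //; exact: measurable_funD.
have ms : measurable_fun setT s.
  apply: measurable_funB; last exact: measurable_indic.
  apply: measurable_funM => //; apply: measurable_sum => j.
  by apply: measurable_indic; exact: measurableI.
exists (N + N)%N, A, N%:R^-1; split => //.
have cs x : `|chi x - s x| <= N%:R^-1.
  have [Dx|Dx] := pselect (D x); last first.
    by rewrite sD0// cD// subrr normr0 invr_ge0 ltW.
  rewrite sD//; have /andP[h1 h2] : -1 <= chi x <= 1 by rewrite -ler_norml.
  have t0 : 0 <= N%:R * (chi x + 1) by rewrite mulr_ge0 ?(ltW N1)// -lerBlDr sub0r.
  have t2 : N%:R * (chi x + 1) <= (N + N)%:R.
    by rewrite natrD -mulr2n -[leRHS]mulr_natr ler_wpM2l ?(ltW N1)//; lra.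
  have := grid_approximation t0 t2; move: (\sum_j _) => S h.
  rewrite (_ : chi x - _ = N%:R^-1 * (N%:R * (chi x + 1) - S)).
    by rewrite normrM gtr0_norm ?invr_gt0// ler_piMr ?invr_ge0 ?(ltW N1).
  by field; rewrite gt_eqF.
have := @integral_exprn_le_bound _ T R mu (fun x => chi x - s x) N%:R^-1 D 0 (measurable_funB mc ms) mD.
rewrite invr_ge0 (ltW N1) => /(_ isT cs); under eq_integral do rewrite expr1.
rewrite expr1 => H; apply: le_trans (H _) _.
  by move=> x Dx; rewrite sD0// cD// subrr.
by rewrite -(fineK (x := mu D)) ?ge0_fin_numE// -EFinM lee_fin.
Qed.

Lemma integrableM_indic (g0 : T -> R) (A : set T) : measurable A ->
  mu.-integrable setT (EFin \o g0) ->
  mu.-integrable setT (EFin \o (fun x => g0 x * \1_A x)).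
Proof.
move=> mA ig; apply: (@integrable_mulr_bounded _ T R mu _ _ _ 1 measurableT ig).
  exact: measurable_indic.
by move=> x _; rewrite indicE; case: (_ \in _); rewrite ?normr1 ?normr0.
Qed.

Lemma pairing_of_indicators g (g0 : T -> R) :
  (forall m, mu.-integrable setT (EFin \o g m)) -> unif_int mu g ->
  mu.-integrable setT (EFin \o g0) ->
  (forall A, measurable A -> Rintegral mu setT (fun x => g m x * \1_(A `&` D) x) @[m --> \oo] -->
     Rintegral mu setT (fun x => g0 x * \1_(A `&` D) x)) ->
  forall chi, measurable_fun setT chi -> (forall x, `|chi x| <= 1) ->
  (forall x, ~ D x -> chi x = 0) ->
  Rintegral mu setT (fun x => g m x * chi x) @[m --> \oo] -->
  Rintegral mu setT (fun x => g0 x * chi x).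
Proof.
move=> ig ug ig0 H chi mc c1 cD; apply: pairing_cvg => // e e0.
have [N [A [c [mA s1 cs]]]] := indic_steps_approximation mc c1 cD e0.
exists (fun x => c * (\sum_j \1_(A j `&` D) x) - \1_D x); split => //.
  apply: measurable_funB; last exact: measurable_indic.
  apply: measurable_funM => //; apply: measurable_sum => j.
  by apply: measurable_indic; exact: measurableI.
have E (f : T -> R) : mu.-integrable setT (EFin \o f) ->
    Rintegral mu setT (fun x => f x * (c * (\sum_j \1_(A j `&` D) x) - \1_D x)) =
    c * (\sum_j Rintegral mu setT (fun x => f x * \1_(A j `&` D) x)) -
    Rintegral mu setT (fun x => f x * \1_(setT `&` D) x).
  move=> if_; rewrite setTI.
  have [iS <-] := @Rintegral_sum _ T R mu _ (index_enum _) (fun j x => f x * \1_(A j `&` D) x)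
    (fun j => integrableM_indic (measurableI _ _ (mA j) mD) if_).
  rewrite -(RintegralZl c measurableT iS).
  rewrite -(RintegralB measurableT (integrableZl measurableT c iS) (integrableM_indic mD if_)).
  apply: eq_Rintegral => x _; rewrite mulrBr mulrCA; congr (_ * _ - _).
  by rewrite mulr_sumr.
rewrite E//; under eq_fun do rewrite E//.
apply: cvgB; last exact: H.
by apply: cvgMl_tmp; apply: cvg_sumr => j; exact: H.
Qed.

End pairings.

(** * Weak limits through the Radon-Nikodym theorem *)

Section weak_limits.
Context d (T : measurableType d) (R : realType) (mu : {sigma_finite_measure set T -> \bar R}).
Implicit Types (g : nat -> T -> R) (h chi phi : T -> R) (q e : R) (A B : set T).
Variable D : set T.
Hypotheses (mD : measurable D) (Doo : (mu D < +oo)%E).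

Section set_function.
Variable g : nat -> T -> R.
Hypotheses (ig : forall m, mu.-integrable setT (EFin \o g m)) (ug : unif_int mu g).
Hypothesis cg : forall A, measurable A ->
  cvgn (fun m => Rintegral mu setT (fun x => g m x * \1_(A `&` D) x)).

(** The candidate charge: the limit of the integrals of g m over the part of A in D. Its density
    will be the weak limit. *)
Let L A : R := lim ((fun m => Rintegral mu setT (fun x => g m x * \1_(A `&` D) x)) @ \oo).

Let L_cvg A : measurable A ->
  Rintegral mu setT (fun x => g m x * \1_(A `&` D) x) @[m --> \oo] --> L A.
Proof. exact: cg. Qed.

Let L_additive A B : measurable A -> measurable B -> A `&` B = set0 ->
  L (A `|` B) = L A + L B.
Proof.
move=> mA mB AB; apply/cvg_lim => //.
rewrite (_ : (fun m => _) = (fun m => Rintegral mu setT (fun x => g m x * \1_(A `&` D) x) +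
  Rintegral mu setT (fun x => g m x * \1_(B `&` D) x))).
  by apply: cvgD; exact: L_cvg.
apply/funext => m.
rewrite -(RintegralD measurableT (integrableM_indic (measurableI _ _ mA mD) (ig m))
  (integrableM_indic (measurableI _ _ mB mD) (ig m))).
apply: eq_Rintegral => x _; rewrite -mulrDr; congr (_ * _).
rewrite !indicE !in_setI in_setU.
have : ~ ((x \in A) && (x \in B)) by rewrite -in_setI AB inE.
by case: (x \in A); case: (x \in B); case: (x \in D) => //=; rewrite ?addr0 ?add0r.
Qed.

(** Uniform integrability survives in the limit; countable additivity and absolute continuity of L
    both rest on this bound. *)
Let L_small e : 0 < e -> exists2 K, 0 <= K &
  forall A, measurable A -> `|L A| <= K * fine (mu (A `&` D)) + e.
Proof.
move=> e0; have [K K0 HK] := ug e0; exists K => // A mA.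
apply: (cvgr_to_le (cvg_norm (L_cvg mA))); near=> m; apply: HK.
- by apply: measurable_indic; exact: measurableI.
- by move=> x; rewrite indicE; case: (_ \in _); rewrite ?normr1 ?normr0// ler1n.
- rewrite fineK; last first.
    by rewrite ge0_fin_numE// (le_lt_trans _ Doo)// le_measure ?inE//; exact: measurableI.
  rewrite (eq_integral (fun x => (\1_(A `&` D) x)%:E)); last first.
    by move=> x _; rewrite ger0_norm// indicE; case: (_ \in _).
  by rewrite integral_indic// ?setIT//; exact: measurableI.
Unshelve. all: by end_near. Qed.

Let L0 : L set0 = 0.
Proof.
by have := L_additive measurable0 measurable0 (setI0 _); rewrite setU0 => /eqP; rewrite -subr_eq subrr eq_sym => /eqP.
Qed.

Let L_sigma_additive : semi_sigma_additive (fun A => (L A)%:E).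
Proof.
move=> F mF tF mUF.
(* The tails of the union: L of the n-th tail is the error of the n-th partial sum, and the measures
   of the tails in D decrease to 0. *)
pose G (n : nat) := \bigcup_(i in [set i | (n <= i)%N]) F i.
have mG n : measurable (G n) by apply: bigcup_measurable.
have GS n : G n = F n `|` G n.+1.
  apply/seteqP; split => x.
    move=> [i /= ni Fi]; move: ni; rewrite leq_eqVlt => /predU1P[->|ni]; first by left.
    by right; exists i.
  by move=> [Fx|[i /= ni Fi]]; [exists n => /=|exists i => //=; exact: ltnW].
have FG n : F n `&` G n.+1 = set0.
  apply/seteqP; split => // x [Fx [i /= ni Fi]].
  have := tF n i I I; have : (F n `&` F i) !=set0 by exists x.
  by move=> + /(_ _) h => /h ni'; rewrite ni' ltnn in ni.
have LS n : L (\bigcup_i F i) = \sum_(0 <= i < n) L (F i) + L (G n).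
  elim: n => [|n IH].
    rewrite big_geq// add0r; congr (L _); apply/seteqP; split => x [i _ Fi]; exists i => //.
  by rewrite big_nat_recr//= -addrA -(L_additive (mF n) (mG n.+1) (FG n)) -GS.
have Goo n : (mu (G n `&` D) < +oo)%E.
  by rewrite (le_lt_trans _ Doo)// le_measure ?inE//; exact: measurableI.
have G0 : \bigcap_n (G n `&` D) = set0.
  apply/seteqP; split => // x H; have [[i _ Fi] _] := H 0%N I.
  have [[j /= ij Fj] _] := H i.+1 I.
  have := tF i j I I; have : (F i `&` F j) !=set0 by exists x.
  by move=> + /(_ _) h => /h ij'; rewrite ij' ltnn in ij.
have muG : mu (G n `&` D) @[n --> \oo] --> 0%E.
  rewrite -(measure0 mu) -G0; apply: nonincreasing_cvg_mu.
  - exact: Goo.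
  - by move=> n; exact: measurableI.
  - by rewrite G0.
  - move=> m n mn; apply/subsetPset => x [[i /= ni Fi] Dx]; split=> //.
    by exists i => //=; exact: leq_trans ni.
have fmuG : fine (mu (G n `&` D)) @[n --> \oo] --> (0 : R) by apply: fine_cvg muG.
rewrite (_ : (fun n => _) = (fun n => (\sum_(0 <= i < n) L (F i))%:E)); last first.
  by apply/funext => n; rewrite sumEFin.
apply: cvg_EFin; first by near=> n.
apply/cvgrPdist_le => e e0; have e2 : 0 < e / 2%:R by rewrite divr_gt0.
have [K K0 HK] := L_small e2.
have K1 : 0 < K + 1 by rewrite ltr_wpDl.
have eK : 0 < e / 2%:R / (K + 1) by rewrite divr_gt0.
move/cvgrPdist_le : fmuG => /(_ _ eK) h.
near=> n => /=.
rewrite (LS n) addrAC subrr add0r (le_trans (HK _ (mG n)))// [leRHS]splitr lerD2r.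
have : `|0 - fine (mu (G n `&` D))| <= e / 2%:R / (K + 1) by near: n.
rewrite sub0r normrN => /(le_trans (ler_norm _)) h1.
rewrite (le_trans (ler_wpM2l K0 h1))// mulrCA ler_piMr ?(ltW e2)//.
by rewrite ler_pdivrMr ?mul1r ?lerDl.
Unshelve. all: by end_near. Qed.

Lemma weak_limit_of_indicators : exists g0 : T -> R,
  [/\ mu.-integrable setT (EFin \o g0), forall x, ~ D x -> g0 x = 0 &
   forall A, measurable A -> Rintegral mu setT (fun x => g m x * \1_(A `&` D) x) @[m --> \oo] -->
     Rintegral mu setT (fun x => g0 x * \1_(A `&` D) x)].
Proof.
pose nu0 A := (L A)%:E.
have nu00 : nu0 set0 = 0%E by rewrite /nu0 L0.
have nu0f A : measurable A -> nu0 A \is a fin_num by [].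
pose nuC := isCharge.Build _ T R nu0 nu00 nu0f L_sigma_additive.
pose nu : {charge set T -> \bar R} := HB.pack nu0 nuC.
have numu : nu `<< mu.
  apply/null_content_dominatesP => A mA muA; congr EFin.
  apply/eqP; rewrite -normr_le0; apply/ler_addgt0Pr => e e0; rewrite add0r.
  have [K K0 HK] := L_small e0; apply: le_trans (HK _ mA) _.
  rewrite (_ : mu (A `&` D) = 0%E) ?mulr0 ?add0r//.
  by apply: (subset_measure0 _ mA _ muA) => //; exact: measurableI.
have if_ := Radon_Nikodym_integrable numu.
have fE x : (Radon_Nikodym nu mu x = (fine (Radon_Nikodym nu mu x))%:E)%E.
  by rewrite fineK// Radon_Nikodym_fin_num.
have ig0 : mu.-integrable setT (EFin \o (fun x => fine (Radon_Nikodym nu mu x))).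
  by rewrite (_ : EFin \o _ = Radon_Nikodym nu mu)//; apply/funext => x /=; rewrite -fE.
exists (fun x => fine (Radon_Nikodym nu mu x) * \1_D x); split.
- exact: integrableM_indic.
- by move=> x Dx; rewrite indicE memNset// mulr0.
move=> A mA; have mAD := measurableI _ _ mA mD.
rewrite (_ : Rintegral mu setT _ = L (A `&` D)); first by rewrite /L -setIA setIid; exact: L_cvg.
have := Radon_Nikodym_integral numu mAD.
rewrite /nu/= /nu0 => h; apply: EFin_inj; rewrite h.
rewrite /Rintegral fineK; last first.
  by apply: integrable_fin_num => //; do 2 apply: integrableM_indic => //.
rewrite [RHS]integral_mkcond; apply: eq_integral => x _.
rewrite /patch indicE [X in _ * _ * X]indicE in_setI fE.
by case: (x \in A); case: (x \in D) => /=; rewrite ?mulr1 ?mulr0.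
Qed.

End set_function.
End weak_limits.

Section weak_limit_bound.
Context d (T : measurableType d) (R : realType) (mu : {measure set T -> \bar R}).
Implicit Types (g : nat -> T -> R) (h chi : T -> R) (q e : R).
Variable D : set T.
Hypotheses (mD : measurable D) (Doo : (mu D < +oo)%E).

(** Duality: with w the truncated limit, pairing with chi = sgn(w) |w|^(q-1) / c turns the weak
    limit into the integral of |w|^q. Truncation keeps chi bounded and this integral finite, so that
    half of it can be absorbed, whence the factor 2 * 2^q. *)
Lemma Lq_le_truncate_of_pairing g (g0 : T -> R) q C (N : R) : 1 < q -> 0 < N ->
  (forall m, Lq_le mu q C (g m)) ->
  measurable_fun setT g0 -> (forall x, ~ D x -> g0 x = 0) ->
  (forall chi, measurable_fun setT chi -> (forall x, `|chi x| <= 1) ->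
    (forall x, ~ D x -> chi x = 0) ->
    Rintegral mu setT (fun x => g m x * chi x) @[m --> \oo] -->
    Rintegral mu setT (fun x => g0 x * chi x)) ->
  (\int[mu]_x (`|truncate N g0 x| `^ q)%:E <= (2%:R * 2%:R `^ q * C)%:E)%E.
Proof.
move=> q1 N0 gC mg0 g0D H.
have q0 : 0 < q by apply: lt_trans q1.
have qN0 : q != 0 by rewrite gt_eqF.
pose w := truncate N g0; have mw : measurable_fun setT w by exact: measurable_truncate.
have wD x : ~ D x -> w x = 0 by move=> /g0D h; rewrite /w /truncate h normr0 (ltW N0).
have wN x : `|w x| <= N by apply: truncate_le; exact: ltW.
pose c := N `^ (q - 1); have c0 : 0 < c by rewrite powR_gt0.
have cw x : `|w x| `^ (q - 1) <= c.
  by rewrite ge0_ler_powR ?nnegrE ?subr_ge0// ltW.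
have mwp (r : R) : measurable_fun setT (fun x => `|w x| `^ r).
  by apply/measurable_EFinP; exact: measurable_powR_norm.
have iw : mu.-integrable setT (EFin \o (fun x => `|w x| `^ q)).
  apply: (@integrable_bounded_on _ T R mu _ (N `^ q) D) => //.
    by move=> x; rewrite ger0_norm ?powR_ge0// ge0_ler_powR ?nnegrE// ltW.
  by move=> x /wD ->; rewrite normr0 powR0.
pose sgn (x : T) : R := if w x < 0 then -1 else 1.
have sgnw x : sgn x * w x = `|w x|.
  by rewrite /sgn; case: ltP => [/ltr0_norm ->|/ger0_norm ->]; rewrite ?mulN1r ?mul1r.
have sgn1 x : `|sgn x| = 1 by rewrite /sgn; case: ifP; rewrite ?normrN normr1.
have msgn : measurable_fun setT sgn.
  by apply: measurable_fun_ifT => //; exact: measurable_fun_ltr.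
pose chi (x : T) : R := c^-1 * (sgn x * `|w x| `^ (q - 1)).
have mchi : measurable_fun setT chi.
  by apply: measurable_funM => //; exact: measurable_funM.
have chiN x : `|chi x| = c^-1 * `|w x| `^ (q - 1).
  rewrite /chi normrM normrM sgn1 mul1r [X in _ * X]ger0_norm ?powR_ge0//.
  by rewrite ger0_norm// invr_ge0 ltW.
have chi1 x : `|chi x| <= 1 by rewrite chiN ler_pdivrMl// mulr1.
have chiD x : ~ D x -> chi x = 0.
  by move=> /wD h; rewrite /chi h normr0 powR0 ?mulr0// subr_eq0 gt_eqF.
(* Where |g0| > N both w and chi vanish, so g0 may be replaced by w in the product. *)
have g0chi x : g0 x * chi x = c^-1 * `|w x| `^ q.
  rewrite /chi mulrCA -(mulr_powRB1 _ q0)//; congr (_ * _).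
  have [gx|gx] := boolP (`|g0 x| <= N).
    by rewrite -{1}[g0 x](_ : w x = _) ?mulrA ?[w x * _]mulrC ?sgnw// /w /truncate gx.
  by rewrite /w /truncate (negbTE gx) normr0 powR0 ?mulr0 ?mul0r// subr_eq0 gt_eqF.
pose I := Rintegral mu setT (fun x => `|w x| `^ q).
have IE : (\int[mu]_x (`|w x| `^ q)%:E = I%:E)%E.
  by rewrite /I /Rintegral fineK// integrable_fin_num.
have Ile : (\int[mu]_x (`|w x| `^ q)%:E <= I%:E)%E by rewrite IE.
have K0 : 0 <= c^-1 * 2%:R `^ q by rewrite mulr_ge0 ?powR_ge0 ?invr_ge0 ?(ltW c0).
have L0 : 0 <= c^-1 * 2%:R^-1 by rewrite mulr_ge0 ?invr_ge0 ?(ltW c0).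
have fab m x : `|g m x * chi x| <= c^-1 * 2%:R `^ q * `|g m x| `^ q + c^-1 * 2%:R^-1 * `|w x| `^ q.
  rewrite normrM chiN mulrCA -!mulrA -mulrDr ler_wpM2l ?invr_ge0 ?(ltW c0)//.
  exact: mulr_powR_le.
have IC : c^-1 * I <= c^-1 * 2%:R `^ q * C + c^-1 * 2%:R^-1 * I.
  rewrite /I -(RintegralZl _ measurableT iw).
  under eq_Rintegral do rewrite -g0chi.
  apply: (cvgr_to_le (H chi mchi chi1 chiD)); near=> m.
  have [mgm gmC] := gC m.
  have mgq : measurable_fun setT (fun x => `|g m x| `^ q).
    by apply/measurable_EFinP; exact: measurable_powR_norm.
  have mgc := measurable_funM mgm mchi.
  have := normr_Rintegral_le_combination mgc mgq (mwp q) K0 L0 (fun x => powR_ge0 _ _)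
    (fun x => powR_ge0 _ _) (fab m) gmC Ile.
  by move=> /(normr_Rintegral_le mgc)[_]; apply: le_trans; exact: ler_norm.
rewrite IE lee_fin.
move: IC; rewrite -!mulrA -mulrDr ler_pM2l ?invr_gt0// => IC.
move: (2%:R `^ q * C) IC => B IC; lra.
Unshelve. all: by end_near. Qed.

(** The bound on the truncations is independent of N, and monotone convergence over the sets where
    |g0| <= N + 1 removes them. *)
Lemma Lq_le_of_pairing g (g0 : T -> R) q C : 1 < q ->
  (forall m, Lq_le mu q C (g m)) ->
  measurable_fun setT g0 -> (forall x, ~ D x -> g0 x = 0) ->
  (forall chi, measurable_fun setT chi -> (forall x, `|chi x| <= 1) ->
    (forall x, ~ D x -> chi x = 0) ->
    Rintegral mu setT (fun x => g m x * chi x) @[m --> \oo] -->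
    Rintegral mu setT (fun x => g0 x * chi x)) ->
  Lq_le mu q (2%:R * 2%:R `^ q * C) g0.
Proof.
move=> q1 gC mg0 g0D H; split => //.
have q0 : q != 0 by rewrite gt_eqF// (lt_trans _ q1).
pose E (N : nat) := [set x | `|g0 x| <= N.+1%:R].
have mE N : measurable (E N).
  by rewrite -[E N]setTI; apply: measurable_fun_le => //; exact: measurableT_comp.
have UE : \bigcup_N E N = setT.
  apply/seteqP; split=> // x _; exists (Num.truncn `|g0 x|) => //.
  by rewrite /E /= ltW// truncnS_gt.
have := @ge0_nondecreasing_set_cvg_integral _ T R E (fun x => (`|g0 x| `^ q)%:E) mu.
rewrite UE => cvE; apply: (cvge_to_le (cvE _ mE _ _)).
- move=> N M NM; apply/subsetPset => x; rewrite /E /= => /le_trans; apply.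
  by rewrite ler_nat ltnS.
- by move=> N; apply: measurable_funTS; exact: measurable_powR_norm.
- by move=> N x _; rewrite lee_fin powR_ge0.
near=> N; have N0 : 0 < (N.+1%:R : R) by [].
apply: le_trans (Lq_le_truncate_of_pairing q1 N0 gC mg0 g0D H).
rewrite integral_mkcond le_eqVlt; apply/orP; left; apply/eqP.
apply: eq_integral => x _; rewrite /patch /truncate.
have [h|h] := boolP (x \in E N); first by move: h; rewrite inE /E /= => ->.
case: ifPn => [h'|]; last by rewrite normr0 powR0.
by move: h; rewrite notin_setE => /(_ h').
Unshelve. all: by end_near. Qed.

End weak_limit_bound.

Section Lq_of_finite_measure.
Context d (T : measurableType d) (R : realType) (mu : {measure set T -> \bar R}).
Variable D : set T.
Hypotheses (mD : measurable D) (Doo : (mu D < +oo)%E).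

Lemma Lq_le_Lk (k : nat) (q C : R) (g : T -> R) : k.+1%:R <= q -> Lq_le mu q C g ->
  (forall x, ~ D x -> g x = 0) ->
  (\int[mu]_x (`|g x| ^+ k.+1)%:E <= (fine (mu D) + C)%:E)%E.
Proof.
move=> kq [mg gC] gD.
have q0 : 0 <= q by apply: le_trans kq.
have := @normr_Rintegral_le_combination _ T R mu (fun x => `|g x| ^+ k.+1) (\1_D) (fun x => `|g x| `^ q) (fine (mu D)) C 1 1.
rewrite !mul1r => H.
have h1 : measurable_fun setT (fun x => `|g x| ^+ k.+1).
  by apply: measurable_funX; exact: measurableT_comp.
have h2 : measurable_fun setT (fun x => `|g x| `^ q).
  by apply/measurable_EFinP; exact: measurable_powR_norm.
have h3 x : `| `|g x| ^+ k.+1 | <= 1 * \1_D x + 1 * `|g x| `^ q.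
  rewrite !mul1r ger0_norm ?exprn_ge0//.
  have [Dx|Dx] := pselect (D x); last first.
    by rewrite gD// normr0 expr0n/= addr_ge0// powR_ge0.
  rewrite indicE mem_set//=; have [g1|g1] := leP `|g x| 1.
    by rewrite (@le_trans _ _ 1) ?exprn_ile1// lerDl powR_ge0.
  rewrite (@le_trans _ _ (`|g x| `^ q)) ?lerDr//.
  by rewrite -powR_mulrn// ler_powR// ltW.
have h4 : (\int[mu]_x (\1_D x)%:E <= (fine (mu D))%:E)%E.
  by rewrite integral_indic// setIT fineK// ge0_fin_numE.
have h5 x : 0 <= `|g x| `^ q by exact: powR_ge0.
have h6 x : 0 <= \1_D x :> R by rewrite indicE.
have := H h1 (measurable_indic mD) h2 ler01 ler01 h6 h5 h3 h4 gC.
by under eq_integral do rewrite normrX normr_id.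
Qed.

Lemma Lq_le_integrableX (k : nat) (q C : R) (g : T -> R) : k.+1%:R <= q -> Lq_le mu q C g ->
  (forall x, ~ D x -> g x = 0) ->
  mu.-integrable setT (EFin \o (fun x => `|g x| ^+ k.+1)).
Proof.
move=> kq gC gD; apply/integrableP; split.
  by apply/measurable_EFinP; case: gC => mg _; apply: measurable_funX; exact: measurableT_comp.
rewrite (eq_integral (fun x => (`|g x| ^+ k.+1)%:E)); last first.
  by move=> x _ /=; rewrite normrX normr_id.
by apply: le_lt_trans (Lq_le_Lk kq gC gD) _; rewrite ltry.
Qed.

Lemma Lq_le_integrable (q C : R) (g : T -> R) : 1 <= q -> Lq_le mu q C g ->
  (forall x, ~ D x -> g x = 0) -> mu.-integrable setT (EFin \o g).
Proof.
move=> q1 gC gD; have := @Lq_le_integrableX 0 q C g q1 gC gD.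
have [mg _] := gC; exact: (integrable_of_Lk mg mD Doo gD).
Qed.

End Lq_of_finite_measure.

Section weak_compactness.
Context {R : realType} {n : nat}.
Implicit Types (f g u phi rho : 'rV[R]_n -> R) (x y : 'rV[R]_n) (j : 'I_n).
Local Notation mu := (@lebesgue_rV R n).
Local Notation T := (@lebesgue_space R n).
Variable U : set 'rV[R]_n.
Hypotheses (oU : open U) (bU : bounded_set U).

Let mU : measurable (U : set T). Proof. exact: open_lebesgue_measurable. Qed.
Let Uoo : (mu U < +oo)%E. Proof. exact: lebesgue_rV_bounded. Qed.

Lemma inner_set_exhausts (e : R) : 0 < e ->
  exists2 r : R, 0 < r & (mu (U `\` inner_set U r) <= e%:E)%E.
Proof.
move=> e0; pose F (m : nat) : set T := U `\` inner_set U m.+1%:R^-1.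
have mF m : measurable (F m).
  by apply: measurableD => //; apply: open_lebesgue_measurable; exact: open_inner_set.
have F0 : \bigcap_m F m = set0.
  apply/seteqP; split => // x H; have [Ux _] := H 0%N I.
  have s0 := sup_inner_radii_gt0 oU Ux.
  have [m _ /(_ m (leqnn m)) hm] := near_infty_natSinv_lt (PosNum s0).
  by have [_] := H m I; apply.
have cF : mu (F m) @[m --> \oo] --> (0 : \bar R)%E.
  have <- : mu (\bigcap_m F m) = 0%E by rewrite F0 measure0.
  apply: (@nonincreasing_cvg_mu _ T R mu F) => //.
  - by apply: le_lt_trans Uoo; apply: lebesgue_rV_le; exact: subDsetl.
  - by rewrite F0.
  - move=> a b ab; apply/subsetPset => x [Ux nx]; split => // h; apply: nx.
    apply: le_lt_trans h; rewrite lef_pV2 ?posrE// ler_nat.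
    by rewrite ltnS.
have /fine_cvgP[fF /cvgrPdist_le/(_ _ e0) h] := cF.
near \oo => m.
exists m.+1%:R^-1 => //.
have fm : mu (F m) \is a fin_num by near: m.
rewrite -[_ `\` _]/(F m) -(fineK fm) lee_fin.
have : `|0 - fine (mu (F m))| <= e by near: m.
by rewrite sub0r normrN; apply: le_trans; exact: ler_norm.
Unshelve. all: by end_near. Qed.

Lemma convolution_bounded a (e M : R) rho x : mollifier e rho ->
  measurable_fun setT (a : T -> R) -> (forall y, `|a y| <= M) -> `|convolution a rho x| <= M.
Proof.
move=> mr ma aM; have [tr r0 _ _ _] := mr.
have r1 := mollifier_int_translate mr x.
have mrx : measurable_fun setT ((fun y => rho (x - y)) : T -> R) by exact: test_functionT_reflect.
have ir : mu.-integrable setT (EFin \o ((fun y => rho (x - y)) : T -> R)).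
  apply/integrableP; split; first exact/measurable_EFinP.
  under eq_integral do rewrite /= ger0_norm//.
  by rewrite r1 ltry.
have := @bounded_mul_Rintegral _ T R mu _ _ M ir ma aM.
rewrite (_ : Rintegral _ _ _ = convolution a rho x); last first.
  by apply: eq_Rintegral => y _; rewrite mulrC.
rewrite (_ : Rintegral _ _ _ = 1) ?mulr1//.
by rewrite /Rintegral; under eq_integral do rewrite ger0_norm//; rewrite r1.
Qed.

(** The function is first cut off near the boundary of U, at a small cost in measure, so that its
    mollification has compact support in U. *)
Lemma test_function_approximation a (e : R) : measurable_fun setT (a : T -> R) ->
  (forall x, `|a x| <= 1) -> (forall x, ~ U x -> a x = 0) -> 0 < e ->
  exists phi, [/\ test_function U phi, forall x, `|phi x| <= 1 &
    (\int[mu]_x `|a x - phi x|%:E <= e%:E)%E].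
Proof.
move=> ma a1 aU e0; have e2 : 0 < e / 2%:R by rewrite divr_gt0.
have [r r0 Hr] := inner_set_exhausts e2.
pose b x := a x * \1_(inner_set U r) x.
have mV : measurable (inner_set U r : set T) by apply: open_lebesgue_measurable; exact: open_inner_set.
have mb : measurable_fun setT (b : T -> R).
  by apply: measurable_funM => //; exact: measurable_indic.
have b1 x : `|b x| <= 1.
  by rewrite /b indicE; case: (_ \in _); rewrite ?mulr1 ?mulr0 ?normr0.
have bz x : ~ U x -> b x = 0 by move=> /aU h; rewrite /b h mul0r.
have bV x : ~ inner_set U r x -> b x = 0 by move=> h; rewrite /b indicE memNset// mulr0.
have ib := @integrable_bounded_on _ T R mu b 1 U mb mU Uoo b1 bz.
have [e1 e10 He1] := mollification_L1 oU bU ib bz e2.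
(* With width at most r / 2, points within reach of [inner_set U r] stay at truncated distance at
   least r / 2 from the complement. *)
have [e' [e'0 e'1 e'r]] : exists e', [/\ 0 < e', e' <= e1 & e' <= r / 2].
  by exists (Num.min e1 (r / 2)); rewrite lt_min e10 divr_gt0// !ge_min !lexx orbT.
have [rho mr] := mollifier_exists (n := n) e'0; have [tr _ _ rs _] := mr.
exists (convolution b rho); split.
- apply: (@test_function_intro _ _ _ [set x | r / 2 <= sup (inner_radii U x)]).
  + exact: smooth_convolution.
  + exact: closed_inner_radii_ge.
  + have [M [Mr HM]] := bU; exists M; split=> // t Mt x /= h; apply: HM Mt _ _; apply: contrapT => /sup_inner_radii_eq0 h'.
    by move: h; rewrite h' leNgt divr_gt0.
  + move=> x /= h; apply: contrapT => /sup_inner_radii_eq0 h'.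
    by move: h; rewrite h' leNgt divr_gt0.
  + move=> x /=; apply: contraNT; rewrite -ltNge => h; apply/eqP.
    rewrite /convolution (_ : (fun y : T => _) = cst 0); first by rewrite /Rintegral integral0.
    apply/funext => y; have [yV|/bV->] := pselect (inner_set U r y); last by rewrite mul0r.
    rewrite rs ?mulr0//; apply: (le_trans e'r).
    have := sup_inner_radii_lipschitz U y x; rewrite mul1r [`|y - x|]distrC.
    move=> /(le_trans (ler_norm _)); apply: le_trans.
    by move: yV h; rewrite /inner_set /= => yV h; lra.
- by move=> x; exact: (convolution_bounded _ mr).
have mc := smooth_measurable (smooth_convolution ib tr).
apply: (le_trans (@L1_triangle _ T R mu _ _ _ ma mb mc)).
rewrite [e]splitr EFinD; apply: leeD; last first.
  by under eq_integral do rewrite distrC; exact: ltW (He1 _ rho e'1 mr).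
have mS : measurable (U `\` inner_set U r : set T) by exact: measurableD.
apply: le_trans Hr.
apply: (@integral_norm_le_measure _ T R mu _ (fun x => a x - b x) mS (measurable_funB ma mb)).
have bV1 x : inner_set U r x -> b x = a x by move=> Vx; rewrite /b indicE mem_set// mulr1.
move=> x; have [Vx|Vx] := pselect (inner_set U r x).
  by rewrite bV1// subrr normr0 indicE.
rewrite bV// subr0; have [Ux|/aU ->] := pselect (U x); last by rewrite normr0 indicE.
by rewrite indicE mem_set.
Qed.

(** Extends the convergence from test functions to bounded measurable chi, as the duality bound on
    weak limits requires. *)
Lemma pairing_test_bounded (g : nat -> 'rV[R]_n -> R) (g0 : 'rV[R]_n -> R) :
  (forall m, mu.-integrable setT (EFin \o (g m : T -> R))) ->
  unif_int mu (g : nat -> T -> R) ->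
  mu.-integrable setT (EFin \o (g0 : T -> R)) ->
  (forall phi, test_function U phi ->
     Rintegral mu setT ((fun x => g m x * phi x) : T -> R) @[m --> \oo] -->
     Rintegral mu setT ((fun x => g0 x * phi x) : T -> R)) ->
  forall chi, measurable_fun setT (chi : T -> R) -> (forall x, `|chi x| <= 1) ->
    (forall x, ~ U x -> chi x = 0) ->
    Rintegral mu setT ((fun x => g m x * chi x) : T -> R) @[m --> \oo] -->
    Rintegral mu setT ((fun x => g0 x * chi x) : T -> R).
Proof.
move=> ig ug ig0 H chi mc c1 cU.
apply: (@pairing_cvg _ T R mu g g0 chi ig ug ig0 mc c1) => e e0.
have [phi [tphi p1 cp]] := test_function_approximation mc c1 cU e0.
exists phi; split => //; last exact: H.
exact: smooth_measurable (test_function_smooth tphi).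
Qed.

(** Convergence is transferred from test functions to indicators, whose limits define g0, and back
    from indicators to test functions. *)
Lemma Lq_weak_limit (g : nat -> 'rV[R]_n -> R) (q C : R) : 1 < q -> 0 <= C ->
  (forall m, Lq_le mu q C (g m)) -> (forall m x, ~ U x -> g m x = 0) ->
  (forall phi, test_function U phi ->
     cvgn (fun m => Rintegral mu setT ((fun x => g m x * phi x) : T -> R))) ->
  exists g0 : 'rV[R]_n -> R, [/\ mu.-integrable setT (EFin \o (g0 : T -> R)),
    forall x, ~ U x -> g0 x = 0 &
    forall phi, test_function U phi ->
     Rintegral mu setT ((fun x => g m x * phi x) : T -> R) @[m --> \oo] -->
     Rintegral mu setT ((fun x => g0 x * phi x) : T -> R)].
Proof.
move=> q1 C0 gC gU H.
have ig m := @Lq_le_integrable _ T R mu U mU Uoo q C (g m) (ltW q1) (gC m) (gU m).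
have ug := @unif_int_Lq _ T R mu nat g q C q1 C0 gC.
have indic1 A (x : T) : `|\1_A x| <= 1 :> R.
  by rewrite indicE; case: (_ \in _); rewrite ?normr1 ?normr0.
have cI (A : set T) : measurable A ->
    cvgn (fun m => Rintegral mu setT (fun x : T => g m x * \1_(A `&` U) x)).
  move=> mA; have mI : measurable_fun setT (\1_(A `&` U) : T -> R).
    by apply: measurable_indic; exact: measurableI.
  apply: (@pairing_is_cvg _ T R mu g _ ig ug mI (indic1 _)) => e e0.
  have cU x : ~ U x -> \1_(A `&` U) x = 0 :> R by move=> h; rewrite indicE memNset// => -[].
  have [phi [tphi p1 cp]] := test_function_approximation mI (indic1 _) cU e0.
  exists phi; split => //; last exact: H.
  exact: smooth_measurable (test_function_smooth tphi).
have [g0 [ig0 g0U Hg0]] := @weak_limit_of_indicators _ T R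
  (@completed_measure_extension _ _ _ (@borel_lebesgue R n)) U mU Uoo g ig ug cI.
exists g0; split => // phi tphi.
have [M HM] := test_function_bounded tphi.
have mphi := smooth_measurable (test_function_smooth tphi).
have M1 : 0 < `|M| + 1 by rewrite ltr_wpDl.
pose chi x := (`|M| + 1)^-1 * phi x.
have mchi : measurable_fun setT (chi : T -> R) by exact: measurable_funM.
have chi1 x : `|chi x| <= 1.
  rewrite normrM ger0_norm ?invr_ge0 ?(ltW M1)// ler_pdivrMl// mulr1.
  by rewrite (le_trans (HM x))// (le_trans (ler_norm _))// lerDl.
have chiU x : ~ U x -> chi x = 0 by move=> /(test_function_out tphi) h; rewrite /chi h mulr0.
have := @pairing_of_indicators _ T R mu U mU Uoo g g0 ig ug ig0 Hg0 chi mchi chi1 chiU.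
have E (f : T -> R) : mu.-integrable setT (EFin \o f) ->
    Rintegral mu setT (fun x => f x * phi x) = (`|M| + 1) * Rintegral mu setT (fun x => f x * chi x).
  move=> if_; rewrite -(RintegralZl _ measurableT (integrable_mulr_bounded measurableT if_ mchi (fun x _ => chi1 x))).
  by apply: eq_Rintegral => x _; rewrite /chi mulrCA mulVKf // gt_eqF.
move=> cchi; rewrite E//; under eq_fun do rewrite E//.
exact: cvgMl_tmp.
Qed.

End weak_compactness.

(** * Weak continuity of minors *)

Section Lq_interpolation.
Context d (T : measurableType d) (R : realType) (mu : {measure set T -> \bar R}).

Lemma Lq_leB (q C C' : R) (f g : T -> R) : 1 < q -> Lq_le mu q C f -> Lq_le mu q C' g ->
  Lq_le mu q (2%:R `^ q * C + 2%:R `^ q * C') (fun x => f x - g x).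
Proof.
move=> q1 [mf fC] [mg gC]; split; first exact: measurable_funB.
have m1 : measurable_fun setT (fun x => `|f x| `^ q).
  by apply/measurable_EFinP; exact: measurable_powR_norm.
have m2 : measurable_fun setT (fun x => `|g x| `^ q).
  by apply/measurable_EFinP; exact: measurable_powR_norm.
have m3 : measurable_fun setT (fun x => `|f x - g x| `^ q).
  by apply/measurable_EFinP; apply: measurable_powR_norm; exact: measurable_funB.
have K0 : 0 <= 2%:R `^ q :> R by exact: powR_ge0.
have q0 : 0 <= q by rewrite (le_trans _ (ltW q1)).
have H x : `| `|f x - g x| `^ q | <= 2%:R `^ q * `|f x| `^ q + 2%:R `^ q * `|g x| `^ q.
  rewrite ger0_norm ?powR_ge0// -mulrDr.
  apply: le_trans (powR_distance_le q1 (normr_ge0 _) (normr_ge0 _)).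
  by rewrite ge0_ler_powR ?nnegrE ?addr_ge0// ler_normB.
have := @normr_Rintegral_le_combination _ T R mu _ _ _ C C' _ _ m3 m1 m2 K0 K0
  (fun x => powR_ge0 _ _) (fun x => powR_ge0 _ _) H fC gC.
by under eq_integral do rewrite ger0_norm ?powR_ge0//.
Qed.

(** The pointwise interpolation inequality is integrated with eta small compared with C; the L^1
    term is then made small by taking m large. *)
Lemma Lk_cvg_of_L1_Lq (k : nat) (q C : R) (v : nat -> T -> R) : k.+1%:R < q -> 0 <= C ->
  (forall m, Lq_le mu q C (v m)) ->
  (forall e : R, 0 < e -> \forall m \near \oo, (\int[mu]_x `|v m x|%:E <= e%:E)%E) ->
  forall e : R, 0 < e -> \forall m \near \oo, (\int[mu]_x (`|v m x| ^+ k.+1)%:E <= e%:E)%E.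
Proof.
move=> kq C0 vC v1 e e0; have e2 : 0 < e / 2%:R by rewrite divr_gt0.
have C1 : 0 < C + 1 by rewrite ltr_wpDl.
have eta0 : 0 < e / 2%:R / (C + 1) by rewrite divr_gt0.
have [K K0 HK] := exprn_le_linear_powR kq eta0.
have K1 : 0 < K + 1 by rewrite ltr_wpDl.
have e3 : 0 < e / 2%:R / (K + 1) by rewrite divr_gt0.
have := v1 _ e3; apply: filterS => m vm; have [mv vmC] := vC m.
have m1 : measurable_fun setT (fun x => `|v m x|) by exact: measurableT_comp.
have m2 : measurable_fun setT (fun x => `|v m x| `^ q).
  by apply/measurable_EFinP; exact: measurable_powR_norm.
have m3 : measurable_fun setT (fun x => `|v m x| ^+ k.+1) by exact: measurable_funX.
have H x : `| `|v m x| ^+ k.+1 | <= K * `|v m x| + e / 2%:R / (C + 1) * `|v m x| `^ q.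
  by rewrite normrX normr_id HK.
have := @normr_Rintegral_le_combination _ T R mu _ _ _ _ _ _ _ m3 m1 m2 K0 (ltW eta0)
  (fun x => normr_ge0 _) (fun x => powR_ge0 _ _) H vm vmC.
under eq_integral do rewrite normrX normr_id.
move=> /le_trans; apply; rewrite lee_fin [leRHS]splitr; apply: lerD.
  by rewrite mulrCA ler_piMr ?(ltW e2)// ler_pdivrMr ?mul1r ?lerDl.
by rewrite mulrAC -mulrA ler_piMr ?(ltW e2)// ler_pdivrMr ?mul1r ?lerDl.
Qed.

End Lq_interpolation.

Section minors_weak_continuity.
Context {R : realType} {n : nat}.
Implicit Types (u h phi : 'rV[R]_n -> R) (j : 'I_n).
Local Notation mu := (@lebesgue_rV R n).
Local Notation T := (@lebesgue_space R n).
Local Notation grad phi := (fun j => partial j phi).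
Variable U : set 'rV[R]_n.
Hypotheses (oU : open U) (bU : bounded_set U).

Let mU : measurable (U : set T). Proof. exact: open_lebesgue_measurable. Qed.
Let Uoo : (mu U < +oo)%E. Proof. exact: lebesgue_rV_bounded. Qed.

Definition Lq_on (q C : R) u : Prop := Lq_le mu q C u /\ forall x, ~ U x -> u x = 0.

Lemma Lq_on_Lk_on (k : nat) (q C : R) u : k.+1%:R <= q -> Lq_on q C u -> Lk_on U k.+1 u.
Proof.
move=> kq [uC uU]; split => //; first by case: uC.
exact: (@Lq_le_integrableX _ T R mu U mU Uoo k q C u kq uC uU).
Qed.

Lemma Lq_on_Lk_on_ord (k : nat) (i : 'I_k) (q C : R) u : k%:R <= q -> Lq_on q C u -> Lk_on U k u.
Proof. by case: k i => [[]//|k _]; exact: Lq_on_Lk_on. Qed.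

Lemma test_jac_integrable k (d : 'I_k -> 'I_n -> 'rV[R]_n -> R) (J : 'I_k -> 'I_n) phi :
  (forall i j, Lk_on U k (d i j)) -> test_function U phi ->
  mu.-integrable setT (EFin \o ((fun x => phi x * jac d J x) : T -> R)).
Proof.
move=> Ld tphi; have [M HM] := test_function_bounded tphi.
have mphi := smooth_measurable (test_function_smooth tphi).
case: k d J Ld => [|k] d J Ld.
  have := test_function_integrable tphi; congr (integrable _ _ _).
  apply/funext => x; rewrite /= /jac (_ : \matrix_(_, _) _ = 1%:M) ?det1 ?mulr1//.
  by apply/matrixP => -[].
have ij := @jac_Lk_on_integrable R n U k d J Ld.
have := integrable_mulr_bounded measurableT ij mphi (fun x _ => HM x).
by congr (integrable _ _ _); apply/funext => x; rewrite /= mulrC.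
Qed.

(** delta is uniform over all gradients with the bound C, as an estimate along a sequence requires;
    it depends on phi through the bound of its derivatives. *)
Lemma jac_row_small k (q C e : R) phi : k.+1%:R <= q -> 0 <= C -> 0 < e -> test_function U phi ->
  exists2 delta : R, 0 < delta & forall u (d : 'I_k -> 'I_n -> 'rV[R]_n -> R) (J : 'I_k.+1 -> 'I_n),
  measurable_fun setT (u : T -> R) -> (forall i j, Lq_on q C (d i j)) ->
  (\int[mu]_x (`|u x| ^+ k.+1)%:E <= delta%:E)%E ->
  mu.-integrable setT (EFin \o (jac (cons_row (fun j x => u x * partial j phi x) d) J : T -> R)) /\
  `|Rintegral mu setT (jac (cons_row (fun j x => u x * partial j phi x) d) J : T -> R)| <= e.
Proof.
move=> kq C0 e0 tphi.
pose S : R := \sum_(i < k) \sum_(c < k.+1) (fine (mu U) + C).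
have c0 : 0 <= fine (mu U) + C by rewrite addr_ge0// fine_ge0.
have S0 : 0 <= S by do 2 (apply: sumr_ge0 => ? _).
have /choice[M' HM'] : forall j, exists M : R, forall x, `|partial j phi x| <= M.
  by move=> j; exact: (test_function_bounded (test_function_partial j tphi)).
have mdphi j := smooth_measurable (test_function_smooth (test_function_partial j tphi)).
have [M2 M20 HM2] : exists2 M2 : R, 0 <= M2 & forall j x, `|partial j phi x| <= M2.
  exists (\sum_j `|M' j|) => [|j x]; first exact: sumr_ge0.
  by rewrite (le_trans (HM' j x))// (bigD1 j)//= (le_trans (ler_norm _))// lerDl sumr_ge0.
have [delta delta0 Hdelta] := @jac_small _ T R mu k S e S0 e0.
have Mk : 0 < M2 ^+ k.+1 + 1 by rewrite ltr_wpDl// exprn_ge0.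
exists (delta / (M2 ^+ k.+1 + 1)) => [|u d J mu_ Ld ud]; first by rewrite divr_gt0.
have ma j : measurable_fun setT ((fun x => u x * partial j phi x) : T -> R).
  exact: (measurable_funM mu_ (mdphi j)).
have md i c : measurable_fun setT (d i (J c) : T -> R) by have [[]] := Ld i (J c).
apply: normr_Rintegral_le.
  apply: (@measurable_jac _ T R) => i c.
  by case: (unliftP ord0 i) => [i'|] ->; rewrite ?cons_row0 ?cons_rowS.
apply: (Hdelta _ _ d J (fun c => ma (J c)) md) => [|c].
  rewrite /S -sumEFin; apply: lee_sum => i _; rewrite -sumEFin; apply: lee_sum => c _.
  have [h1 h2] := Ld i (J c).
  exact: (@Lq_le_Lk _ T R mu U mU Uoo k q C _ kq h1 h2).
apply: (@le_trans _ _ ((M2 ^+ k.+1)%:E * \int[mu]_x (`|u x| ^+ k.+1)%:E)%E).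
  apply: (@Lk_scale _ T R mu k.+1 M2 _ _ M20 (ma (J c)) mu_) => x.
  by rewrite normrM mulrC ler_wpM2r.
apply: (@le_trans _ _ ((M2 ^+ k.+1)%:E * (delta / (M2 ^+ k.+1 + 1))%:E)%E).
  by rewrite lee_wpmul2l ?lee_fin ?exprn_ge0.
rewrite -EFinM lee_fin mulrCA ler_piMr ?(ltW delta0)// ler_pdivrMr// mul1r.
by rewrite lerDl.
Qed.

(** For smooth h the products of h with derivatives of phi are test functions, so the expansion
    along the first row leads to tested minors of order k, to which an induction hypothesis
    applies. *)
Lemma jac_gradient_row k phi h (d : 'I_k -> 'I_n -> 'rV[R]_n -> R) (J : 'I_k.+1 -> 'I_n) :
  smooth h -> test_function U phi -> (forall i j, Lk_on U k (d i j)) ->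
  mu.-integrable setT (EFin \o (jac (cons_row (fun j x => h x * partial j phi x) d) J : T -> R)) /\
  Rintegral mu setT (jac (cons_row (fun j x => h x * partial j phi x) d) J : T -> R) =
  \sum_(c < k.+1) (-1) ^+ c * Rintegral mu setT ((fun x => (partial (J c) phi x * h x) *
    jac d (fun e => J (lift c e)) x) : T -> R).
Proof.
move=> sh tphi Ld.
pose F (c : 'I_k.+1) x := (-1) ^+ c * ((partial (J c) phi x * h x) * jac d (fun e => J (lift c e)) x).
have tF c := test_functionM (test_function_partial (J c) tphi) sh.
have i0 c := test_jac_integrable (fun e => J (lift c e)) Ld (tF c).
have iF c : mu.-integrable setT (EFin \o (F c : T -> R)).
  exact: (integrableZl measurableT ((-1) ^+ c) (i0 c)).
have E : jac (cons_row (fun j x => h x * partial j phi x) d) J = fun x => \sum_c F c x.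
  apply/funext => x; rewrite jac_cons; apply: eq_bigr => c _; rewrite /F.
  by rewrite [h x * _]mulrC mulrCA.
have [h1 h2] := @Rintegral_sum _ T R mu _ (index_enum _) F iF.
rewrite E; split; first exact: h1.
rewrite h2; apply: eq_bigr => c _.
exact: (RintegralZl _ measurableT (i0 c)).
Qed.

Theorem minors_weak_continuity k (q C : R) (u : nat -> 'I_k -> 'rV[R]_n -> R)
    (d : nat -> 'I_k -> 'I_n -> 'rV[R]_n -> R) (u0 : 'I_k -> 'rV[R]_n -> R)
    (d0 : 'I_k -> 'I_n -> 'rV[R]_n -> R) (J : 'I_k -> 'I_n) phi :
  k%:R < q -> 0 <= C ->
  (forall m i, Lq_on q C (u m i)) -> (forall m i j, Lq_on q C (d m i j)) ->
  (forall i, Lq_on q C (u0 i)) -> (forall i j, Lq_on q C (d0 i j)) ->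
  (forall m i, weak_gradient U (u m i) (d m i)) -> (forall i, weak_gradient U (u0 i) (d0 i)) ->
  (forall i (e : R), 0 < e -> \forall m \near \oo, (\int[mu]_x `|u m i x - u0 i x|%:E <= e%:E)%E) ->
  test_function U phi ->
  Rintegral mu setT ((fun x => phi x * jac (d m) J x) : T -> R) @[m --> \oo] -->
  Rintegral mu setT ((fun x => phi x * jac d0 J x) : T -> R).
Proof.
elim: k u d u0 d0 J phi => [|k IH] u d u0 d0 J phi kq C0 Lu Ld Lu0 Ld0 wd wd0 cu tphi.
  (* A minor of order 0 does not depend on its rows, so the sequence is constant. *)
  rewrite (_ : jac d0 J = jac (d 0%N) J); last first.
    by apply/funext => x; congr (\det _); apply/matrixP => -[].
  rewrite (_ : (fun m => _) = (fun=> Rintegral mu setT ((fun x => phi x * jac (d 0%N) J x) : T -> R))).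
    exact: cvg_cst.
  apply/funext => m; apply: eq_Rintegral => x _; congr (_ * \det _).
  by apply/matrixP => -[].
have Wm m i : W1k_on U k.+1 (u m i) (d m i).
  split; [exact: Lq_on_Lk_on (ltW kq) (Lu m i)| |exact: wd].
  by move=> j; exact: Lq_on_Lk_on (ltW kq) (Ld m i j).
have W0 i : W1k_on U k.+1 (u0 i) (d0 i).
  split; [exact: Lq_on_Lk_on (ltW kq) (Lu0 i)| |exact: wd0].
  by move=> j; exact: Lq_on_Lk_on (ltW kq) (Ld0 i j).
rewrite (weak_jacobianP oU bU J W0 tphi).
under eq_fun do rewrite (weak_jacobianP oU bU J (Wm _) tphi).
suff H : Rintegral mu setT ((fun x => u m ord0 x *
      jac (cons_row (grad phi) (fun i => d m (lift ord0 i))) J x) : T -> R) @[m --> \oo] -->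
    Rintegral mu setT ((fun x => u0 ord0 x *
      jac (cons_row (grad phi) (fun i => d0 (lift ord0 i))) J x) : T -> R).
  exact: cvgN H.
pose d' m i := d m (lift ord0 i); pose d0' i := d0 (lift ord0 i).
have k1q : k%:R < q by rewrite (le_lt_trans _ kq)// ler_nat.
have q1 : 1 < q by rewrite (le_lt_trans _ kq)// ler1n.
have Ld' m i j : Lk_on U k (d' m i j) := Lq_on_Lk_on_ord i (ltW k1q) (Ld m _ j).
have Ld0' i j : Lk_on U k (d0' i j) := Lq_on_Lk_on_ord i (ltW k1q) (Ld0 _ j).
apply: cvgr_approx => e e0; have e2 : 0 < e / 2%:R by rewrite divr_gt0.
have [delta delta0 Hdelta] := jac_row_small (ltW kq) C0 e2 tphi.
have [Lw0 Lg0 wg0] := W0 ord0.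
(* h approximates the first component of u0 in L^(k+1) and, by the strong convergence, that of u m
   for large m. With h in its place the induction hypothesis gives the convergence. *)
have [h [sh uh _]] := smooth_approximation oU bU Lw0 Lg0 wg0 tphi delta0.
have mh := smooth_measurable sh.
have mu0 : measurable_fun setT (u0 ord0 : T -> R) by case: Lw0.
have mum m : measurable_fun setT (u m ord0 : T -> R) by case: (Wm m ord0) => -[].
have Lv m : Lq_le mu q (2%:R `^ q * C + 2%:R `^ q * C) (fun x => u m ord0 x - u0 ord0 x).
  by apply: Lq_leB; [exact: q1|case: (Lu m ord0)|case: (Lu0 ord0)].
have C2 : 0 <= 2%:R `^ q * C + 2%:R `^ q * C by rewrite addr_ge0// mulr_ge0// powR_ge0.
have cv := @Lk_cvg_of_L1_Lq _ T R mu k q _ _ kq C2 Lv (cu ord0) _ delta0.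
pose row (v : 'rV[R]_n -> R) (D : 'I_k -> 'I_n -> 'rV[R]_n -> R) :=
  jac (cons_row (fun j x => v x * partial j phi x) D) J.
have rowE v D : (fun x => v x * jac (cons_row (grad phi) D) J x) = row v D.
  by apply/funext => x; rewrite /row jac_consZ.
have rowD v w D : row (fun x => v x + w x) D = fun x => row v D x + row w D x.
  apply/funext => x; rewrite /row -jac_consD; congr (jac (cons_row _ _) _ _).
  by apply/funext => j; apply/funext => y; rewrite mulrDl.
have close v D : measurable_fun setT (v : T -> R) -> (forall i j, Lq_on q C (D i j)) ->
    (\int[mu]_x (`|v x| ^+ k.+1)%:E <= delta%:E)%E -> _ := fun mv LD => Hdelta v D J mv LD.
have muh : measurable_fun setT ((fun x => u0 ord0 x - h x) : T -> R) by exact: measurable_funB.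
have [Ih0 Eh0] := jac_gradient_row J sh tphi Ld0'.
exists (fun m => Rintegral mu setT (row h (d' m) : T -> R)), (Rintegral mu setT (row h d0' : T -> R)); split.
- rewrite Eh0 (_ : (fun m => _) = (fun m => \sum_(c < k.+1) (-1) ^+ c *
    Rintegral mu setT ((fun x => (partial (J c) phi x * h x) *
    jac (d' m) (fun e => J (lift c e)) x) : T -> R))); last first.
    by apply/funext => m; have [_ ->] := jac_gradient_row J sh tphi (Ld' m).
  apply: cvg_sumr => c; apply: cvgMl_tmp.
  apply: (IH (fun m i => u m (lift ord0 i)) d' (fun i => u0 (lift ord0 i)) d0' _ _ k1q C0).
  + by move=> m i; exact: Lu.
  + by move=> m i j; exact: Ld.
  + by move=> i; exact: Lu0.
  + by move=> i j; exact: Ld0.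
  + by move=> m i; exact: wd.
  + by move=> i; exact: wd0.
  + by move=> i; exact: cu.
  + exact: (test_functionM (test_function_partial (J c) tphi) sh).
- apply: filterS cv => m cvm; rewrite rowE.
  have [Ihm _] := jac_gradient_row J sh tphi (Ld' m).
  have muv : measurable_fun setT ((fun x => u m ord0 x - u0 ord0 x) : T -> R) by exact: measurable_funB.
  have [i1 r1] := close _ (d' m) muv (fun i j => Ld m _ j) cvm.
  have [i2 r2] := close _ (d' m) muh (fun i j => Ld m _ j) (ltW uh).
  have -> : u m ord0 = (fun x => (u m ord0 x - u0 ord0 x) + (u0 ord0 x - h x) + h x).
    by apply/funext => x; rewrite subrKA subrK.
  rewrite rowD rowD (RintegralD measurableT (integrableD measurableT i1 i2) Ihm).
  rewrite (RintegralD measurableT i1 i2) addrK.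
  by rewrite (le_trans (ler_normD _ _))// [leRHS]splitr lerD.
- rewrite rowE.
  have [i2 r2] := close _ d0' muh (fun i j => Ld0 _ j) (ltW uh).
  have -> : u0 ord0 = (fun x => (u0 ord0 x - h x) + h x) by apply/funext => x; rewrite subrK.
  rewrite rowD (RintegralD measurableT i2 Ih0) addrK.
  by rewrite (le_trans r2)// [leRHS]splitr lerDl ltW.
Qed.

End minors_weak_continuity.

(** * Local weak differentials *)

Section zero_extension.
Context d (T : measurableType d) (R : realType) (mu : {measure set T -> \bar R}).
Implicit Types (U V : set T) (f g : T -> R).

Definition zext U g (x : T) : R := if x \in U then g x else 0.

Lemma zext_in U g x : U x -> zext U g x = g x.
Proof. by move=> Ux; rewrite /zext mem_set. Qed.

Lemma zext_out U g x : ~ U x -> zext U g x = 0.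
Proof. by move=> Ux; rewrite /zext memNset. Qed.

Lemma zext_zext U V g : V `<=` U -> zext V (zext U g) = zext V g.
Proof.
move=> VU; apply/funext => x; have [Vx|Vx] := pselect (V x); last by rewrite !zext_out.
by rewrite zext_in// zext_in ?zext_in//; exact: VU.
Qed.

Lemma zextM U g f : zext U (fun x => g x * f x) = fun x => zext U g x * f x.
Proof. by apply/funext => x; rewrite /zext; case: ifP => // _; rewrite mul0r. Qed.

Lemma zext_id U g : (forall x, ~ U x -> g x = 0) -> zext U g = g.
Proof.
move=> gU; apply/funext => x; have [Ux|Ux] := pselect (U x); first by rewrite zext_in.
by rewrite zext_out// gU.
Qed.

Lemma integral_zext U (F : T -> \bar R) (G : T -> \bar R) : measurable U ->
  (forall x, U x -> F x = G x) -> (forall x, ~ U x -> G x = 0%E) ->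
  (\int[mu]_(x in U) F x = \int[mu]_x G x)%E.
Proof.
move=> mU FG G0; rewrite integral_mkcond; apply: eq_integral => x _.
rewrite /patch; case: ifPn => [|xU]; first by rewrite inE; exact: FG.
by rewrite G0//; move: xU; rewrite notin_setE.
Qed.

Lemma Rintegral_zext U g : measurable U ->
  Rintegral mu U g = Rintegral mu setT (zext U g).
Proof.
move=> mU; congr fine; apply: integral_zext => // x Ux; first by rewrite zext_in.
by rewrite zext_out.
Qed.

Lemma measurable_zext U g : measurable U -> measurable_fun U g ->
  measurable_fun setT (zext U g).
Proof.
move=> mU mg; rewrite -(setUv U); apply/measurable_funU => //; first exact: measurableC.
split.
  by apply: eq_measurable_fun mg => x; rewrite inE => Ux; rewrite zext_in.
apply: (eq_measurable_fun (cst (0 : R))); last exact: measurable_cst.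
by move=> x; rewrite inE => Ux; rewrite zext_out.
Qed.

Lemma integrable_zext U g : measurable U -> measurable_fun U g ->
  (\int[mu]_(x in U) `|g x|%:E < +oo)%E -> mu.-integrable setT (EFin \o zext U g).
Proof.
move=> mU mg goo; apply/integrableP; split.
  by apply/measurable_EFinP; exact: measurable_zext.
apply: le_lt_trans goo; rewrite le_eqVlt; apply/orP; left; apply/eqP/esym.
apply: integral_zext => // x Ux; first by rewrite /= zext_in.
by rewrite /= zext_out// normr0.
Qed.

Lemma integrable_zextT U g : measurable U -> mu.-integrable setT (EFin \o g) ->
  mu.-integrable setT (EFin \o zext U g).
Proof.
move=> mU /[dup] /integrableP[/measurable_EFinP mg _] ig.
apply: integrable_zext => //; first exact: measurable_funTS.
by have /integrableP[] := integrableS measurableT mU (@subsetT _ U) ig.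
Qed.

End zero_extension.

Section weak_gradient_gluing.
Context {R : realType} {n : nat}.
Implicit Types (f g u phi rho : 'rV[R]_n -> R) (x y : 'rV[R]_n) (j : 'I_n).
Local Notation mu := (@lebesgue_rV R n).
Local Notation T := (@lebesgue_space R n).
Implicit Types (U V : set 'rV[R]_n).

Lemma weak_gradient_restrict U V u (d : 'I_n -> 'rV[R]_n -> R) : V `<=` U ->
  weak_gradient U u d ->
  weak_gradient V (zext (V : set T) u) (fun j => zext (V : set T) (d j)).
Proof.
move=> VU wd phi j tphi.
have tU : test_function U phi by case: tphi => a b c; split => //; exact: subset_trans VU.
have tp := test_function_partial j tphi.
have E (g psi : T -> R) : test_function V psi ->
    (fun x : T => zext (V : set T) g x * psi x) = (fun x => g x * psi x).
  move=> tpsi; apply/funext => x; have [Vx|Vx] := pselect (V x); first by rewrite zext_in.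
  by rewrite (test_function_out tpsi Vx) !mulr0.
by rewrite (E u _ tp) (E (d j) _ tphi); exact: wd.
Qed.

Lemma weak_gradient_unique U u (d d' : 'I_n -> 'rV[R]_n -> R) j : open U -> bounded_set U ->
  weak_gradient U u d -> weak_gradient U u d' ->
  mu.-integrable setT (EFin \o (d j : T -> R)) -> mu.-integrable setT (EFin \o (d' j : T -> R)) ->
  (forall x, ~ U x -> d j x = 0) -> (forall x, ~ U x -> d' j x = 0) ->
  {ae mu, forall x, d j x = d' j x}.
Proof.
move=> oU bU wd wd' id_ id' d0 d'0.
have H : {ae mu, forall x, d j x - d' j x = 0}.
  apply: (du_bois_reymond oU bU).
  - exact: (integrableB measurableT id_ id').
  - by move=> x Ux; rewrite d0// d'0// subr0.
  move=> phi tphi; have [M HM] := test_function_bounded tphi.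
  have mphi := smooth_measurable (test_function_smooth tphi).
  have i1 := integrable_mulr_bounded measurableT id_ mphi (fun x _ => HM x).
  have i2 := integrable_mulr_bounded measurableT id' mphi (fun x _ => HM x).
  rewrite (_ : (fun x : T => _) = (fun x => d j x * phi x - d' j x * phi x)); last first.
    by apply/funext => x; rewrite mulrBl.
  rewrite (RintegralB measurableT i1 i2).
  by apply/eqP; rewrite subr_eq0 -eqr_opp -(wd phi j tphi) -(wd' phi j tphi).
move: H; apply: (@filterS _ _ (ae_filter_ringOfSetsType mu)) => x /eqP.
by rewrite subr_eq0 => /eqP.
Qed.

Variable Omega : set 'rV[R]_n.
Hypotheses (oO : open Omega) (bO : bounded_set Omega).

Definition exhaustion (m : nat) : set 'rV[R]_n := inner_set Omega m.+1%:R^-1.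

Lemma open_exhaustion m : open (exhaustion m).
Proof. exact: open_inner_set. Qed.

Lemma exhaustion_sub m : exhaustion m `<=` Omega.
Proof. by apply: inner_set_sub. Qed.

Lemma exhaustion_homo (i m : nat) : (i <= m)%N -> exhaustion i `<=` exhaustion m.
Proof.
move=> im x; rewrite /exhaustion /inner_set /=; apply: le_lt_trans.
by rewrite lef_pV2 ?posrE// ler_nat ltnS.
Qed.

Lemma closure_exhaustion m : closure (exhaustion m) `<=` Omega.
Proof.
have cF := @closed_inner_radii_ge R n Omega m.+1%:R^-1.
apply: (@subset_trans _ [set x | m.+1%:R^-1 <= sup (inner_radii Omega x)]).
  rewrite [X in _ `<=` X](closure_id _).1//; apply: closureS => x.
  by rewrite /exhaustion /inner_set /= => /ltW.
move=> x /= h; apply: contrapT => /sup_inner_radii_eq0 h'.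
by move: h; rewrite h' leNgt invr_gt0 ltr0n.
Qed.

Lemma bounded_exhaustion m : bounded_set (exhaustion m).
Proof.
have [M [Mr HM]] := bO; exists M; split=> // t Mt x h; apply: HM Mt _ _.
exact: exhaustion_sub h.
Qed.

Lemma compact_closure_exhaustion m : compact (closure (exhaustion m)).
Proof.
apply: bounded_closed_compact; last exact: closed_closure.
have [M [Mr HM]] := bO; exists M; split=> // t Mt x h; apply: HM Mt _ _.
exact: closure_exhaustion h.
Qed.

Lemma compact_exhausted (K : set 'rV[R]_n) : compact K -> K `<=` Omega ->
  exists m, K `<=` exhaustion m.
Proof.
move=> cK KO; have [r r0 Hr] := compact_in_open cK oO KO.
(* The minimum with 1 matches the truncation of the distance at 1. *)
have r10 : 0 < Num.min r 1 by rewrite lt_min r0 ltr01.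
have [m _ /(_ m (leqnn m)) hm] := near_infty_natSinv_lt (PosNum r10).
exists m => x Kx; rewrite /exhaustion /inner_set /=; apply: lt_le_trans hm _ => /=.
apply: ub_le_sup; first by case: (inner_radii_sup Omega x).
split; first by rewrite ge_min lexx orbT andbT le_min (ltW r0) ler01.
by apply: subset_trans (Hr x Kx); apply: le_ball; rewrite ge_min lexx.
Qed.

Lemma bigcup_exhaustion : \bigcup_m exhaustion m = Omega.
Proof.
apply/seteqP; split => x; first by move=> [m _]; exact: exhaustion_sub.
move=> Ox; have xO : [set x] `<=` Omega by move=> y ->.
have [m Km] := compact_exhausted (@compact_set1 _ x) xO.
by exists m => //; exact: Km.
Qed.

(** At x the glued gradient is taken from the first member of the exhaustion that contains x. By
    uniqueness it agrees almost everywhere with each d m, since only countably many comparisons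
    occur. *)
Lemma weak_gradient_glue u (d : nat -> 'I_n -> 'rV[R]_n -> R) :
  (forall m j, mu.-integrable setT (EFin \o (d m j : T -> R))) ->
  (forall m j x, ~ exhaustion m x -> d m j x = 0) ->
  (forall m, weak_gradient (exhaustion m) (zext (exhaustion m : set T) u) (d m)) ->
  exists D : 'I_n -> 'rV[R]_n -> R, forall j, [/\ measurable_fun setT (D j : T -> R),
    forall x, ~ Omega x -> D j x = 0 &
    forall m, {ae mu, forall x, exhaustion m x -> D j x = d m j x}].
Proof.
move=> id_ dV wd; pose V m : set T := exhaustion m.
have mV m : measurable (V m) by apply: open_lebesgue_measurable; exact: open_exhaustion.
(* The sets [seqDU V m] are disjoint, so N x is the first index m with x in V m; the default 0 is
   taken off Omega, where every d m vanishes. *)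
pose N x := xget 0%N [set m | seqDU V m x].
have NE m x : seqDU V m x -> N x = m.
  move=> Vx; apply: xget_unique => // i Vi.
  by apply: (@trivIset_seqDU _ V i m I I); exists x.
have NV m x : V m x -> (N x <= m)%N /\ V (N x) x.
  move=> Vx; have [i im Vi] : (\bigcup_(i in [set i | (i <= m)%N]) seqDU V i) x.
    have : (\big[setU/set0]_(i < m.+1) seqDU V i) x.
      rewrite -bigsetU_seqDU; rewrite -bigcup_mkord; exists m => //=.
    by rewrite -bigcup_mkord => -[i /= im Vi]; exists i.
  by rewrite (NE _ _ Vi); split => //; exact: subset_seqDU Vi.
exists (fun j x => d (N x) j x) => j; split.
(* A countable measurable partition of the space: the complement of Omega comes first, and each
   later piece carries a single d i. *)
- pose E (i : nat) : set T := if i is i'.+1 then seqDU V i' else ~` Omega.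
  have mSD i : measurable (seqDU V i).
    by apply: measurableD => //; apply: bigsetU_measurable => l _.
  have mO : measurable (Omega : set T) by exact: open_lebesgue_measurable.
  have mE i : measurable (E i) by case: i => [|i] /=; [exact: measurableC|exact: mSD].
  have UE : \bigcup_i E i = setT.
    apply/seteqP; split => // x _; have [Ox|Ox] := pselect (Omega x); last by exists 0%N.
    move: Ox; rewrite -bigcup_exhaustion -/V seqDU_bigcup_eq => -[i _ Vi].
    by exists i.+1.
  rewrite -UE; apply/(measurable_fun_bigcup _ mE) => -[|i] /=.
    apply: (eq_measurable_fun (cst (0 : R))); last exact: measurable_cst.
    move=> x; rewrite inE => Ox; rewrite dV// => Vx; apply: Ox.
    exact: exhaustion_sub Vx.
  apply: (eq_measurable_fun (d i j : T -> R)); first by move=> x; rewrite inE => /NE ->.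
  by have /integrableP[/measurable_EFinP mdi _] := id_ i j; exact: measurable_funTS.
- by move=> x Ox; apply: dV => Vx; apply: Ox; exact: exhaustion_sub Vx.
move=> m.
(* On the smaller set both d i and the restriction of d m are weak gradients of u, hence equal
   almost everywhere. *)
have key i : {ae mu, forall x, (i <= m)%N -> V i x -> d i j x = d m j x}.
  have [im|im] := boolP (i <= m)%N; last by apply: aeW.
  have iz : mu.-integrable setT (EFin \o zext (V i) (d m j)).
    exact: (integrable_zextT (mV i) (id_ m j)).
  have w1 := weak_gradient_restrict (exhaustion_homo im) (wd m).
  rewrite zext_zext in w1; last exact: exhaustion_homo.
  have := @weak_gradient_unique _ _ (d i) (fun j => zext (V i) (d m j)) j (@open_exhaustion i)
    (@bounded_exhaustion i) (wd i) w1 (id_ i j) iz (dV i j) _.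
  move=> /(_ (fun x => @zext_out _ T R (V i) (d m j) x)).
  by apply: (@filterS _ _ (ae_filter_ringOfSetsType mu)) => x + _ Vx; rewrite zext_in.
have /ae_foralln := key; apply: (@filterS _ _ (ae_filter_ringOfSetsType mu)) => x H Vx.
by have [Nm VN] := NV _ _ Vx; exact: H.
Qed.

End weak_gradient_gluing.

(** * From grand norms to L^q bounds *)

Section powR_ereal.
Context {R : realType}.

Lemma poweR_le_inv (x : \bar R) (q M : R) : 0 < q -> (0 <= x)%E -> 0 <= M ->
  (x `^ q^-1 <= M%:E)%E -> (x <= (M `^ q)%:E)%E.
Proof.
move=> q0 x0 M0 H; rewrite -poweR_EFin.
have -> : x = ((x `^ q^-1) `^ q)%E by rewrite -poweRrM mulVf ?gt_eqF// poweRe1.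
by apply: gt0_ler_poweR; rewrite ?in_itv/= ?leey ?andbT ?poweR_ge0 ?lee_fin ?(ltW q0).
Qed.

Lemma normr_le_euclidean_norm (I : finType) (v : I -> R) i : `|v i| <= euclidean_norm v.
Proof.
rewrite /euclidean_norm -sqrtr_sqr ler_wsqrtr// (bigD1 i)//= lerDl.
by apply: sumr_ge0 => j _; exact: sqr_ge0.
Qed.

Lemma euclidean_norm_ge0 (I : finType) (v : I -> R) : 0 <= euclidean_norm v.
Proof. exact: sqrtr_ge0. Qed.

Lemma measurable_euclidean_norm d (T : measurableType d) (I : finType) (U : set T)
    (g : T -> I -> R) : (forall i, measurable_fun U (g ^~ i)) ->
  measurable_fun U (fun x => euclidean_norm (g x)).
Proof.
move=> mg; apply: measurableT_comp.
  by apply: continuous_measurable_fun; exact: sqrt_continuous.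
by apply: measurable_sum => i; apply: measurable_funX.
Qed.

End powR_ereal.

Section integral_euclidean_norm.
Context d (T : measurableType d) (R : realType) (mu : {measure set T -> \bar R}).

Lemma measurable_powR_euclidean_norm (I : finType) (V : set T) (g : T -> I -> R) (q : R) :
  (forall i, measurable_fun V (g ^~ i)) ->
  measurable_fun V (fun x => (euclidean_norm (g x) `^ q)%:E).
Proof.
move=> mg; apply/measurable_EFinP; apply: (measurableT_comp (measurable_powR _)).
exact: measurable_euclidean_norm.
Qed.

Lemma integral_zext_powR_le (I : finType) (V : set T) (g : T -> I -> R) (q : R) i :
  0 < q -> measurable V -> (forall i, measurable_fun V (g ^~ i)) ->
  (\int[mu]_x (`|zext V (g ^~ i) x| `^ q)%:E <=
   \int[mu]_(x in V) (euclidean_norm (g x) `^ q)%:E)%E.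
Proof.
move=> q0 mV mg; rewrite -(@integral_zext _ T R mu V (fun x => (`|g x i| `^ q)%:E))//; last 2 first.
- by move=> x Vx; rewrite zext_in.
- by move=> x Vx; rewrite zext_out// normr0 powR0// gt_eqF.
apply: ge0_le_integral => //.
- apply/measurable_EFinP; apply: (measurableT_comp (measurable_powR _)).
  by apply: measurableT_comp => //; exact: mg.
- exact: measurable_powR_euclidean_norm.
move=> x _; rewrite lee_fin ge0_ler_powR ?nnegrE ?euclidean_norm_ge0 ?(ltW q0)//.
exact: normr_le_euclidean_norm.
Qed.

End integral_euclidean_norm.

Section grand_norms.
Context {R : realType} {n : nat}.
Local Notation mu := (@lebesgue_rV R n).
Local Notation T := (@lebesgue_space R n).
Implicit Types (U V : set 'rV[R]_n).

Lemma grand_norm_integral_le (I : finType) V (p q M : R) (delta : R -> R)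
    (g : 'rV[R]_n -> I -> R) :
  open V -> bounded_set V -> V !=set0 -> admissible p delta -> 1 < q -> q < p -> 0 <= M ->
  (grand_norm V p delta g <= M%:E)%E ->
  (\int[mu]_(x in V) (euclidean_norm (g x) `^ q)%:E <=
    (M `^ q * (fine (mu V) / delta (p - q)))%:E)%E.
Proof.
move=> oV bV V0 adm q1 qp M0 gM.
have q0 : 0 < q by apply: lt_trans q1.
have pq : p - q \in `]0, p - 1[ by rewrite in_itv/= subr_gt0 qp/=; lra.
have /andP[d0 d1] := admissible_range adm pq.
have fV : (mu V \is a fin_num)%E by rewrite ge0_fin_numE//; exact: lebesgue_rV_bounded.
have V1 : 0 < fine (mu V) by rewrite -lte_fin fineK//; exact: lebesgue_rV_open_gt0.
have c0 : 0 < delta (p - q) / fine (mu V) by rewrite divr_gt0.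
have H : ((((delta (p - q) / fine (mu V))%:E *
      \int[mu]_(x in V) (euclidean_norm (g x) `^ q)%:E) `^ q^-1)%E <= M%:E)%E.
  apply: le_trans gM; apply: ereal_sup_ubound; exists (p - q) => //=.
  by rewrite subKr.
have I0 : (0 <= \int[mu]_(x in V) (euclidean_norm (g x) `^ q)%:E)%E.
  by apply: integral_ge0 => x _; rewrite lee_fin powR_ge0.
move: (\int[mu]_(x in V) (euclidean_norm (g x) `^ q)%:E)%E I0 H => J J0.
move=> /poweR_le_inv H; have {H} := H q0 _ M0.
rewrite mule_ge0 ?lee_fin ?(ltW c0)// => /(_ isT).
move=> Jle; rewrite (_ : M `^ q * _ = (delta (p - q) / fine (mu V))^-1 * M `^ q); last first.
  by rewrite invf_div mulrC.
by rewrite EFinM lee_pdivlMl.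
Qed.

Lemma grand_norm_Lq_on (I : finType) V (p q M : R) (delta : R -> R)
    (g : 'rV[R]_n -> I -> R) :
  open V -> bounded_set V -> V !=set0 -> admissible p delta -> 1 < q -> q < p -> 0 <= M ->
  grand_lebesgue V p delta g -> (grand_norm V p delta g <= M%:E)%E ->
  forall i, Lq_on V q (M `^ q * (fine (mu V) / delta (p - q))) (zext (V : set T) (g ^~ i)).
Proof.
move=> oV bV V0 adm q1 qp M0 [mg _] gM i.
have mV : measurable (V : set T) by exact: open_lebesgue_measurable.
have q0 : 0 < q by apply: lt_trans q1.
have mz : measurable_fun setT (zext (V : set T) (g ^~ i)) by exact: measurable_zext (mg i).
split; last by move=> x; exact: zext_out.
split => //.
apply: le_trans (grand_norm_integral_le oV bV V0 adm q1 qp M0 gM).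
exact: (@integral_zext_powR_le _ T R mu I V g q i q0 mV mg).
Qed.

End grand_norms.

Section almost_everywhere_integrals.
Context d (T : measurableType d) (R : realType) (mu : {measure set T -> \bar R}).
Implicit Types (U V K : set T) (f g : T -> R).

Lemma Rintegral_pair_zext U V g f : measurable U -> V `<=` U -> (forall x, ~ V x -> f x = 0) ->
  Rintegral mu U (fun x => g x * f x) = Rintegral mu setT (fun x => zext V g x * f x).
Proof.
move=> mU VU f0; rewrite Rintegral_zext//; apply: eq_Rintegral => x _.
have [Vx|Vx] := pselect (V x); first by rewrite /zext (mem_set Vx) (mem_set (VU _ Vx)).
by rewrite f0// mulr0 /zext; case: ifP; rewrite ?f0 ?mulr0.
Qed.

Lemma Rintegral_ae_eq f g : measurable_fun setT f -> measurable_fun setT g ->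
  {ae mu, forall x, f x = g x} -> Rintegral mu setT f = Rintegral mu setT g.
Proof.
move=> mf mg fg; congr fine; apply: ae_eq_integral => //; try exact/measurable_EFinP.
by move: fg; apply: filterS => x /= ->.
Qed.

Lemma integral_ae_eq_norm K V f g : measurable K -> K `<=` V -> measurable_fun setT f ->
  measurable_fun setT g -> {ae mu, forall x, V x -> f x = g x} ->
  (\int[mu]_(x in K) `|f x|%:E = \int[mu]_(x in K) `|g x|%:E)%E.
Proof.
move=> mK KV mf mg fg; apply: ae_eq_integral => //.
- by apply: measurable_funTS; apply/measurable_EFinP; exact: measurableT_comp.
- by apply: measurable_funTS; apply/measurable_EFinP; exact: measurableT_comp.
- by move: fg; apply: filterS => x /= h /KV/h ->.
Qed.

Lemma integrable_fin_on K g : measurable K -> mu.-integrable setT (EFin \o g) ->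
  (\int[mu]_(x in K) `|g x|%:E < +oo)%E.
Proof.
by move=> mK ig; have /integrableP[] := integrableS measurableT mK (@subsetT _ K) ig.
Qed.

Lemma integrable_zext_sub U K V g : measurable U -> measurable K -> measurable V ->
  V `<=` K -> K `<=` U -> measurable_fun U g -> (\int[mu]_(x in K) `|g x|%:E < +oo)%E ->
  mu.-integrable setT (EFin \o zext V g).
Proof.
move=> mU mK mV VK KU mg goo.
have mgK : measurable_fun K g by exact: measurable_funS mg.
apply: integrable_zext => //; first exact: measurable_funS mgK.
apply: le_lt_trans goo; apply: ge0_subset_integral => //.
by apply/measurable_EFinP; exact: measurableT_comp.
Qed.

Lemma Lq_le_ae_eq (q C : R) f g : measurable_fun setT g ->
  {ae mu, forall x, f x = g x} -> Lq_le mu q C f -> Lq_le mu q C g.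
Proof.
move=> mg fg [mf fC]; split; first exact: mg.
apply: le_trans fC.
rewrite le_eqVlt; apply/orP; left; apply/eqP/esym; apply: ae_eq_integral => //.
- exact: measurable_powR_norm.
- exact: measurable_powR_norm.
- by move: fg; apply: filterS => x /= ->.
Qed.

End almost_everywhere_integrals.

Section weak_differentials.
Context {R : realType} {n k : nat}.
Local Notation mu := (@lebesgue_rV R n).
Local Notation T := (@lebesgue_space R n).
Implicit Types (U V : set 'rV[R]_n) (f : 'rV[R]_n -> 'rV[R]_k) (D : 'rV[R]_n -> 'M[R]_(k, n)).

Lemma weak_diffP U f : weakly_differentiable U f -> is_weak_diff U f (weak_diff U f).
Proof. by move=> H; apply: (@xgetPex _ _ [set D | is_weak_diff U f D]). Qed.

Lemma is_weak_diff_gradient U V f D i : open U -> is_weak_diff U f D -> V `<=` U ->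
  weak_gradient V (zext (V : set T) (fun x => f x 0 i))
    (fun j => zext (V : set T) (fun x => D x i j)).
Proof.
move=> oU [_ _ fD] VU phi j tphi.
have mU : measurable (U : set T) by exact: open_lebesgue_measurable.
have tU : test_function U phi by case: tphi => a b c; split => //; exact: subset_trans VU.
have := fD i j phi tU; rewrite /Rintegral_rV.
rewrite (@Rintegral_pair_zext _ T R mu U V (fun x => f x 0 i) (partial j phi) mU VU); last first.
  by move=> x Vx; exact: test_function_out (test_function_partial j tphi) Vx.
rewrite (@Rintegral_pair_zext _ T R mu U V (fun x => D x i j) phi mU VU)//.
by move=> x Vx; exact: test_function_out tphi Vx.
Qed.

Lemma locally_integrable_zext U V (g : 'rV[R]_n -> R) : open U -> locally_integrable_rV U g -> open V ->
  compact (closure V) -> closure V `<=` U ->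
  mu.-integrable setT (EFin \o (zext (V : set T) g : T -> R)).
Proof.
move=> oU [mg ig] oV cV VU; have mV : measurable (V : set T) by exact: open_lebesgue_measurable.
have mcV : measurable (closure V : set T) by apply: compact_lebesgue_measurable.
have mU : measurable (U : set T) by exact: open_lebesgue_measurable.
exact: (@integrable_zext_sub _ T R mu U (closure V) V g mU mcV mV (@subset_closure _ V) VU mg (ig _ cV VU)).
Qed.

(** [weak_diff] is chosen separately on each set, so its representatives for U and for a smaller V
    can be compared only almost everywhere; this is the comparison. *)
Lemma is_weak_diff_ae_unique U V f D D' i j : open U -> open V -> bounded_set U -> V `<=` U ->
  is_weak_diff U f D -> is_weak_diff V f D' ->
  mu.-integrable setT (EFin \o (zext (V : set T) (fun x => D x i j) : T -> R)) ->
  mu.-integrable setT (EFin \o (zext (V : set T) (fun x => D' x i j) : T -> R)) ->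
  {ae mu, forall x, zext (V : set T) (fun x => D x i j) x = zext (V : set T) (fun x => D' x i j) x}.
Proof.
move=> oU oV bU VU fD fD' iD iD'.
have bV : bounded_set V by have [M [Mr HM]] := bU; exists M; split=> // t Mt x Vx; apply: HM Mt _ _; exact: VU.
have w1 := is_weak_diff_gradient i oU fD VU.
have w2 := is_weak_diff_gradient i oV fD' (@subset_refl _ V).
by apply: (weak_gradient_unique oV bV w1 w2) => // x Vx; exact: zext_out.
Qed.

(** The support of a test function on Omega is compact, so it lies in one member of the exhaustion,
    and the identity needs only the gradient given there. *)
Lemma weakly_differentiable_glue (Omega : set 'rV[R]_n) f : open Omega -> bounded_set Omega ->
  (forall i, locally_integrable_rV Omega (fun x => f x 0 i)) ->
  (forall i m, exists d : 'I_n -> 'rV[R]_n -> R,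
    [/\ forall j, mu.-integrable setT (EFin \o (d j : T -> R)),
      forall j x, ~ exhaustion Omega m x -> d j x = 0 &
      weak_gradient (exhaustion Omega m)
        (zext (exhaustion Omega m : set T) (fun x => f x 0 i)) d]) ->
  weakly_differentiable Omega f.
Proof.
move=> oO bO lf H.
have {H} /choice[D HD] : forall i, exists D : 'I_n -> 'rV[R]_n -> R, forall j,
  [/\ measurable_fun setT (D j : T -> R), forall x, ~ Omega x -> D j x = 0 &
    forall m, exists dm : 'rV[R]_n -> R, [/\ mu.-integrable setT (EFin \o (dm : T -> R)),
      forall x, ~ exhaustion Omega m x -> dm x = 0,
      {ae mu, forall x, exhaustion Omega m x -> D j x = dm x} &
      forall phi, test_function (exhaustion Omega m) phi ->
      Rintegral mu setT ((fun x => zext (exhaustion Omega m : set T) (fun x => f x 0 i) x * partial j phi x) : T -> R) =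
      - Rintegral mu setT ((fun x => dm x * phi x) : T -> R)]].
  move=> i; have /choice[d Hd] := H i.
  have [D HD] := @weak_gradient_glue R n Omega oO bO (fun x => f x 0 i) d
    (fun m j => let: And3 h _ _ := Hd m in h j) (fun m j => let: And3 _ h _ := Hd m in h j)
    (fun m => let: And3 _ _ h := Hd m in h).
  exists D => j; have [mD D0 Dae] := HD j; split => // m; exists (d m j).
  by have [h1 h2 h3] := Hd m; split => [||//|phi]; [exact: h1|exact: h2|exact: h3].
have mO : measurable (Omega : set T) by exact: open_lebesgue_measurable.
exists (fun x => \matrix_(i, j) D i j x); split=> //.
- move=> i j; rewrite (_ : (fun x => _) = D i j); last by apply/funext => x; rewrite mxE.
  have [mD D0 Dae] := HD i j; split; first exact: measurable_funTS.
  move=> K cK KO; have [m Km] := compact_exhausted oO cK KO.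
  have [dm [idm dm0 aem _]] := Dae m.
  have mK : measurable (K : set T) by apply: compact_lebesgue_measurable.
  have mdm : measurable_fun setT (dm : T -> R) by have /integrableP[/measurable_EFinP] := idm.
  rewrite /integral_rV (@integral_ae_eq_norm _ T R mu K _ _ dm mK Km mD mdm aem).
  exact: (@integrable_fin_on _ T R mu K dm mK idm).
move=> i j phi tphi; have [mD D0 Dae] := HD i j.
have [sphi cphi suppO] := tphi; have [m Km] := compact_exhausted oO cphi suppO.
have tm : test_function (exhaustion Omega m) phi by split.
have [dm [idm dm0 aem wm]] := Dae m.
have mdm : measurable_fun setT (dm : T -> R) by have /integrableP[/measurable_EFinP] := idm.
have mphi := smooth_measurable sphi.
rewrite /Rintegral_rV.
rewrite (@Rintegral_pair_zext _ T R mu Omega (exhaustion Omega m) (fun x => f x 0 i)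
  (partial j phi) mO (@exhaustion_sub _ _ _ m)); last first.
  by move=> x; exact: test_function_out (test_function_partial j tm).
rewrite (wm _ tm); congr (- _).
rewrite (_ : (fun x : T => (\matrix_(i, j) D i j x) i j * phi x) = (fun x => D i j x * phi x)); last first.
  by apply/funext => x; rewrite mxE.
rewrite [RHS]Rintegral_zext// zextM zext_id//.
apply: (@Rintegral_ae_eq _ T R mu); [exact: (measurable_funM mdm mphi)|exact: (measurable_funM mD mphi)|].
move: aem; apply: (@filterS _ _ (ae_filter_ringOfSetsType mu)) => x h.
have [Vx|Vx] := pselect (exhaustion Omega m x); first by rewrite h.
by rewrite (test_function_out tm Vx) !mulr0.
Qed.

End weak_differentials.

Section local_bounds.
Context {R : realType} {n k : nat}.
Local Notation mu := (@lebesgue_rV R n).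
Local Notation T := (@lebesgue_space R n).
Implicit Types (U V : set 'rV[R]_n).
Variables (Omega : set 'rV[R]_n) (p : R) (delta : R -> R).
Variable f : nat -> 'rV[R]_n -> 'rV[R]_k.
Hypotheses (oO : open Omega) (bO : bounded_set Omega) (adm : admissible p delta).
Hypothesis lf : forall m i, locally_integrable_rV Omega (fun x => f m x 0 i).
Hypothesis bf : locally_bounded_grand_sobolev Omega p delta f.
Variable q : R.
Hypotheses (q1 : 1 < q) (qp : q < p).

Lemma grand_norm_ge0 (I : finType) V (g : 'rV[R]_n -> I -> R) :
  (0 <= grand_norm V p delta g)%E.
Proof.
(* The supremum of the empty set would be -oo; one parameter, here (p - 1) / 2, yields a nonnegative
   term. *)
have p2 : (p - 1) / 2 \in `]0, p - 1[ by rewrite in_itv/=; apply/andP; split; move: q1 qp; lra.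
apply: (le_trans _ (ereal_sup_ubound _)); last by exists ((p - 1) / 2).
exact: poweR_ge0.
Qed.

Lemma compactly_inside_bounded V : compactly_inside V Omega -> bounded_set V.
Proof.
move=> [_ _ _ VO]; have [M [Mr HM]] := bO; exists M; split=> // t Mt x Vx.
by apply: HM Mt _ _; apply: VO; exact: subset_closure.
Qed.

Lemma compactly_inside_sub V : compactly_inside V Omega -> V `<=` Omega.
Proof. by move=> [_ _ _ VO]; exact: subset_trans (@subset_closure _ V) VO. Qed.

Lemma local_Lq_bounds V : compactly_inside V Omega -> exists2 C : R, 0 <= C & forall m,
  [/\ weakly_differentiable V (f m), forall i, Lq_on V q C (zext (V : set T) (fun x => f m x 0 i)) &
    forall i j, Lq_on V q C (zext (V : set T) (fun x => weak_diff V (f m) x i j))].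
Proof.
move=> cV; have [M HM] := bf cV; have bV := compactly_inside_bounded cV.
have [oV V0 _ _] := cV.
have pq : p - q \in `]0, p - 1[ by rewrite in_itv/= subr_gt0 qp/=; move: q1; lra.
have /andP[d0 _] := admissible_range adm pq.
exists (`|M| `^ q * (fine (mu V) / delta (p - q))).
  by rewrite mulr_ge0 ?powR_ge0// divr_ge0 ?fine_ge0// ltW.
move=> m; have [[wf gf gd] nM] := HM m.
have leM (a b : \bar R) : (0 <= a)%E -> (0 <= b)%E -> (a + b <= M%:E)%E -> (a <= `|M|%:E)%E /\ (b <= `|M|%:E)%E.
  move=> a0 b0 abM; have MM : (M%:E <= `|M|%:E)%E by rewrite lee_fin ler_norm.
  by split; apply: le_trans MM; apply: le_trans abM; [rewrite leeDl|rewrite leeDr].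
have [h1 h2] := leM _ _ (grand_norm_ge0 _ _) (grand_norm_ge0 _ _) nM.
split; first exact: wf.
- move=> i; exact: (grand_norm_Lq_on oV bV V0 adm q1 qp (normr_ge0 M) gf h1 (ord0, i)).
- move=> i j; exact: (grand_norm_Lq_on oV bV V0 adm q1 qp (normr_ge0 M) gd h2 (i, j)).
Qed.

Lemma exhaustion_compactly_inside m : exhaustion Omega m !=set0 ->
  compactly_inside (exhaustion Omega m) Omega.
Proof.
move=> V0; split=> //; [exact: open_exhaustion|exact: compact_closure_exhaustion|].
exact: closure_exhaustion.
Qed.

(** Early members of the exhaustion can be empty, whereas [compactly_inside] asks for a nonempty
    set; this settles that case. *)
Lemma weak_gradient_set0 u d : @weak_gradient R n set0 u d.
Proof.
move=> phi j tphi.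
have phi0 x : phi x = 0 by apply: (test_function_out tphi).
have dphi0 x : partial j phi x = 0 by apply: (test_function_out (test_function_partial j tphi)).
have -> : (fun x => u x * partial j phi x) = cst 0 by apply/funext => x; rewrite dphi0 mulr0.
have -> : (fun x => d j x * phi x) = cst 0 by apply/funext => x; rewrite phi0 mulr0.
by rewrite /Rintegral integral0 oppr0.
Qed.

Lemma zext_set0 (g : T -> R) : zext set0 g = cst 0.
Proof. by apply/funext => x; rewrite zext_out. Qed.

Lemma weakly_differentiable_bounded m : weakly_differentiable Omega (f m).
Proof.
apply: weakly_differentiable_glue => // i l.
have [V0|/set0P V0] := eqVneq (exhaustion Omega l) set0.
  exists (fun _ => cst 0); split=> //; first by move=> j; exact: integrable0.
  by rewrite V0; exact: weak_gradient_set0.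
have cV := exhaustion_compactly_inside V0.
have [C C0 /(_ m)[wV Lf Ld]] := local_Lq_bounds cV; have [oV _ _ _] := cV.
exists (fun j => zext (exhaustion Omega l : set T) (fun x => weak_diff (exhaustion Omega l) (f m) x i j)).
split.
- move=> j; have [h1 h2] := Ld i j.
  apply: (@Lq_le_integrable _ T R mu (exhaustion Omega l) _ _ q C) => //; last exact: ltW.
    exact: open_lebesgue_measurable.
  by apply: lebesgue_rV_bounded; exact: compactly_inside_bounded.
- by move=> j x; exact: zext_out.
exact: is_weak_diff_gradient oV (weak_diffP wV) (@subset_refl _ _).
Qed.

Lemma weak_diff_ae_local V m i j : compactly_inside V Omega -> weakly_differentiable V (f m) ->
  mu.-integrable setT (EFin \o (zext (V : set T) (fun x => weak_diff V (f m) x i j) : T -> R)) ->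
  {ae mu, forall x, zext (V : set T) (fun x => weak_diff Omega (f m) x i j) x =
                    zext (V : set T) (fun x => weak_diff V (f m) x i j) x}.
Proof.
move=> cV wV iV; have [oV _ cc VO] := cV.
have wO := weak_diffP (weakly_differentiable_bounded m).
apply: (is_weak_diff_ae_unique oO oV bO (compactly_inside_sub cV) wO (weak_diffP wV) _ iV).
by have [_ h _] := wO; exact: (locally_integrable_zext oO (h i j) oV cc VO).
Qed.

(** Carries the bounds from [weak_diff V (f m)], which the hypothesis controls, to
    [weak_diff Omega (f m)], on which the forms are built. *)
Lemma local_weak_diff_Lq_bounds l : exists2 C : R, 0 <= C & forall m i,
  let V := exhaustion Omega l in
  [/\ Lq_on V q C (zext (V : set T) (fun x => f m x 0 i)),
    forall j, Lq_on V q C (zext (V : set T) (fun x => weak_diff Omega (f m) x i j)) &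
    weak_gradient V (zext (V : set T) (fun x => f m x 0 i))
      (fun j => zext (V : set T) (fun x => weak_diff Omega (f m) x i j))].
Proof.
have [V0|/set0P V0] := eqVneq (exhaustion Omega l) set0.
  exists 0; first exact: lexx.
  move=> m i; rewrite V0.
  have L0 : Lq_on set0 q 0 (cst 0 : 'rV[R]_n -> R).
    split=> //; split => //; under eq_integral do rewrite normr0 powR0 ?gt_eqF ?(lt_trans _ q1)//.
    by rewrite integral0.
  by split; [rewrite zext_set0|move=> j; rewrite zext_set0|exact: weak_gradient_set0].
have cV := exhaustion_compactly_inside V0.
have [C C0 HC] := local_Lq_bounds cV; have [oV _ cc VO] := cV.
have mV : measurable (exhaustion Omega l : set T) by exact: open_lebesgue_measurable.
have bV : (mu (exhaustion Omega l) < +oo)%E.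
  by apply: lebesgue_rV_bounded; exact: compactly_inside_bounded.
exists C; first exact: C0.
move=> m i V; have [wV Lf Ld] := HC m.
have wO := weak_diffP (weakly_differentiable_bounded m).
split.
- exact: Lf.
- move=> j; split; last by move=> x; exact: zext_out.
  have [h1 h2] := Ld i j.
  have iV := @Lq_le_integrable _ T R mu V mV bV q C _ (ltW q1) h1 h2.
  have ae1 := weak_diff_ae_local cV wV iV.
  have iO : mu.-integrable setT (EFin \o (zext (V : set T) (fun x => weak_diff Omega (f m) x i j) : T -> R)).
    by have [_ h _] := wO; exact: (locally_integrable_zext oO (h i j) oV cc VO).
  have mO : measurable_fun setT (zext (V : set T) (fun x => weak_diff Omega (f m) x i j) : T -> R).
    by have /integrableP[/measurable_EFinP] := iO.
  apply: (@Lq_le_ae_eq _ T R mu q C _ _ mO _ h1).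
  by move: ae1; apply: (@filterS _ _ (ae_filter_ringOfSetsType mu)) => x ->.
exact: is_weak_diff_gradient oO wO (compactly_inside_sub cV).
Qed.

End local_bounds.

Section L1_pairing.
Context d (T : measurableType d) (R : realType) (mu : {measure set T -> \bar R}).

Lemma L1_pairing_cvg (v : nat -> T -> R) (v0 chi : T -> R) (M : R) :
  (forall m, mu.-integrable setT (EFin \o v m)) -> mu.-integrable setT (EFin \o v0) ->
  (forall e : R, 0 < e -> \forall m \near \oo, (\int[mu]_x `|v m x - v0 x|%:E <= e%:E)%E) ->
  measurable_fun setT chi -> (forall x, `|chi x| <= M) ->
  Rintegral mu setT (fun x => v m x * chi x) @[m --> \oo] -->
  Rintegral mu setT (fun x => v0 x * chi x).
Proof.
move=> iv iv0 cv mc cM; apply/cvgrPdist_le => e e0.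
have M1 : 0 < `|M| + 1 by rewrite ltr_wpDl.
have eM : 0 < e / (`|M| + 1) by rewrite divr_gt0.
have := cv _ eM; apply: filterS => m vm.
have i1 := integrable_mulr_bounded measurableT (iv m) mc (fun x _ => cM x).
have i0 := integrable_mulr_bounded measurableT iv0 mc (fun x _ => cM x).
have mv : measurable_fun setT (v m) by have /integrableP[/measurable_EFinP] := iv m.
have mv0 : measurable_fun setT v0 by have /integrableP[/measurable_EFinP] := iv0.
have mB := measurable_funB mv mv0.
rewrite distrC -(RintegralB measurableT i1 i0).
have := @normr_Rintegral_le_combination _ T R mu (fun x => v m x * chi x - v0 x * chi x)
  (fun x => `|v m x - v0 x|) (cst 0) (e / (`|M| + 1)) 0 (`|M| + 1) 0.
have -> : (`|M| + 1) * (e / (`|M| + 1)) + 0 * 0 = e by rewrite mul0r addr0 mulrC divfK// gt_eqF.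
move=> H.
have mf : measurable_fun setT (fun x => v m x * chi x - v0 x * chi x).
  by apply: measurable_funB; exact: measurable_funM.
have I0 : (\int[mu]_x (cst (0 : R) x)%:E <= 0)%E by rewrite integral0.
have ma : measurable_fun setT (fun x => `|v m x - v0 x|) by exact: measurableT_comp.
have fab x : `|v m x * chi x - v0 x * chi x| <= (`|M| + 1) * `|v m x - v0 x| + 0 * cst 0 x.
  rewrite mul0r addr0 -mulrBl normrM mulrC ler_wpM2r//.
  by rewrite (le_trans (cM x))// (le_trans (ler_norm _))// lerDl.
have := H mf ma (measurable_cst _) (ltW M1) (lexx _) (fun x => normr_ge0 _) (fun x => lexx _) fab vm I0.
by move=> /(normr_Rintegral_le mf)[].
Qed.

End L1_pairing.

Section euclidean_L1.
Context d (T : measurableType d) (R : realType) (mu : {measure set T -> \bar R}).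

Lemma integral_zextB_le (I : finType) (V K : set T) (g h : T -> I -> R) i :
  measurable V -> measurable K -> V `<=` K ->
  (forall i, measurable_fun K (fun x => g x i - h x i)) ->
  (\int[mu]_x `|zext V (g ^~ i) x - zext V (h ^~ i) x|%:E <=
   \int[mu]_(x in K) (euclidean_norm (fun i => g x i - h x i))%:E)%E.
Proof.
move=> mV mK VK mB; rewrite -(@integral_zext _ T R mu V (fun x => `|g x i - h x i|%:E))//; last 2 first.
- by move=> x Vx; rewrite !zext_in.
- by move=> x Vx; rewrite !zext_out// subrr normr0.
apply: (@le_trans _ _ (\int[mu]_(x in K) `|g x i - h x i|%:E)%E).
  apply: ge0_subset_integral => //.
  by apply/measurable_EFinP; apply: measurableT_comp => //; exact: mB.
apply: ge0_le_integral => //.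
- by apply/measurable_EFinP; apply: measurableT_comp => //; exact: mB.
- by apply/measurable_EFinP; exact: (measurable_euclidean_norm (g := fun x i => g x i - h x i)).
- by move=> x _; rewrite lee_fin; exact: (normr_le_euclidean_norm (fun i => g x i - h x i) i).
Qed.

End euclidean_L1.

(** * Weak differentiability of the limit map *)

Section limit_map.
Context {R : realType} {n k : nat}.
Local Notation mu := (@lebesgue_rV R n).
Local Notation T := (@lebesgue_space R n).
Implicit Types (U V : set 'rV[R]_n).
Variables (Omega : set 'rV[R]_n) (p : R) (delta : R -> R).
Variables (f : nat -> 'rV[R]_n -> 'rV[R]_k) (f0 : 'rV[R]_n -> 'rV[R]_k).
Hypotheses (oO : open Omega) (bO : bounded_set Omega) (adm : admissible p delta).
Hypothesis bf : locally_bounded_grand_sobolev Omega p delta f.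
Hypothesis cf : cvg_L1loc Omega f f0.
Variable q : R.
Hypotheses (q1 : 1 < q) (qp : q < p).

Let lf : forall m i, locally_integrable_rV Omega (fun x => f m x 0 i).
Proof. by case: cf. Qed.

Let lf0 : forall i, locally_integrable_rV Omega (fun x => f0 x 0 i).
Proof. by case: cf. Qed.

Let mO : measurable (Omega : set T). Proof. exact: open_lebesgue_measurable. Qed.

(** The closure of a member of the exhaustion is a compact subset of Omega, to which the assumed
    convergence applies. *)
Lemma exhaustion_L1_cvg l i (e : R) : 0 < e -> \forall m \near \oo,
  (\int[mu]_x `|zext (exhaustion Omega l : set T) (fun x => f m x 0 i) x -
    zext (exhaustion Omega l : set T) (fun x => f0 x 0 i) x|%:E <= e%:E)%E.
Proof.
move=> e0; have [_ _ H] := cf.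
have cK := @compact_closure_exhaustion R n Omega bO l.
have KO := @closure_exhaustion R n Omega l.
have /fine_cvgP[fin /cvgrPdist_le/(_ _ e0) h] := H _ cK KO.
near=> m.
have fm : (integral_rV (closure (exhaustion Omega l))
   (fun x => (euclidean_norm (fun i => f m x 0 i - f0 x 0 i))%:E) \is a fin_num)%E by near: m.
have hm : `|0 - fine (integral_rV (closure (exhaustion Omega l))
   (fun x => (euclidean_norm (fun i => f m x 0 i - f0 x 0 i))%:E))| <= e by near: m.
apply: (@le_trans _ _ (integral_rV (closure (exhaustion Omega l))
   (fun x => (euclidean_norm (fun i => f m x 0 i - f0 x 0 i))%:E))); last first.
  by rewrite -(fineK fm) lee_fin; move: hm; rewrite sub0r normrN; apply: le_trans; exact: ler_norm.
have mV : measurable (exhaustion Omega l : set T).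
  by apply: open_lebesgue_measurable; exact: open_exhaustion.
have mK : measurable (closure (exhaustion Omega l) : set T) by apply: compact_lebesgue_measurable.
have VK : exhaustion Omega l `<=` closure (exhaustion Omega l) by exact: subset_closure.
have mB i' : measurable_fun (closure (exhaustion Omega l) : set T) ((fun x => f m x 0 i' - f0 x 0 i') : T -> R).
  apply: (measurable_funS mO KO); apply: measurable_funB.
    by have [] := lf m i'.
  by have [] := lf0 i'.
exact: (@integral_zextB_le _ T R mu _ _ _ (fun x i => f m x 0 i) (fun x i => f0 x 0 i) i mV mK VK mB).
Unshelve. all: by end_near. Qed.

Let zf0_integrable l i :
  mu.-integrable setT (EFin \o (zext (exhaustion Omega l : set T) (fun x => f0 x 0 i) : T -> R)).
Proof.
apply: (locally_integrable_zext oO (lf0 i)); first exact: open_exhaustion.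
  exact: compact_closure_exhaustion.
exact: closure_exhaustion.
Qed.

Let zf_integrable l m i :
  mu.-integrable setT (EFin \o (zext (exhaustion Omega l : set T) (fun x => f m x 0 i) : T -> R)).
Proof.
apply: (locally_integrable_zext oO (lf m i)); first exact: open_exhaustion.
  exact: compact_closure_exhaustion.
exact: closure_exhaustion.
Qed.

(** The derivative is moved to phi, where the L^1 convergence of f m suffices. The limit is
    expressed through f0 itself, whose weak differentiability is still to be proved. *)
Let gradient_pairing_cvg l i j phi : test_function (exhaustion Omega l) phi ->
  Rintegral mu setT ((fun x => zext (exhaustion Omega l : set T)
     (fun x => weak_diff Omega (f m) x i j) x * phi x) : T -> R) @[m --> \oo] -->
  - Rintegral mu setT ((fun x => zext (exhaustion Omega l : set T)
     (fun x => f0 x 0 i) x * partial j phi x) : T -> R).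
Proof.
move=> tphi; have [C C0 HC] := local_weak_diff_Lq_bounds oO bO adm lf bf q1 qp l.
have tp := test_function_partial j tphi.
have [M HM] := test_function_bounded tp.
have c := @L1_pairing_cvg _ T R mu _ _ _ M (zf_integrable l ^~ i) (zf0_integrable l i)
  (fun e e0 => exhaustion_L1_cvg l i e0) (smooth_measurable (test_function_smooth tp)) HM.
rewrite (_ : (fun m => _) = (fun m => - Rintegral mu setT ((fun x => zext (exhaustion Omega l : set T)
     (fun x => f m x 0 i) x * partial j phi x) : T -> R))); first exact: cvgN c.
by apply/funext => m; have [_ _ w] := HC m i; rewrite (w phi j tphi) opprK.
Qed.

Lemma weakly_differentiable_limit : weakly_differentiable Omega f0.
Proof.
apply: weakly_differentiable_glue => // i l.
have [C C0 HC] := local_weak_diff_Lq_bounds oO bO adm lf bf q1 qp l.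
have oV := @open_exhaustion R n Omega l; have bV := @bounded_exhaustion R n Omega bO l.
have /choice[d Hd] : forall j, exists g0 : 'rV[R]_n -> R, [/\ mu.-integrable setT (EFin \o (g0 : T -> R)),
    forall x, ~ exhaustion Omega l x -> g0 x = 0 &
    forall phi, test_function (exhaustion Omega l) phi ->
     Rintegral mu setT ((fun x => zext (exhaustion Omega l : set T)
        (fun x => weak_diff Omega (f m) x i j) x * phi x) : T -> R) @[m --> \oo] -->
     Rintegral mu setT ((fun x => g0 x * phi x) : T -> R)].
  move=> j.
  apply: (@Lq_weak_limit R n _ oV bV (fun m => zext (exhaustion Omega l : set T)
        (fun x => weak_diff Omega (f m) x i j)) q C q1 C0).
  - by move=> m; have [_ /(_ j)[] ] := HC m i.
  - by move=> m x; exact: zext_out.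
  - by move=> phi tphi; apply: cvgP; exact: gradient_pairing_cvg.
exists d; split.
- by move=> j; have [] := Hd j.
- by move=> j; have [] := Hd j.
move=> phi j tphi; have [_ _ h] := Hd j.
have E1 := cvg_lim (@Rhausdorff R) (h phi tphi).
have E2 := cvg_lim (@Rhausdorff R) (@gradient_pairing_cvg l i j phi tphi).
by rewrite -E1 E2 opprK.
Qed.

(** The constant is that of the duality bound. The pairings with bounded functions converge for f m
    by its L^1 convergence, and for the gradients by the density of test functions. *)
Lemma limit_Lq_bounds l : exists2 C : R, 0 <= C & forall i,
  let V := exhaustion Omega l in
  [/\ Lq_on V q C (zext (V : set T) (fun x => f0 x 0 i)),
    forall j, Lq_on V q C (zext (V : set T) (fun x => weak_diff Omega f0 x i j)) &
    weak_gradient V (zext (V : set T) (fun x => f0 x 0 i))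
      (fun j => zext (V : set T) (fun x => weak_diff Omega f0 x i j))].
Proof.
have [C C0 HC] := local_weak_diff_Lq_bounds oO bO adm lf bf q1 qp l.
have oV := @open_exhaustion R n Omega l; have bV := @bounded_exhaustion R n Omega bO l.
have mV : measurable (exhaustion Omega l : set T) by exact: open_lebesgue_measurable.
have Voo : (mu (exhaustion Omega l) < +oo)%E by exact: lebesgue_rV_bounded.
have wO := weak_diffP weakly_differentiable_limit.
exists (2%:R * 2%:R `^ q * C) => [|i V]; first by rewrite mulr_ge0// mulr_ge0// powR_ge0.
have wg : weak_gradient V (zext (V : set T) (fun x => f0 x 0 i))
      (fun j => zext (V : set T) (fun x => weak_diff Omega f0 x i j)).
  exact: is_weak_diff_gradient oO wO (@exhaustion_sub _ _ _ _).
have Lu : Lq_on V q (2%:R * 2%:R `^ q * C) (zext (V : set T) (fun x => f0 x 0 i)).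
  split; last by move=> x; exact: zext_out.
  have m0 : measurable_fun setT (zext (V : set T) (fun x => f0 x 0 i)).
    by have /integrableP[/measurable_EFinP] := zf0_integrable l i.
  apply: (@Lq_le_of_pairing _ T R mu V mV Voo (fun m => zext (V : set T) (fun x => f m x 0 i)) _ q C q1 _ m0).
  + by move=> m; have [[] ] := HC m i.
  + by move=> x; exact: zext_out.
  move=> chi mchi chi1 _.
  exact: (@L1_pairing_cvg _ T R mu _ _ _ 1 (zf_integrable l ^~ i) (zf0_integrable l i)
    (fun e e0 => exhaustion_L1_cvg l i e0) mchi chi1).
split; [exact: Lu| |exact: wg].
move=> j; split; last by move=> x; exact: zext_out.
have iD : mu.-integrable setT (EFin \o (zext (V : set T) (fun x => weak_diff Omega f0 x i j) : T -> R)).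
  have [_ h _] := wO; apply: (locally_integrable_zext oO (h i j) oV).
    exact: compact_closure_exhaustion.
  exact: closure_exhaustion.
have m0 : measurable_fun setT (zext (V : set T) (fun x => weak_diff Omega f0 x i j)).
  by have /integrableP[/measurable_EFinP] := iD.
have gC m : Lq_le mu q C (zext (V : set T) (fun x => weak_diff Omega (f m) x i j)).
  by have [_ /(_ j)[] ] := HC m i.
have gV m x : ~ V x -> zext (V : set T) (fun x => weak_diff Omega (f m) x i j) x = 0.
  exact: zext_out.
apply: (@Lq_le_of_pairing _ T R mu V mV Voo _ _ q C q1 gC m0).
  by move=> x; exact: zext_out.
apply: (pairing_test_bounded oV bV _ _ iD).
- by move=> m; exact: (@Lq_le_integrable _ T R mu V mV Voo q C _ (ltW q1) (gC m) (gV m)).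
- exact: (@unif_int_Lq _ T R mu nat _ q C q1 C0 gC).
move=> phi tphi; rewrite -[X in _ --> X]opprK -(wg phi j tphi).
exact: gradient_pairing_cvg.
Qed.

End limit_map.

(** * Exterior products of weak differentials *)

Section wedge_convergence.
Context {R : realType} {n k : nat}.
Local Notation mu := (@lebesgue_rV R n).
Local Notation T := (@lebesgue_space R n).
Implicit Types (U V : set 'rV[R]_n).

Lemma wedge_diffE U (F : 'rV[R]_n -> 'rV[R]_k) x J :
  wedge_diff U F x J = jac (fun i j y => weak_diff U F y i j) (val J) x.
Proof. by congr (\det _); apply/matrixP => r c; rewrite !mxE. Qed.

Lemma jac_zext (S N : Type) (V : set S) (D : 'I_k -> N -> S -> R) (J : 'I_k -> N) x :
  V x -> jac (fun i j y => if y \in V then D i j y else 0) J x = jac D J x.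
Proof. by move=> Vx; congr (\det _); apply/matrixP => r c; rewrite !mxE mem_set. Qed.

Lemma Lq_on_weaken V (q C C' : R) u : C <= C' -> Lq_on V q C u -> Lq_on V q C' u.
Proof. by move=> CC [[mu_ uC] uV]; split=> //; split=> //; apply: le_trans uC _; rewrite lee_fin. Qed.

Variables (Omega : set 'rV[R]_n).
Hypotheses (oO : open Omega) (bO : bounded_set Omega) (k0 : (0 < k)%N).

Lemma wedge_diff_measurable (F : 'rV[R]_n -> 'rV[R]_k) J : weakly_differentiable Omega F ->
  lebesgue_measurable Omega (fun x => wedge_diff Omega F x J).
Proof.
move=> /weak_diffP[_ lD _].
have mO : measurable (Omega : set T) by exact: open_lebesgue_measurable.
have mj : measurable_fun setT (jac (fun i j => zext (Omega : set T) (fun x => weak_diff Omega F x i j)) (val J) : T -> R).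
  by apply: (@measurable_jac _ T R) => i c; exact: (@measurable_zext _ T R Omega _ mO (lD i (val J c)).1).
apply: (eq_measurable_fun _ _ (measurable_funTS mj)) => x; rewrite inE => Ox.
by rewrite wedge_diffE; exact: jac_zext.
Qed.

(** A compact set lies in one member of the exhaustion, where the differential is in L^q with q >=
    k, so that products of k of its entries are integrable. *)
Lemma wedge_diff_locally_integrable (F : 'rV[R]_n -> 'rV[R]_k) (q : R) J :
  k%:R <= q -> weakly_differentiable Omega F ->
  (forall l, exists C : R, forall i j, Lq_on (exhaustion Omega l) q C
    (zext (exhaustion Omega l : set T) (fun x => weak_diff Omega F x i j))) ->
  locally_integrable_rV Omega (fun x => wedge_diff Omega F x J).
Proof.
move=> kq wF HF; split; first exact: wedge_diff_measurable.
move=> K cK KO; have [l Kl] := compact_exhausted oO cK KO; have [C HC] := HF l.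
have oV := @open_exhaustion R n Omega l; have bV := @bounded_exhaustion R n Omega bO l.
have mK : measurable (K : set T) by apply: compact_lebesgue_measurable.
have ij : mu.-integrable setT (EFin \o (jac (fun i j => zext (exhaustion Omega l : set T)
    (fun x => weak_diff Omega F x i j)) (val J) : T -> R)).
  move: (val J : 'I_k -> 'I_n) => J'; move: k0 kq F wF HF HC J' {J}.
  case: k => // k' _ kq F wF HF HC J'.
  apply: (@jac_Lk_on_integrable R n (exhaustion Omega l)) => i j.
  exact: (Lq_on_Lk_on oV bV kq (HC i j)).
rewrite /integral_rV (eq_integral (fun x => `|jac (fun i j => zext (exhaustion Omega l : set T)
    (fun x => weak_diff Omega F x i j)) (val J) x|%:E)).
  exact: (@integrable_fin_on _ T R mu K _ mK ij).
by move=> x; rewrite inE => Kx; rewrite wedge_diffE -(@jac_zext _ _ (exhaustion Omega l))//; exact: Kl.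
Qed.

(** As phi vanishes off V, the minors may be computed from the differential extended by zero from V,
    where its L^q bounds hold. *)
Lemma wedge_diff_pairing (F : 'rV[R]_n -> 'rV[R]_k) J V phi : V `<=` Omega ->
  test_function V phi ->
  Rintegral_rV Omega (fun x => wedge_diff Omega F x J * phi x) =
  Rintegral mu setT ((fun x => phi x * jac (fun i j => zext (V : set T)
    (fun x => weak_diff Omega F x i j)) (val J) x) : T -> R).
Proof.
move=> VO tphi; rewrite /Rintegral_rV Rintegral_zext; last exact: open_lebesgue_measurable.
apply: eq_Rintegral => x _; have [Vx|Vx] := pselect (V x).
  rewrite /zext (mem_set (VO _ Vx)) wedge_diffE mulrC; congr (_ * _).
  by rewrite jac_zext.
by rewrite (test_function_out tphi Vx) mul0r /zext mulr0; case: ifP.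
Qed.

End wedge_convergence.

Section distributional_convergence.
Context {R : realType} {n k : nat}.
Local Notation mu := (@lebesgue_rV R n).
Local Notation T := (@lebesgue_space R n).
Variables (Omega : set 'rV[R]_n) (p : R) (delta : R -> R).
Variables (f : nat -> 'rV[R]_n -> 'rV[R]_k) (f0 : 'rV[R]_n -> 'rV[R]_k).

Theorem wedge_diff_cvg_distribution J : open Omega -> bounded_set Omega -> (0 < k)%N ->
  k%:R < p -> admissible p delta ->
  locally_bounded_grand_sobolev Omega p delta f -> cvg_L1loc Omega f f0 ->
  cvg_distribution Omega (fun m x => wedge_diff Omega (f m) x J)
    (fun x => wedge_diff Omega f0 x J).
Proof.
(* The midpoint of k and p; the same q serves all orders in the induction on minors. *)
move=> oO bO k0 kp adm bf cf; pose q : R := (k%:R + p) / 2.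
have kq : k%:R < q by rewrite /q; lra.
have qp : q < p by rewrite /q; lra.
have q1 : 1 < q by apply: le_lt_trans kq; rewrite ler1n.
have lf : forall m i, locally_integrable_rV Omega (fun x => f m x 0 i) by case: cf.
have wf m := weakly_differentiable_bounded oO bO adm lf bf q1 qp m.
have wf0 := weakly_differentiable_limit oO bO adm bf cf q1 qp.
split.
- move=> m; apply: (wedge_diff_locally_integrable oO bO k0 J (ltW kq) (wf m)) => l.
  have [C _ HC] := local_weak_diff_Lq_bounds oO bO adm lf bf q1 qp l.
  by exists C => i j; have [_ h _] := HC m i; exact: h.
- apply: (wedge_diff_locally_integrable oO bO k0 J (ltW kq) wf0) => l.
  have [C _ HC] := limit_Lq_bounds oO bO adm bf cf q1 qp l.
  by exists C => i j; have [_ h _] := HC i; exact: h.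
move=> phi tphi; have [sphi cphi suppO] := tphi.
have [l Kl] := compact_exhausted oO cphi suppO.
have tl : test_function (exhaustion Omega l) phi by split.
have VO := @exhaustion_sub R n Omega l.
have [C1 C10 HC1] := local_weak_diff_Lq_bounds oO bO adm lf bf q1 qp l.
have [C2 C20 HC2] := limit_Lq_bounds oO bO adm bf cf q1 qp l.
(* [minors_weak_continuity] uses a single constant for the sequence and its limit. *)
have C12 : C1 <= C1 + C2 by rewrite lerDl.
have C21 : C2 <= C1 + C2 by rewrite lerDr.
rewrite (wedge_diff_pairing oO _ _ VO tl).
under eq_fun do rewrite (wedge_diff_pairing oO _ _ VO tl).
apply: (@minors_weak_continuity R n (exhaustion Omega l) (@open_exhaustion _ _ _ l)
  (@bounded_exhaustion _ _ _ bO l) k q (C1 + C2)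
  (fun m i => zext (exhaustion Omega l : set T) (fun x => f m x 0 i)) _
  (fun i => zext (exhaustion Omega l : set T) (fun x => f0 x 0 i)) _ _ _ kq).
- exact: addr_ge0.
- by move=> m i; have [h _ _] := HC1 m i; exact: Lq_on_weaken h.
- by move=> m i j; have [_ h _] := HC1 m i; exact: Lq_on_weaken (h j).
- by move=> i; have [h _ _] := HC2 i; exact: Lq_on_weaken h.
- by move=> i j; have [_ h _] := HC2 i; exact: Lq_on_weaken (h j).
- by move=> m i; have [_ _ h] := HC1 m i.
- by move=> i; have [_ _ h] := HC2 i.
- by move=> i e e0; exact: exhaustion_L1_cvg.
- exact: tl.
Qed.

End distributional_convergence.

(** * Grand norm of the minors *)

Section wedge_bounds.
Context {R : realType}.

(** The Leibniz formula has k! terms, counted by [#|{: 'S_k}|]. *)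
Lemma normr_minor_le (k n : nat) (M : 'I_k -> 'I_n -> R) (J : 'I_k -> 'I_n) (e : R) :
  0 <= e -> (forall i j, `|M i j| <= e) ->
  `|\det (\matrix_(r < k, c < k) M r (J c))| <= #|{: 'S_k}|%:R * e ^+ k.
Proof.
move=> e0 Me; apply: (le_trans (ler_norm_sum _ _ _)).
rewrite mulr_natl -sumr_const; apply: ler_sum => s _.
rewrite normrM normr_sign mul1r normr_prod -[X in _ ^+ X]card_ord -prodr_const.
by apply: ler_prod => i _; rewrite normr_ge0 mxE Me.
Qed.

Lemma euclidean_norm_le_const (I : finType) (v : I -> R) (b : R) : 0 <= b ->
  (forall i, `|v i| <= b) -> euclidean_norm v <= Num.sqrt #|I|%:R * b.
Proof.
move=> b0 vb; have bE : b = Num.sqrt (b ^+ 2) by rewrite sqrtr_sqr ger0_norm.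
rewrite /euclidean_norm [X in _ * X]bE -sqrtrM//.
rewrite ler_wsqrtr// mulr_natl -sumr_const; apply: ler_sum => i _.
by rewrite -real_normK ?num_real// lerXn2r ?nnegrE.
Qed.

(** Raising to the power s gives a <= b^(s/t), and b^(s/t) <= b because s/t >= 1 and b <= 1. It is
    meant for a = delta(e) and b = delta(k e). *)
Lemma powR_le_of_roots (a b s t : R) : 0 < a -> 0 < b <= 1 -> 0 < t -> t <= s ->
  a `^ s^-1 <= b `^ t^-1 -> a <= b.
Proof.
move=> a0 b01 t0 ts H; have s0 : 0 < s by exact: lt_le_trans ts.
have /andP[b0 b1] := b01.
have -> : a = (a `^ s^-1) `^ s by rewrite -powRrM mulVf ?gt_eqF// powRr1// ltW.
apply: (@le_trans _ _ ((b `^ t^-1) `^ s)).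
  by rewrite ge0_ler_powR ?nnegrE ?powR_ge0// ltW.
rewrite -powRrM -[leRHS]powRr1 ?(ltW b0)//; apply: ger_powR => //.
by rewrite mulrC ler_pdivlMr// mul1r.
Qed.

End wedge_bounds.

Section euclidean_norm_integrals.
Context d (T : measurableType d) (R : realType) (mu : {measure set T -> \bar R}).

Lemma integral_euclidean_norm_ae_eq (I : finType) (V : set T) (g h : T -> I -> R) (r : R) :
  measurable V -> (forall i, measurable_fun V (g ^~ i)) -> (forall i, measurable_fun V (h ^~ i)) ->
  {ae mu, forall x, V x -> forall i, g x i = h x i} ->
  (\int[mu]_(x in V) (euclidean_norm (g x) `^ r)%:E =
   \int[mu]_(x in V) (euclidean_norm (h x) `^ r)%:E)%E.
Proof.
move=> mV mg mh gh; apply: ae_eq_integral => //; try exact: measurable_powR_euclidean_norm.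
move: gh; apply: filterS => x gh /gh{}gh.
by congr ((Num.sqrt _ `^ _)%:E); apply: eq_bigr => i _; rewrite gh.
Qed.

Lemma integral_euclidean_norm_le (I I' : finType) (V : set T) (g : T -> I -> R)
    (h : T -> I' -> R) (A s : R) (k : nat) :
  measurable V -> (forall i, measurable_fun V (g ^~ i)) -> (forall i, measurable_fun V (h ^~ i)) ->
  0 <= A -> 0 < s -> (forall x, euclidean_norm (g x) <= A * euclidean_norm (h x) ^+ k) ->
  (\int[mu]_(x in V) (euclidean_norm (g x) `^ s)%:E <=
   (A `^ s)%:E * \int[mu]_(x in V) (euclidean_norm (h x) `^ (k%:R * s))%:E)%E.
Proof.
move=> mV mg mh A0 s0 gh.
have mhr := measurable_powR_euclidean_norm (k%:R * s) mh.
rewrite -ge0_integralZl//; last 2 first.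
- by move=> x _; rewrite lee_fin powR_ge0.
- by rewrite lee_fin powR_ge0.
apply: ge0_le_integral => //.
- by move=> x _; rewrite lee_fin powR_ge0.
- exact: measurable_powR_euclidean_norm.
- exact: emeasurable_funM.
move=> x _; rewrite -EFinM lee_fin powRrM powR_mulrn ?euclidean_norm_ge0//.
rewrite -powRM ?exprn_ge0 ?euclidean_norm_ge0//.
by rewrite ge0_ler_powR ?nnegrE ?(ltW s0) ?mulr_ge0 ?exprn_ge0 ?euclidean_norm_ge0.
Qed.

End euclidean_norm_integrals.

Section wedge_grand_norm.
Context {R : realType} {n k : nat}.
Local Notation mu := (@lebesgue_rV R n).
Local Notation T := (@lebesgue_space R n).
Variables (Omega : set 'rV[R]_n) (p : R) (delta : R -> R).
Variable f : nat -> 'rV[R]_n -> 'rV[R]_k.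

(** The Euclidean norm over the multi-indices costs the square root of their number, and each minor
    is at most k! times the k-th power of the norm of the differential. *)
Let A : R := Num.sqrt #|multi_index (n := n) (k := k)|%:R * #|{: 'S_k}|%:R.

Let A_ge0 : 0 <= A.
Proof. by rewrite mulr_ge0 ?sqrtr_ge0. Qed.

Lemma wedge_diff_norm_le U (F : 'rV[R]_n -> 'rV[R]_k) x :
  euclidean_norm (wedge_diff U F x) <= A * euclidean_norm (mx_coefs (weak_diff U F) x) ^+ k.
Proof.
rewrite /A -mulrA; apply: euclidean_norm_le_const => [|J].
  by rewrite mulr_ge0 ?exprn_ge0 ?euclidean_norm_ge0.
rewrite wedge_diffE /jac.
apply: (@normr_minor_le R k n (fun i j => weak_diff U F x i j) (val J)) => [|i j].
  exact: euclidean_norm_ge0.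
exact: (normr_le_euclidean_norm (mx_coefs (weak_diff U F) x) (i, j)).
Qed.

Hypotheses (oO : open Omega) (bO : bounded_set Omega) (adm : admissible p delta).
Hypothesis lf : forall m i, locally_integrable_rV Omega (fun x => f m x 0 i).
Hypothesis bf : locally_bounded_grand_sobolev Omega p delta f.
Hypotheses (k0 : (0 < k)%N) (kp : k%:R < p).

Let k1 : 1 <= k%:R :> R. Proof. by rewrite ler1n. Qed.

(** The exponent p / k - e for the minors corresponds to p - k e for the differential: the norm of
    the latter is used at the parameter k e, whereas the weight of the minors is taken at e. *)
Lemma admissible_dilation (e : R) : e \in `]0, p / k%:R - 1[ ->
  (k%:R * e \in `]0, p - 1[) /\ delta e <= delta (k%:R * e).
Proof.
rewrite in_itv/= => /andP[e0 ek].
have k_gt0 : 0 < k%:R :> R by rewrite ltr0n.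
have kek : k%:R * e < p - k%:R.
  by move: ek; rewrite ltrBrDr ltr_pdivlMr// => h; lra.
have ek1 : e <= k%:R * e by rewrite ler_peMl// ltW.
have ke0 : 0 < k%:R * e by rewrite mulr_gt0.
have i1 : k%:R * e \in `]0, p - 1[ by rewrite in_itv/= ke0/=; move: k1; lra.
have i2 : e \in `]0, p - 1[ by rewrite in_itv/= e0/=; move: k1; lra.
split=> //.
have /andP[d0 _] := admissible_range adm i2.
apply: (@powR_le_of_roots _ _ _ (p - e) (p - k%:R * e)) => //.
- exact: admissible_range adm _ i1.
- by move: k1; lra.
- by rewrite lerD2l lerN2.
exact: (admissible_nondecreasing adm i2 i1 ek1).
Qed.

(** The pointwise bound on the minors concerns [weak_diff Omega (f m)], the grand norm in the
    hypothesis [weak_diff U (f m)]. *)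
Lemma weak_diff_norm_ae_local U m (q r : R) : compactly_inside U Omega -> 1 < q -> q < p ->
  (\int[mu]_(x in U) (euclidean_norm (mx_coefs (weak_diff Omega (f m)) x) `^ r)%:E =
   \int[mu]_(x in U) (euclidean_norm (mx_coefs (weak_diff U (f m)) x) `^ r)%:E)%E.
Proof.
move=> cU q1 qp; have [oU _ _ _] := cU.
have mU : measurable (U : set T) by exact: open_lebesgue_measurable.
have mO : measurable (Omega : set T) by exact: open_lebesgue_measurable.
have Uoo : (mu U < +oo)%E.
  by apply: lebesgue_rV_bounded; exact: (compactly_inside_bounded bO cU).
have [C C0 /(_ m)[wU _ Ld]] := local_Lq_bounds bO adm bf q1 qp cU.
have wO := weakly_differentiable_bounded oO bO adm lf bf q1 qp m.
have [_ lO _] := weak_diffP wO; have [_ lU _] := weak_diffP wU.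
have ae1 i j : {ae mu, forall x, zext (U : set T) (fun x => weak_diff Omega (f m) x i j) x =
                    zext (U : set T) (fun x => weak_diff U (f m) x i j) x}.
  have [h1 h2] := Ld i j.
  apply: (weak_diff_ae_local oO bO adm lf bf q1 qp cU wU).
  exact: (@Lq_le_integrable _ T R mu U mU Uoo q C _ (ltW q1) h1 h2).
have aeD : {ae mu, forall x, forall ij : 'I_k * 'I_n,
    zext (U : set T) (fun x => weak_diff Omega (f m) x ij.1 ij.2) x =
    zext (U : set T) (fun x => weak_diff U (f m) x ij.1 ij.2) x}.
  by apply: (@filter_forall _ _ _ _ (ae_filter_ringOfSetsType mu)) => ij; exact: ae1.
have UO := compactly_inside_sub cU.
apply: (@integral_euclidean_norm_ae_eq _ T R mu _ U _ _ r mU).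
- by move=> ij; apply: (measurable_funS mO UO); case: (lO ij.1 ij.2).
- by move=> ij; case: (lU ij.1 ij.2).
move: aeD; apply: (@filterS _ _ (ae_filter_ringOfSetsType mu)) => x h Ux ij.
by have := h ij; rewrite /zext (mem_set Ux).
Qed.

Theorem wedge_diff_locally_bounded :
  locally_bounded_grand_lebesgue Omega (p / k%:R) delta (fun m => wedge_diff Omega (f m)).
Proof.
move=> U cU; have [M HM] := bf cU.
have k_gt0 : 0 < k%:R :> R by rewrite ltr0n.
have [oU U0 _ _] := cU; have bU := compactly_inside_bounded bO cU.
have UO := compactly_inside_sub cU.
have mU : measurable (U : set T) by exact: open_lebesgue_measurable.
have mO : measurable (Omega : set T) by exact: open_lebesgue_measurable.
(* The bound to be proved does not involve q; any value between 1 and p gives access to the local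
   results. *)
have [q q1 qp] : exists2 q : R, 1 < q & q < p by exists ((1 + p) / 2); move: k1 kp; lra.
have fU : (mu U \is a fin_num)%E by rewrite ge0_fin_numE//; exact: lebesgue_rV_bounded.
have U1 : 0 < fine (mu U) by rewrite -lte_fin fineK//; exact: lebesgue_rV_open_gt0.
exists (A * `|M| ^+ k) => m; have [[wU gf gd] nM] := HM m.
have wO := weakly_differentiable_bounded oO bO adm lf bf q1 qp m.
have nD : (grand_norm U p delta (mx_coefs (weak_diff U (f m))) <= `|M|%:E)%E.
  apply: le_trans (_ : M%:E <= _)%E; last by rewrite lee_fin ler_norm.
  apply: le_trans nM; rewrite leeDr//; exact: (grand_norm_ge0 _ q1 qp).
have mW J : lebesgue_measurable U (fun x => wedge_diff Omega (f m) x J).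
  exact: (measurable_funS mO UO (wedge_diff_measurable oO J wO)).
suff nW : (grand_norm U (p / k%:R) delta (wedge_diff Omega (f m)) <= (A * `|M| ^+ k)%:E)%E.
  by split=> //; split=> //; apply: le_lt_trans nW _; rewrite ltry.
apply: ge_ereal_sup => _ [e /= eI <-].
have [keI dle] := admissible_dilation eI.
move: eI; rewrite in_itv/= => /andP[e0 ek].
set s := p / k%:R - e; have s1 : 1 < s by rewrite /s; lra.
have s0 : 0 < s by apply: lt_trans s1.
have rE : k%:R * s = p - k%:R * e by rewrite /s mulrBr mulrCA divff ?gt_eqF// mulr1.
have r1 : 1 < k%:R * s by rewrite (lt_le_trans s1)// ler_peMl// ltW.
have rp : k%:R * s < p by rewrite rE ltrBlDr ltrDl mulr_gt0.
have /andP[dk0 _] := admissible_range adm keI.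
have d0 : 0 < delta e.
  have ei : e \in `]0, p - 1[.
    by move: keI; rewrite !in_itv/= e0 => /andP[_]; apply: le_lt_trans; rewrite ler_peMl// ltW.
  by have /andP[] := admissible_range adm ei.
have key : (\int[mu]_(x in U) (euclidean_norm (wedge_diff Omega (f m) x) `^ s)%:E <=
    (A `^ s * (`|M| `^ (k%:R * s) * (fine (mu U) / delta (k%:R * e))))%:E)%E.
  have [_ lO _] := weak_diffP wO.
  have mD (ij : 'I_k * 'I_n) : measurable_fun (U : set T) ((fun x => mx_coefs (weak_diff Omega (f m)) x ij) : T -> R).
    by apply: (measurable_funS mO UO); case: (lO ij.1 ij.2).
  apply: (le_trans (@integral_euclidean_norm_le _ T R mu _ _ U _ _ A s k mU mW mD A_ge0 s0
    (wedge_diff_norm_le Omega (f m)))).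
  rewrite EFinM lee_wpmul2l ?lee_fin ?powR_ge0//.
  rewrite (weak_diff_norm_ae_local m _ cU q1 qp).
  have := grand_norm_integral_le oU bU U0 adm r1 rp (normr_ge0 M) nD.
  by rewrite (_ : p - k%:R * s = k%:R * e)// rE subKr.
rewrite /integral_rV.
apply: (@le_trans _ _ (((A * `|M| ^+ k) `^ s)%:E `^ s^-1)%E); last first.
  by rewrite poweR_EFin -powRrM mulfV ?gt_eqF// powRr1// mulr_ge0 ?exprn_ge0.
apply: gt0_ler_poweR.
- by rewrite invr_ge0 ltW.
- rewrite in_itv/= leey andbT mule_ge0 ?lee_fin ?divr_ge0 ?(ltW d0) ?(ltW U1)//.
  by apply: integral_ge0 => x _; rewrite lee_fin powR_ge0.
- by rewrite in_itv/= leey andbT lee_fin powR_ge0.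
apply: (@le_trans _ _ ((delta e / fine (mu U))%:E *
    (A `^ s * (`|M| `^ (k%:R * s) * (fine (mu U) / delta (k%:R * e))))%:E)%E).
  by rewrite lee_wpmul2l ?lee_fin ?divr_ge0 ?(ltW d0) ?(ltW U1).
rewrite -EFinM lee_fin powRM ?exprn_ge0// -[in leRHS]powR_mulrn// -powRrM.
(* The volume cancels, and only the factor delta(e) / delta(k e) <= 1 remains. *)
have -> : delta e / fine (mu U) * (A `^ s * (`|M| `^ (k%:R * s) * (fine (mu U) / delta (k%:R * e)))) =
    A `^ s * `|M| `^ (k%:R * s) * (delta e / delta (k%:R * e)).
  by field; rewrite !gt_eqF.
by rewrite ler_piMr ?mulr_ge0 ?powR_ge0// ler_pdivrMr// mul1r.
Qed.

End wedge_grand_norm.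

Theorem theorem1p1 (R : realType) (n k : nat) (Omega : set 'rV[R]_n)
    (p : R) (delta : R -> R)
    (f : nat -> 'rV[R]_n -> 'rV[R]_k) (f0 : 'rV[R]_n -> 'rV[R]_k) :
  (1 <= n)%N -> open Omega -> bounded_set Omega ->
  (1 <= k <= n)%N -> k%:R < p ->
  admissible p delta ->
  locally_bounded_grand_sobolev Omega p delta f ->
  cvg_L1loc Omega f f0 ->
  [/\ (forall m, weakly_differentiable Omega (f m)),
      weakly_differentiable Omega f0,
      (forall J, cvg_distribution Omega
         (fun m x => wedge_diff Omega (f m) x J)
         (fun x => wedge_diff Omega f0 x J)) &
      locally_bounded_grand_lebesgue Omega (p / k%:R) delta
        (fun m => wedge_diff Omega (f m))].
Proof.
move=> _ oO bO /andP[k0 _] kp adm bf cf.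
have k1 : 1 <= k%:R :> R by rewrite ler1n.
have [q q1 qp] : exists2 q : R, 1 < q & q < p by exists ((1 + p) / 2); move: k1 kp; lra.
have lf : forall m i, locally_integrable_rV Omega (fun x => f m x 0 i) by case: cf.
split.
- by move=> m; exact: (weakly_differentiable_bounded oO bO adm lf bf q1 qp).
- exact: (weakly_differentiable_limit oO bO adm bf cf q1 qp).
- by move=> J; exact: (wedge_diff_cvg_distribution J oO bO k0 kp adm bf cf).
- exact: (wedge_diff_locally_bounded oO bO adm lf bf k0 kp).
Qed.
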